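(* Let $\rho$ be a real quadratic irrationality, and let $a,b,s$ be integers with $s \geq \max(a,b,1)+1$. If $s$ and $b$ have the same parity, then $$\psi^{a,b}_s(\rho)=\sum_{n=1}^{\infty}\frac{\sec^a(\pi n\rho)\csc^b(\pi n\rho)}{n^s}\in \pi^s\,\mathbb{Q}(\rho).$$ Moreover, if in addition $\rho^2\in\mathbb{Q}$ and $a+b\geq 0$, then $\psi^{a,b}_s(\rho)\in(\pi\rho)^s\,\mathbb{Q}$.
   Context: For integers $a,b$, $\operatorname{trig}^{a,b}=\sec^a\csc^b$, and $\psi^{a,b}_s(\tau)=\sum_{n\ge1}\operatorname{trig}^{a,b}(\pi n\tau)/n^s$. Under the stated hypotheses this series converges absolutely at $\tau=\rho$. A real quadratic irrationality is a real irrational root of a quadratic polynomial with rational coefficients. *)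

(* Defs.v *)
From Stdlib Require Import Reals QArith ZArith List.
From Coquelicot Require Import Coquelicot.
Open Scope R_scope.

Definition trig (a b : Z) (x : R) : R :=
  powerRZ (/ cos x) a * powerRZ (/ sin x) b.

Definition psi_term (a b s : Z) (tau : R) (k : nat) : R :=
  let n := INR (S k) in trig a b (PI * n * tau) / powerRZ n s.

Definition quad_irrational (rho : R) : Prop :=
  (exists p q r : Q, ~ (p == 0)%Q /\
     Q2R p * rho ^ 2 + Q2R q * rho + Q2R r = 0) /\
  ~ (exists x : Q, Q2R x = rho).

Fixpoint Qpoly_eval (P : list Q) (x : R) : R :=
  match P with
  | nil => 0
  | c :: P' => Q2R c + x * Qpoly_eval P' x
  end.

Definition in_Q_adj (rho v : R) : Prop :=
  exists P D : list Q, Qpoly_eval D rho <> 0 /\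
    v = Qpoly_eval P rho / Qpoly_eval D rho.

(* Main.v *)
(** The partial fraction expansions of cot, csc, tan and sec turn the series into lattice sums
    L(tau) = sum over (m, n) of 1 / ((n + b)^s (m + a + (n + b) tau)^j) with a, b in Z/4.
    Writing x = m + a + (n + b) tau, the decomposition of 1 / (x^j (m + a - x)^s) into partial fractions,
    summed over squares |m|, |n| <= N, expresses L(tau) through L(1 / tau), through sums of the same weight
    s + j with smaller j, and through products of one-dimensional sums, which are rational multiples of powers of pi.
    The series also behave well under tau -> tau + 1, so the continued fraction algorithm applies.
    As tau is quadratic, a pair (tau, (a, b)) recurs (Lagrange), and going round the cycle gives L = kappa L + r with
    |kappa| < 1 and kappa, r / pi^(s + j) in Q(tau); hence L is in pi^(s + j) Q(tau). Carrying tau and its conjugate along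
    simultaneously shows that the value at the conjugate is the conjugate value, which gives the second claim, since
    rho -> - rho multiplies the series by (-1)^s. For a + b < 0 there also occur series
    sum of cos(k pi n rho) / n^s or sin(k pi n rho) / n^s, which are Bernoulli polynomials. *)

Require Import Defs.
From Stdlib Require Import Reals QArith ZArith List Lra Lia Psatz FinFun Classical.
From Coquelicot Require Import Coquelicot.
Open Scope R_scope.

(** * Symmetric sums *)

(** When [j = 1] the double series converges only conditionally, and reciprocity interchanges [m]
    and [n]; so the sums over squares must be shown to have the iterated sum as limit. This is
    dominated convergence in [n], and the dominating function comes from bad approximability of
    quadratic irrationals: the inner sums are bounded by a multiple of sqrt |n| / |sin|^j uniformly
    in [N], and division by n^s with s >= j + 1 leaves a series of the shape n^(-3/2) / |sin (pi q
    tau)|, which converges because small values of the sine are far apart. The same inequality s >=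
    j + 1 gives the contraction: for 0 < t < 1 the multiplier of one inversion is, up to sign,
    t^(s-j). On the conjugate side the multiplier may be large; there one divides by 1 - kappa',
    which is nonzero as the conjugate of 1 - kappa. Quarter shifts suffice because powers of
    tangent, secant and cosecant are polynomials in cotangents of half the angle at shifts by
    multiples of 1/4, and the cotangents at these shifts themselves are 1, 0 and -1, hence
    rational. *)

Fixpoint zs (N : nat) (f : Z -> R) : R :=
  match N with
  | O => f 0%Z
  | S M => zs M f + (f (Z.of_nat (S M)) + f (- Z.of_nat (S M))%Z)
  end.

Notation zlim f l := (is_lim_seq (fun N => zs N f) l).

Lemma lim_scal (c l : R) (u : nat -> R) : is_lim_seq u l -> is_lim_seq (fun N => c * u N) (c * l).
Proof. apply is_lim_seq_mult', is_lim_seq_const. Qed.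

Lemma zs_ext_in (N : nat) (f g : Z -> R) :
  (forall m, (Z.abs m <= Z.of_nat N)%Z -> f m = g m) -> zs N f = zs N g.
Proof.
  induction N as [|N IH]; intros H; cbn [zs].
  - apply H; simpl; lia.
  - rewrite IH by (intros; apply H; lia). rewrite !H by lia. reflexivity.
Qed.

Lemma zs_ext (N : nat) (f g : Z -> R) : (forall m, f m = g m) -> zs N f = zs N g.
Proof. intros H; apply zs_ext_in; auto. Qed.

Lemma zs_plus (N : nat) (f g : Z -> R) : zs N (fun m => f m + g m) = zs N f + zs N g.
Proof. induction N; cbn [zs]; [reflexivity|]. rewrite IHN. ring. Qed.

Lemma zs_scal (N : nat) (c : R) (f : Z -> R) : zs N (fun m => c * f m) = c * zs N f.
Proof. induction N; cbn [zs]; [reflexivity|]. rewrite IHN. ring. Qed.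

Lemma zs_swap (N M : nat) (f : Z -> Z -> R) :
  zs N (fun n => zs M (fun m => f n m)) = zs M (fun m => zs N (fun n => f n m)).
Proof.
  induction N; cbn [zs]; [reflexivity|]. rewrite IHN, !zs_plus. reflexivity.
Qed.

Lemma zs_le (N : nat) (f g : Z -> R) :
  (forall m, (Z.abs m <= Z.of_nat N)%Z -> f m <= g m) -> zs N f <= zs N g.
Proof.
  induction N as [|N IH]; intros H; cbn [zs].
  - apply H; simpl; lia.
  - assert (zs N f <= zs N g) by (apply IH; intros; apply H; lia).
    assert (f (Z.of_nat (S N)) <= g (Z.of_nat (S N))) by (apply H; lia).
    assert (f (- Z.of_nat (S N))%Z <= g (- Z.of_nat (S N))%Z) by (apply H; lia).
    lra.
Qed.

Lemma zs_abs (N : nat) (f : Z -> R) : Rabs (zs N f) <= zs N (fun m => Rabs (f m)).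
Proof.
  induction N; cbn [zs]; [lra|].
  eapply Rle_trans; [apply Rabs_triang|]. apply Rplus_le_compat; [exact IHN|apply Rabs_triang].
Qed.

Lemma zs_const (N : nat) (c : R) : zs N (fun _ => c) = (2 * INR N + 1) * c.
Proof. induction N; cbn [zs]; [simpl; ring|]. rewrite IHN, S_INR. ring. Qed.

Lemma zs_opp (N : nat) (f : Z -> R) : zs N (fun m => f (- m)%Z) = zs N f.
Proof.
  induction N; cbn [zs]; [reflexivity|]. rewrite IHN, Z.opp_involutive. ring.
Qed.

Lemma zs_shift (N : nat) (f : Z -> R) :
  zs N (fun m => f (m + 1)%Z) = zs N f + f (Z.of_nat N + 1)%Z - f (- Z.of_nat N)%Z.
Proof.
  induction N as [|N IH]; cbn [zs].
  - replace (0 + 1)%Z with 1%Z by lia. change (Z.of_nat 0) with 0%Z. simpl (- 0)%Z.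
    replace (0 + 1)%Z with 1%Z by lia. lra.
  - rewrite IH. replace (- Z.of_nat (S N) + 1)%Z with (- Z.of_nat N)%Z by lia.
    replace (Z.of_nat N + 1)%Z with (Z.of_nat (S N)) by lia. ring.
Qed.

Lemma zs_incr (f : Z -> R) : (forall m, 0 <= f m) -> forall N M, (N <= M)%nat -> zs N f <= zs M f.
Proof.
  intros Hf N M H; induction H; [lra|]. cbn [zs].
  generalize (Hf (Z.of_nat (S m))) (Hf (- Z.of_nat (S m))%Z); lra.
Qed.

Lemma zs_sum (N : nat) (f : Z -> R) :
  zs (S N) f = f 0%Z + sum_n (fun k => f (Z.of_nat (S k)) + f (- Z.of_nat (S k))%Z) N.
Proof.
  induction N.
  - rewrite sum_O. reflexivity.
  - rewrite sum_Sn. change (zs (S (S N)) f) with (zs (S N) f + (f (Z.of_nat (S (S N))) + f (- Z.of_nat (S (S N)))%Z)).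
    rewrite IHN. unfold plus; simpl; ring.
Qed.

Lemma ex_lim_seq_zs_bounded (g : Z -> R) (B : R) :
  (forall m, 0 <= g m) -> (forall N, zs N g <= B) -> ex_finite_lim_seq (fun N => zs N g).
Proof.
  intros Hg HB. apply ex_finite_lim_seq_incr with B; [|exact HB].
  intros n. apply zs_incr; auto.
Qed.

(** Dominated convergence in which the number of terms and the terms move together with [N]; this is
    what turns sums over growing squares into iterated sums. *)
Lemma zs_tannery (F : nat -> Z -> R) (f g : Z -> R) (B : R) :
  (forall m, is_lim_seq (fun N => F N m) (f m)) ->
  (forall N m, Rabs (F N m) <= g m) ->
  (forall N, zs N g <= B) ->
  exists l : R, zlim f l /\ is_lim_seq (fun N => zs N (F N)) l.
Proof.
  intros Hlim Hdom HB.
  assert (Hg : forall m, 0 <= g m).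
  { intros m; eapply Rle_trans; [apply Rabs_pos|apply (Hdom O m)]. }
  assert (Hf : forall m, Rabs (f m) <= g m).
  { intros m. assert (L := is_lim_seq_abs _ _ (Hlim m)).
    refine (is_lim_seq_le _ _ _ _ _ L (is_lim_seq_const (g m))). intros N; apply Hdom. }
  destruct (ex_lim_seq_zs_bounded g B Hg HB) as [G HG].
  assert (HGle : forall N, zs N g <= G).
  { intros N. apply (is_lim_seq_incr_compare _ _ HG).
    intros n; apply zs_incr; auto. }
  (* Beyond [K] every function dominated by [g] is controlled by the tail of [g]; applied to [f] and
     to each [F n], this reduces the claim to the finitely many terms with |m| <= K. *)
  assert (tail : forall (h : Z -> R) K N, (forall m, Rabs (h m) <= g m) -> (K <= N)%nat ->
            Rabs (zs N h - zs K h) <= zs N g - zs K g).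
  { intros h K N Hh HKN. induction HKN.
    - rewrite !Rminus_diag, Rabs_R0; lra.
    - cbn [zs].
      replace (zs m h + (h (Z.of_nat (S m)) + h (- Z.of_nat (S m))%Z) - zs K h)
        with ((zs m h - zs K h) + (h (Z.of_nat (S m)) + h (- Z.of_nat (S m))%Z)) by ring.
      eapply Rle_trans; [apply Rabs_triang|].
      assert (Rabs (h (Z.of_nat (S m)) + h (- Z.of_nat (S m))%Z) <= g (Z.of_nat (S m)) + g (- Z.of_nat (S m))%Z).
      { eapply Rle_trans; [apply Rabs_triang|]. apply Rplus_le_compat; apply Hh. }
      lra. }
  assert (fin : forall K, is_lim_seq (fun N => zs K (F N)) (zs K f)).
  { induction K; cbn [zs]; [apply Hlim|].
    apply (is_lim_seq_plus' _ _ _ _ IHK). apply (is_lim_seq_plus' _ _ _ _ (Hlim _) (Hlim _)). }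
  assert (exf : ex_finite_lim_seq (fun N => zs N f)).
  { apply ex_lim_seq_cauchy_corr. intros eps.
    apply is_lim_seq_spec in HG. destruct (HG (pos_div_2 eps)) as [K HK].
    exists K. intros n m Hn Hm.
    replace (zs n f - zs m f) with ((zs n f - zs K f) - (zs m f - zs K f)) by ring.
    assert (H1 := tail f K n Hf Hn). assert (H2 := tail f K m Hf Hm).
    assert (H3 := HK K (Nat.le_refl K)). simpl in H3. apply Rabs_def2 in H3.
    assert (H4 := HGle n). assert (H5 := HGle m).
    eapply Rle_lt_trans; [apply Rabs_triang|]. rewrite Rabs_Ropp. lra. }
  destruct exf as [l Hl]. exists l; split; [exact Hl|].
  apply is_lim_seq_spec. intros eps.
  assert (e4 : 0 < eps / 4) by (destruct eps; simpl; lra).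
  apply is_lim_seq_spec in HG. destruct (HG (mkposreal _ e4)) as [K HK].
  assert (Hl' := Hl). apply is_lim_seq_spec in Hl'. destruct (Hl' (mkposreal _ e4)) as [K2 HK2].
  assert (fK := fin K). apply is_lim_seq_spec in fK. destruct (fK (mkposreal _ e4)) as [K3 HK3].
  exists (max K (max K2 K3)). intros n Hn.
  assert (H1 := tail (F n) K n (Hdom n) ltac:(lia)).
  assert (H2 := tail f K n Hf ltac:(lia)).
  assert (H3 := HK K (Nat.le_refl K)). assert (H4 := HK2 n ltac:(lia)). assert (H5 := HK3 n ltac:(lia)).
  simpl in H3, H4, H5. apply Rabs_def2 in H3. assert (H6 := HGle n).
  replace (zs n (F n) - l) with ((zs n (F n) - zs K (F n)) + (zs K (F n) - zs K f) + (- (zs n f - zs K f)) + (zs n f - l)) by ring.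
  eapply Rle_lt_trans; [apply Rabs_triang|].
  assert (H7 := Rabs_triang (zs n (F n) - zs K (F n) + (zs K (F n) - zs K f)) (- (zs n f - zs K f))).
  assert (H8 := Rabs_triang (zs n (F n) - zs K (F n)) (zs K (F n) - zs K f)).
  rewrite Rabs_Ropp in H7. lra.
Qed.

(** * Expansion of the cotangent and its powers *)

Fixpoint ns (M : nat) (f : nat -> R) : R :=
  match M with O => 0 | S K => ns K f + f K end.

Lemma ns_ext (M : nat) (f g : nat -> R) : (forall k, (k < M)%nat -> f k = g k) -> ns M f = ns M g.
Proof.
  induction M; intros H; cbn [ns]; [reflexivity|]. rewrite IHM, H; auto.
Qed.

Lemma ns_plus (M : nat) (f g : nat -> R) : ns M (fun k => f k + g k) = ns M f + ns M g.
Proof. induction M; cbn [ns]; [ring|]. rewrite IHM; ring. Qed.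

Lemma ns_scal (M : nat) (c : R) (f : nat -> R) : ns M (fun k => c * f k) = c * ns M f.
Proof. induction M; cbn [ns]; [ring|]. rewrite IHM; ring. Qed.

Lemma ns_const (M : nat) (c : R) : ns M (fun _ => c) = INR M * c.
Proof. induction M; cbn [ns]; [simpl; ring|]. rewrite IHM, S_INR; ring. Qed.

Lemma ns_le (M : nat) (f g : nat -> R) : (forall k, (k < M)%nat -> f k <= g k) -> ns M f <= ns M g.
Proof.
  induction M; intros H; cbn [ns]; [lra|]. apply Rplus_le_compat; auto.
Qed.

Lemma ns_app (M K : nat) (f : nat -> R) : ns (M + K) f = ns M f + ns K (fun k => f (M + k)%nat).
Proof.
  induction K; cbn [ns]; [rewrite Nat.add_0_r; ring|].
  rewrite Nat.add_succ_r; cbn [ns]. rewrite IHK; ring.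
Qed.

Lemma ns_shift (M : nat) (f : nat -> R) : ns (S M) f = f O + ns M (fun k => f (S k)).
Proof.
  change (S M) with (1 + M)%nat. rewrite ns_app. cbn [ns]. f_equal. ring.
Qed.

Lemma ns_rev (M : nat) (f : nat -> R) : ns M (fun k => f (M - 1 - k)%nat) = ns M f.
Proof.
  induction M; [reflexivity|]. rewrite ns_shift. cbn [ns].
  rewrite <- IHM. replace (S M - 1 - 0)%nat with M by lia.
  rewrite Rplus_comm. f_equal. apply ns_ext; intros k Hk; f_equal; lia.
Qed.

(** The range from -M to M - 1 has 2 M elements, a power of two when [M] is one, as the iterated
    duplication formula requires; the last point is left over. *)
Lemma zs_ns (M : nat) (f : Z -> R) :
  zs M f = ns (2 * M) (fun k => f (Z.of_nat k - Z.of_nat M)%Z) + f (Z.of_nat M).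
Proof.
  replace (2 * M)%nat with (M + M)%nat by lia. rewrite ns_app.
  rewrite <- (ns_rev M (fun k => f (Z.of_nat k - Z.of_nat M)%Z)).
  rewrite (ns_ext M _ (fun k => f (- Z.of_nat (S k))%Z)) by (intros; f_equal; lia).
  rewrite (ns_ext M (fun k => f (Z.of_nat (M + k) - Z.of_nat M)%Z) (fun k => f (Z.of_nat k)))
    by (intros; f_equal; lia).
  induction M; cbn [zs ns]; [simpl; ring|]. rewrite IHM. ring.
Qed.

Lemma abs_cos_le_1 (x : R) : Rabs (cos x) <= 1.
Proof. apply Rabs_le. generalize (COS_bound x); lra. Qed.

(** The derivative of sin y - y cos y is y sin y, which is nonnegative here. *)
Lemma sin_ge_mul_cos (y : R) : 0 <= y <= PI / 2 -> y * cos y <= sin y.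
Proof.
  intros [H0 H1].
  destruct (MVT_gen (fun y => sin y - y * cos y) 0 y (fun y => y * sin y)) as [c [Hc E]].
  - intros x _. auto_derive; [trivial|]. ring.
  - intros x _. apply derivable_continuous_pt, ex_derive_Reals_0. auto_derive. trivial.
  - rewrite Rmin_left, Rmax_right in Hc by lra. rewrite sin_0 in E.
    assert (0 <= sin c) by (apply sin_ge_0; lra).
    assert (0 <= c * sin c * (y - 0)) by (repeat apply Rmult_le_pos; lra). lra.
Qed.

(** These are the inverse squares of sin y <= y <= tan y, with cot^2 = 1 / sin^2 - 1; the form y cos
    y <= sin y of the second inequality includes the endpoint pi/2. *)
Lemma inv_sin2_bounds (y : R) : y <> 0 -> - (PI / 2) <= y <= PI / 2 ->
  / (sin y) ^ 2 - 1 <= / y ^ 2 <= / (sin y) ^ 2.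
Proof.
  assert (pos : forall y, 0 < y <= PI / 2 -> / (sin y) ^ 2 - 1 <= / y ^ 2 <= / (sin y) ^ 2).
  { clear y. intros y Hy.
    assert (S0 : 0 < sin y) by (apply sin_gt_0; lra).
    assert (S1 : sin y <= y) by (apply Rlt_le, sin_lt_x; lra).
    assert (S2 := sin_ge_mul_cos y ltac:(lra)).
    assert (C0 : 0 <= cos y) by (apply cos_ge_0; lra).
    assert (E := sin2_cos2 y). unfold Rsqr in E.
    split.
    - replace (/ sin y ^ 2 - 1) with ((cos y) ^ 2 / (sin y) ^ 2).
      2:{ replace (cos y ^ 2) with (1 - sin y ^ 2) by nra. field. lra. }
      apply Rmult_le_reg_r with (y ^ 2 * sin y ^ 2); [apply Rmult_lt_0_compat; apply pow_lt; lra|].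
      replace (cos y ^ 2 / sin y ^ 2 * (y ^ 2 * sin y ^ 2)) with ((y * cos y) ^ 2) by (field; lra).
      replace (/ y ^ 2 * (y ^ 2 * sin y ^ 2)) with (sin y ^ 2) by (field; lra).
      apply pow_incr. split; [apply Rmult_le_pos; lra|lra].
    - apply Rinv_le_contravar; [apply pow_lt; lra|]. apply pow_incr; lra. }
  intros Hy [H1 H2]. destruct (Rlt_dec 0 y) as [p|p].
  - apply pos; lra.
  - generalize (pos (- y) ltac:(lra)). rewrite sin_neg.
    replace ((- sin y) ^ 2) with (sin y ^ 2) by ring.
    replace ((- y) ^ 2) with (y ^ 2) by ring. auto.
Qed.

Lemma sin2_shift_nat (x : R) (k : nat) : (sin (x + INR k * PI)) ^ 2 = (sin x) ^ 2.
Proof.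
  induction k.
  - simpl INR. rewrite Rmult_0_l, Rplus_0_r. reflexivity.
  - rewrite S_INR. replace (x + (INR k + 1) * PI) with ((x + INR k * PI) + PI) by ring.
    rewrite neg_sin. rewrite <- IHk. ring.
Qed.

Lemma sin2_shift_Z (x : R) (k : Z) : (sin (x + IZR k * PI)) ^ 2 = (sin x) ^ 2.
Proof.
  destruct (Z_le_gt_dec 0 k) as [H|H].
  - rewrite <- (Z2Nat.id k H), <- INR_IZR_INZ. apply sin2_shift_nat.
  - rewrite <- (sin2_shift_nat _ (Z.to_nat (- k))). rewrite INR_IZR_INZ, Z2Nat.id by lia.
    rewrite opp_IZR. f_equal. f_equal. ring.
Qed.

Lemma inv_sin2_double (y : R) : sin y <> 0 ->
  / (sin (y / 2)) ^ 2 + / (sin (y / 2 + PI / 2)) ^ 2 = 4 * / (sin y) ^ 2.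
Proof.
  intros H. rewrite (Rplus_comm (y / 2)), <- cos_sin.
  replace y with (2 * (y / 2)) in H |- * at 3 by field. rewrite sin_2a in H |- *.
  assert (sin (y / 2) <> 0) by (intro E; rewrite E in H; lra).
  assert (cos (y / 2) <> 0) by (intro E; rewrite E in H; lra).
  assert (E := sin2_cos2 (y / 2)). unfold Rsqr in E.
  field_simplify_eq; [nra|auto].
Qed.

(** The duplication formula, iterated: halving an argument splits it into two points that differ by
    pi/2. *)
Lemma inv_sin2_dyadic (x : R) (n : nat) : sin x <> 0 ->
  ns (2 ^ n) (fun k => / (sin ((x + INR k * PI) / 2 ^ n)) ^ 2) = 4 ^ n * / (sin x) ^ 2.
Proof.
  intros Hx.
  assert (nz : forall n k, sin ((x + INR k * PI) / 2 ^ n) <> 0).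
  { intros m k E. apply Hx.
    assert (Q : forall m y, sin (y / 2 ^ m) = 0 -> sin y = 0).
    { clear. induction m; intros y; [simpl; now replace (y / 1) with y by field|].
      intros H. replace y with (2 * (y / 2)) by field. rewrite sin_2a.
      rewrite (IHm (y / 2)); [ring|]. rewrite <- H. f_equal. simpl. field. apply pow_nonzero; lra. }
    apply Q in E. assert (S := sin2_shift_nat x k). rewrite E in S.
    assert (sin x * sin x = 0) by (simpl in S; lra). apply Rmult_integral in H; tauto. }
  induction n.
  - simpl. rewrite Rmult_0_l, Rplus_0_r. replace (x / 1) with x by field. ring.
  - replace (2 ^ S n)%nat with (2 ^ n + 2 ^ n)%nat by (simpl; lia).
    rewrite ns_app, <- ns_plus. change (4 ^ S n) with (4 * 4 ^ n). rewrite Rmult_assoc, <- IHn, <- ns_scal.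
    apply ns_ext. intros k _. rewrite <- inv_sin2_double by apply nz.
    assert (P : 2 ^ n <> 0) by (apply pow_nonzero; lra).
    replace ((x + INR k * PI) / 2 ^ S n) with ((x + INR k * PI) / 2 ^ n / 2).
    2:{ simpl pow. revert P. generalize (2 ^ n). intros; field; auto. }
    replace ((x + INR (2 ^ n + k) * PI) / 2 ^ S n) with ((x + INR k * PI) / 2 ^ n / 2 + PI / 2).
    2:{ rewrite plus_INR, pow_INR. replace (INR 2) with 2 by (simpl; lra). simpl pow.
        revert P. generalize (2 ^ n). intros; field; auto. }
    reflexivity.
Qed.

Lemma inv_sq_nonneg (x : R) : 0 <= / x ^ 2.
Proof.
  destruct (Req_dec (x ^ 2) 0) as [->|H]; [rewrite Rinv_0; lra|].
  apply Rlt_le, Rinv_0_lt_compat. generalize (pow2_ge_0 x); lra.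
Qed.

(** The dyadic identity is compared term by term with inverse squares. Each of the 2^(p+1)
    comparisons loses at most 1, and rescaling by pi^2 / 4^(p+1) leaves an error pi^2 / 2^(p+1) that
    does not depend on [x]. This uniformity later permits the mean value argument and termwise
    differentiation. *)
Lemma zs_inv_sq_bounds (x : R) (p : nat) : 0 < x < 1 ->
  PI ^ 2 / (sin (PI * x)) ^ 2 - PI ^ 2 / 2 ^ S p <= zs (2 ^ p) (fun m => / (x + IZR m) ^ 2) /\
  forall N, zs N (fun m => / (x + IZR m) ^ 2) <= PI ^ 2 / (sin (PI * x)) ^ 2.
Proof.
  intros Hx. assert (HPI := PI_RGT_0).
  assert (S0 : 0 < sin (PI * x)) by (apply sin_gt_0; nra).
  assert (main : forall p, PI ^ 2 / (sin (PI * x)) ^ 2 - PI ^ 2 / 2 ^ S p <=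
     ns (2 * 2 ^ p) (fun k => / (x + IZR (Z.of_nat k - Z.of_nat (2 ^ p))) ^ 2)
     <= PI ^ 2 / (sin (PI * x)) ^ 2).
  { clear p; intros p.
    (* The subtraction of 2^p pi centres the points: they all lie in [-pi/2, pi/2], where the
       comparison of the sine with its argument holds. *)
    set (y := fun k => (PI * x - INR (2 ^ p) * PI + INR k * PI) / 2 ^ S p).
    assert (H2 : 0 < 2 ^ p) by (apply pow_lt; lra).
    assert (yeq : forall k, y k = (x + IZR (Z.of_nat k - Z.of_nat (2 ^ p))) * (PI / 2 ^ S p)).
    { intros k. unfold y. rewrite minus_IZR, <- !INR_IZR_INZ. field. apply pow_nonzero; lra. }
    assert (S2 : (sin (PI * x - INR (2 ^ p) * PI)) ^ 2 = (sin (PI * x)) ^ 2).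
    { rewrite <- (sin2_shift_nat _ (2 ^ p)). f_equal. f_equal. ring. }
    assert (D := inv_sin2_dyadic (PI * x - INR (2 ^ p) * PI) (S p)).
    rewrite S2 in D.
    assert (Hne : sin (PI * x - INR (2 ^ p) * PI) <> 0).
    { intros E; rewrite E in S2. assert (0 < sin (PI * x) ^ 2) by (apply pow_lt; auto).
      simpl in S2. simpl in H. lra. }
    specialize (D Hne).
    assert (B : forall k, (k < 2 ^ S p)%nat -> / (sin (y k)) ^ 2 - 1 <= / (y k) ^ 2 <= / (sin (y k)) ^ 2).
    { intros k Hk. assert (K : INR k <= 2 * 2 ^ p - 1).
      { replace (2 * 2 ^ p - 1) with (INR (2 ^ S p - 1)).
        - apply le_INR; lia.
        - rewrite minus_INR, pow_INR; [|clear; induction (S p); simpl; lia].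
          replace (INR 2) with 2 by (simpl; lra). simpl; lra. }
      assert (K0 := pos_INR k).
      apply inv_sin2_bounds.
      - rewrite yeq. apply Rmult_integral_contrapositive_currified.
        + intros E. set (z := (Z.of_nat k - Z.of_nat (2 ^ p))%Z) in E.
          assert (z < 0)%Z by (apply lt_IZR; lra). assert (-1 < z)%Z by (apply lt_IZR; lra). lia.
        + apply Rgt_not_eq. apply Rdiv_lt_0_compat; [lra|apply pow_lt; lra].
      - unfold y. rewrite pow_INR. replace (INR 2) with 2 by (simpl; lra). simpl pow.
        assert (PI * x < PI) by nra. assert (0 < PI * x) by nra.
        assert (INR k * PI <= (2 * 2 ^ p - 1) * PI) by (apply Rmult_le_compat_r; [lra|exact K]).
        assert (0 <= INR k * PI) by (apply Rmult_le_pos; lra).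
        assert (fe : forall u t, 0 < t -> u / (2 * t) * (2 * t) = u) by (intros; field; lra).
        split; apply Rmult_le_reg_r with (2 * 2 ^ p); try lra; rewrite fe by assumption;
          clear - H H0 H1 H2 H3; revert H1 H2; generalize (2 ^ p); intros; lra. }
    assert (Ey : ns (2 ^ S p) (fun k => / (y k) ^ 2) =
       4 ^ S p / PI ^ 2 * ns (2 * 2 ^ p) (fun k => / (x + IZR (Z.of_nat k - Z.of_nat (2 ^ p))) ^ 2)).
    { rewrite <- ns_scal. apply ns_ext. intros k _. rewrite yeq.
      replace (4 ^ S p) with ((2 ^ S p) ^ 2).
      2:{ rewrite <- pow_mult, Nat.mul_comm, pow_mult. f_equal. ring. }
      rewrite Rpow_mult_distr, Rinv_mult. rewrite Rmult_comm. f_equal.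
      field. split; [lra|apply pow_nonzero; lra]. }
    fold (y) in D.
    assert (U := ns_le (2 ^ S p) _ _ (fun k Hk => proj2 (B k Hk))).
    assert (L := ns_le (2 ^ S p) _ _ (fun k Hk => proj1 (B k Hk))).
    unfold Rminus in L. rewrite ns_plus, ns_const in L.
    change (fun k : nat => / sin (y k) ^ 2) with (fun k : nat => / sin ((PI * x - INR (2 ^ p) * PI + INR k * PI) / 2 ^ S p) ^ 2) in L, U.
    rewrite D, Ey in L, U. rewrite pow_INR in L. replace (INR 2) with 2 in L by (simpl; lra).
    assert (P4 : 0 < 4 ^ S p) by (apply pow_lt; lra).
    assert (P2 : 0 < PI ^ 2) by (apply pow_lt; lra).
    assert (E4 : 4 ^ S p = 2 ^ S p * 2 ^ S p) by (rewrite <- Rpow_mult_distr; f_equal; lra).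
    assert (P22 : 0 < 2 ^ S p) by (apply pow_lt; lra).
    set (A := ns (2 * 2 ^ p) _) in *.
    split; apply Rmult_le_reg_l with (4 ^ S p / PI ^ 2); try (apply Rdiv_lt_0_compat; assumption).
    - eapply Rle_trans; [|exact L]. apply Req_le. rewrite E4. field. repeat split; lra.
    - eapply Rle_trans; [exact U|]. apply Req_le. field. split; lra. }
  assert (nn : forall m, 0 <= / (x + IZR m) ^ 2) by (intros; apply inv_sq_nonneg).
  split.
  - rewrite zs_ns. generalize (main p) (nn (Z.of_nat (2 ^ p))). lra.
  - intros N. assert (HN2 : (N < 2 ^ N)%nat) by (apply Nat.pow_gt_lin_r; lia).
    assert (HN : (N <= 2 ^ N - 1)%nat) by (clear - HN2; lia).
    eapply Rle_trans; [|apply (main N)].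
    assert (Z2 : zs (2 ^ N - 1) (fun m => / (x + IZR m) ^ 2) <= ns (2 * 2 ^ N) (fun k => / (x + IZR (Z.of_nat k - Z.of_nat (2 ^ N))) ^ 2)).
    { set (f := fun m => / (x + IZR m) ^ 2).
      change (zs (2 ^ N - 1) f <= ns (2 * 2 ^ N) (fun k => f (Z.of_nat k - Z.of_nat (2 ^ N))%Z)).
      assert (E := zs_ns (2 ^ N) f). assert (E2 : zs (2 ^ N) f = zs (2 ^ N - 1) f + (f (Z.of_nat (2 ^ N)) + f (- Z.of_nat (2 ^ N))%Z)).
      { replace (2 ^ N)%nat with (S (2 ^ N - 1)) at 1 by lia. cbn [zs].
        replace (S (2 ^ N - 1)) with (2 ^ N)%nat by lia. reflexivity. }
      generalize (nn (- Z.of_nat (2 ^ N))%Z). fold (f (- Z.of_nat (2 ^ N))%Z). lra. }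
    eapply Rle_trans; [|exact Z2]. apply zs_incr; auto.
Qed.

(** * Rational numbers and rational polynomial functions *)

Definition isQ (x : R) : Prop := exists q : Q, x = Q2R q.

Lemma isQ_IZR (z : Z) : isQ (IZR z).
Proof. exists (inject_Z z). unfold Q2R; simpl. field. Qed.

Lemma isQ_INR (n : nat) : isQ (INR n).
Proof. rewrite INR_IZR_INZ. apply isQ_IZR. Qed.

Lemma isQ_plus (x y : R) : isQ x -> isQ y -> isQ (x + y).
Proof. intros [p ->] [q ->]. exists (p + q)%Q. now rewrite Qreals.Q2R_plus. Qed.

Lemma isQ_mult (x y : R) : isQ x -> isQ y -> isQ (x * y).
Proof. intros [p ->] [q ->]. exists (p * q)%Q. now rewrite Qreals.Q2R_mult. Qed.

Lemma isQ_opp (x : R) : isQ x -> isQ (- x).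
Proof. intros [p ->]. exists (- p)%Q. now rewrite Qreals.Q2R_opp. Qed.

Lemma isQ_minus (x y : R) : isQ x -> isQ y -> isQ (x - y).
Proof. intros; apply isQ_plus; [|apply isQ_opp]; assumption. Qed.

Lemma isQ_inv (x : R) : isQ x -> isQ (/ x).
Proof.
  intros [p ->]. destruct (Qeq_dec p 0) as [E|E].
  - rewrite (Qreals.Qeq_eqR _ _ E). unfold Q2R; simpl. rewrite Rmult_0_l, Rinv_0. apply isQ_IZR.
  - exists (/ p)%Q. now rewrite Qreals.Q2R_inv.
Qed.

Lemma isQ_div (x y : R) : isQ x -> isQ y -> isQ (x / y).
Proof. intros; apply isQ_mult; [|apply isQ_inv]; assumption. Qed.

Lemma isQ_pow (x : R) (n : nat) : isQ x -> isQ (x ^ n).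
Proof. intros H; induction n; simpl; [apply isQ_IZR|apply isQ_mult; auto]. Qed.

Create HintDb isq.
#[global] Hint Resolve isQ_IZR isQ_INR isQ_plus isQ_mult isQ_opp isQ_minus isQ_inv isQ_div isQ_pow : isq.

(* Rational polynomial functions of degree strictly less than [d]. *)
Fixpoint QP (d : nat) (f : R -> R) : Prop :=
  match d with
  | O => forall c, f c = 0
  | S e => exists q g, isQ q /\ QP e g /\ forall c, f c = q * c ^ e + g c
  end.

Lemma QP_ext (d : nat) (f g : R -> R) : (forall c, f c = g c) -> QP d f -> QP d g.
Proof.
  destruct d; simpl; intros E H.
  - intros c; rewrite <- E; auto.
  - destruct H as (q & h & Hq & Hh & H). exists q, h; repeat split; auto.
    intros c; rewrite <- E; auto.
Qed.

Lemma QP_0 (d : nat) : QP d (fun _ => 0).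
Proof.
  induction d; simpl; [auto|]. exists 0, (fun _ => 0); repeat split; auto with isq.
  intros; ring.
Qed.

Lemma QP_S (d : nat) (f : R -> R) : QP d f -> QP (S d) f.
Proof. intros H; exists 0, f; repeat split; auto with isq. intros; ring. Qed.

Lemma QP_le (d e : nat) (f : R -> R) : (d <= e)%nat -> QP d f -> QP e f.
Proof. intros H Hf; induction H; auto using QP_S. Qed.

Lemma QP_plus (d : nat) : forall f g, QP d f -> QP d g -> QP d (fun c => f c + g c).
Proof.
  induction d; simpl; intros f g Hf Hg.
  - intros c; rewrite Hf, Hg; ring.
  - destruct Hf as (q & h & Hq & Hh & Ef), Hg as (r & k & Hr & Hk & Eg).
    exists (q + r), (fun c => h c + k c); repeat split; auto with isq.
    intros c; rewrite Ef, Eg; ring.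
Qed.

Lemma QP_scal (d : nat) : forall f q, isQ q -> QP d f -> QP d (fun c => q * f c).
Proof.
  induction d; simpl; intros f q Hq Hf.
  - intros c; rewrite Hf; ring.
  - destruct Hf as (r & h & Hr & Hh & Ef).
    exists (q * r), (fun c => q * h c); repeat split; auto with isq.
    intros c; rewrite Ef; ring.
Qed.

Lemma QP_pow (d : nat) : QP (S d) (fun c => c ^ d).
Proof. exists 1, (fun _ => 0); repeat split; auto with isq. apply QP_0. intros; ring. Qed.

Lemma QP_mul_var (d : nat) : forall f, QP d f -> QP (S d) (fun c => c * f c).
Proof.
  induction d; intros f Hf.
  - apply QP_ext with (fun _ => 0); [intros c; rewrite Hf; ring|apply QP_0].
  - destruct Hf as (r & h & Hr & Hh & Ef). exists r, (fun c => c * h c); repeat split; auto.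
    intros c; rewrite Ef; simpl; ring.
Qed.

Lemma QP_derive (d : nat) : forall f, QP d f ->
  exists g, QP (pred d) g /\ forall c, is_derive f c (g c).
Proof.
  induction d; intros f Hf.
  - exists (fun _ => 0); split; [apply QP_0|]. intros c.
    apply is_derive_ext with (fun _ => 0); [intros; now rewrite Hf|]. apply @is_derive_const.
  - destruct Hf as (r & h & Hr & Hh & Ef). destruct (IHd h Hh) as (g & Hg & Dg).
    exists (fun c => r * INR d * c ^ pred d + g c). split.
    + simpl pred. destruct d; simpl pred in *.
      * intros c; rewrite Hg; simpl; ring.
      * exists (r * INR (S d)), g; repeat split; auto with isq.
    + intros c. apply is_derive_ext with (fun c => r * c ^ d + h c); [intros; now rewrite Ef|].
      apply @is_derive_plus; [|apply Dg].
      evar_last. apply is_derive_scal, is_derive_pow, is_derive_id. unfold one; simpl; ring.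
Qed.

Lemma QP_isQ (d : nat) : forall f x, QP d f -> isQ x -> isQ (f x).
Proof.
  induction d; intros f x Hf Hx; simpl in Hf.
  - rewrite Hf; auto with isq.
  - destruct Hf as (q & h & Hq & Hh & E). rewrite E. auto with isq.
Qed.

(** * The cotangent series and its derivatives *)

Definition cotp (x : R) : R := cos (PI * x) / sin (PI * x).

Lemma zs_is_derive (N : nat) (f : Z -> R -> R) (g : Z -> R) (x : R) :
  (forall m, is_derive (f m) x (g m)) ->
  is_derive (fun t => zs N (fun m => f m t)) x (zs N g).
Proof.
  intros H. induction N; cbn [zs]; [apply H|].
  apply @is_derive_plus; [exact IHN|]. apply @is_derive_plus; apply H.
Qed.

Lemma frac_ne (x : R) (m : Z) : 0 < x < 1 -> x + IZR m <> 0.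
Proof.
  intros Hx E. assert (m < 0)%Z by (apply lt_IZR; lra). assert (-1 < m)%Z by (apply lt_IZR; lra). lia.
Qed.

Lemma is_derive_inv_pow (m : Z) (j : nat) (x : R) : x + IZR m <> 0 ->
  is_derive (fun t => / (t + IZR m) ^ j) x (- INR j * / (x + IZR m) ^ S j).
Proof.
  intros H. assert (P : (x + IZR m) ^ j <> 0) by (apply pow_nonzero; auto).
  auto_derive; [exact P|].
  destruct j; [simpl; field; auto|].
  simpl pred. rewrite <- !tech_pow_Rmult in *. field.
  split; [|auto]. intros E; rewrite E in P; lra.
Qed.

Lemma sin_pi_pos (x : R) : 0 < x < 1 -> 0 < sin (PI * x).
Proof. intros; assert (H2 := PI_RGT_0). apply sin_gt_0; nra. Qed.

Lemma is_derive_cotp (x : R) : sin (PI * x) <> 0 ->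
  is_derive cotp x (- PI * (1 + cotp x ^ 2)).
Proof.
  intros H. unfold cotp. auto_derive; [auto|].
  assert (E := sin2_cos2 (PI * x)). unfold Rsqr in E. field_simplify_eq; [|auto]. nra.
Qed.

Lemma cotp_sq (x : R) : sin (PI * x) <> 0 -> 1 + cotp x ^ 2 = / sin (PI * x) ^ 2.
Proof.
  intros H. unfold cotp. assert (E := sin2_cos2 (PI * x)). unfold Rsqr in E.
  field_simplify_eq; [|auto]. nra.
Qed.

(** The terms at m and -1 - m cancel, which leaves only the one at m = N. *)
Lemma zs_inv_half (N : nat) : zs N (fun m => / (/ 2 + IZR m)) = / (/ 2 + INR N).
Proof.
  induction N; cbn [zs]; [simpl; f_equal; ring|].
  rewrite IHN, opp_IZR, <- INR_IZR_INZ, S_INR. assert (H := pos_INR N). field. lra.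
Qed.

(** The partial sum minus the cotangent has derivative pi^2 / sin^2 minus a partial sum of inverse
    squares, a number between 0 and pi^2 / 2^(p+1). The mean value theorem starts at 1/2, where the
    cotangent vanishes and the partial sum is explicit. *)
Lemma zs_inv_cotp_bound (x : R) (p N : nat) : 0 < x < 1 -> (2 ^ p <= N)%nat ->
  Rabs (zs N (fun m => / (x + IZR m)) - PI * cotp x) <= / (/ 2 + INR N) + PI ^ 2 / 2 ^ S p.
Proof.
  intros Hx HN.
  set (D := fun t => zs N (fun m => / (t + IZR m)) - PI * cotp t).
  set (D' := fun t => PI ^ 2 / sin (PI * t) ^ 2 - zs N (fun m => / (t + IZR m) ^ 2)).
  assert (dD : forall t, 0 < t < 1 -> is_derive D t (D' t)).
  { intros t Ht. assert (St := sin_pi_pos t Ht).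
    assert (dc := is_derive_cotp t ltac:(lra)). rewrite cotp_sq in dc by lra.
    unfold D. evar_last.
    - apply @is_derive_minus.
      + apply (zs_is_derive N (fun m t => / (t + IZR m))). intros m.
        apply is_derive_ext with (fun t => / (t + IZR m) ^ 1); [intros; now rewrite pow_1|].
        apply (is_derive_inv_pow m 1 t), frac_ne; auto.
      + apply is_derive_scal. exact dc.
    - unfold D', minus, plus, opp; simpl.
      rewrite (zs_ext N _ (fun m => (-1) * / (t + IZR m) ^ 2)) by (intros; simpl; ring).
      rewrite zs_scal. simpl. unfold Rdiv. ring. }
  assert (bD : forall t, 0 < t < 1 -> 0 <= D' t <= PI ^ 2 / 2 ^ S p).
  { intros t Ht. unfold D'. destruct (zs_inv_sq_bounds t p Ht) as [L U].
    assert (M : zs (2 ^ p) (fun m => / (t + IZR m) ^ 2) <= zs N (fun m => / (t + IZR m) ^ 2)).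
    { apply zs_incr; [|exact HN]. intros m. apply Rlt_le, Rinv_0_lt_compat.
      apply pow2_gt_0, frac_ne; auto. }
    generalize (U N). lra. }
  assert (Dh : D (/ 2) = / (/ 2 + INR N)).
  { unfold D. rewrite zs_inv_half. unfold cotp. replace (PI * / 2) with (PI / 2) by field.
    rewrite cos_PI2. field. assert (H := pos_INR N). rewrite sin_PI2. lra. }
  destruct (MVT_gen D (/ 2) x D') as [c [Hc E]].
  - intros t Ht. apply dD. unfold Rmin, Rmax in Ht; destruct (Rle_dec (/ 2) x); lra.
  - intros t Ht. apply derivable_continuous_pt, ex_derive_Reals_0. eexists. apply dD.
    unfold Rmin, Rmax in Ht; destruct (Rle_dec (/ 2) x); lra.
  - assert (Hc' : 0 < c < 1) by (unfold Rmin, Rmax in Hc; destruct (Rle_dec (/ 2) x); lra).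
    fold (D x). replace (D x) with (D (/ 2) + D' c * (x - / 2)) by lra.
    eapply Rle_trans; [apply Rabs_triang|]. apply Rplus_le_compat.
    + rewrite Dh, Rabs_pos_eq; [lra|]. apply Rlt_le, Rinv_0_lt_compat. generalize (pos_INR N); lra.
    + rewrite Rabs_mult, (Rabs_pos_eq (D' c)) by apply bD, Hc'.
      assert (Rabs (x - / 2) <= 1) by (apply Rabs_le; lra).
      assert (B := bD c Hc'). assert (R0 := Rabs_pos (x - / 2)). nra.
Qed.

Lemma pow2_tail_small (C eps : R) : 0 < eps -> exists p, C / 2 ^ S p < eps.
Proof.
  intros He.
  assert (L : is_lim_seq (fun n => C * (/ 2) ^ n) (C * 0)).
  { apply lim_scal. apply is_lim_seq_geom. rewrite Rabs_pos_eq; lra. }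
  rewrite Rmult_0_r in L. apply is_lim_seq_spec in L. destruct (L (mkposreal _ He)) as [p Hp].
  exists p. specialize (Hp (S p) ltac:(lia)). simpl pos in Hp. rewrite Rminus_0_r in Hp.
  apply Rabs_def2 in Hp. rewrite pow_inv in Hp. apply Hp.
Qed.

Lemma is_lim_seq_of_dyadic_bound (u e : nat -> R) (l C : R) :
  is_lim_seq e 0 ->
  (forall p N, (2 ^ p <= N)%nat -> Rabs (u N - l) <= e N + C / 2 ^ S p) -> is_lim_seq u l.
Proof.
  intros He H. apply is_lim_seq_spec. intros eps.
  assert (e2 : 0 < eps / 2) by (destruct eps; simpl; lra).
  destruct (pow2_tail_small C (eps / 2) e2) as [p Hp].
  apply is_lim_seq_spec in He. destruct (He (mkposreal _ e2)) as [K HK].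
  exists (max K (2 ^ p)). intros n Hn. specialize (HK n ltac:(lia)). simpl in HK.
  rewrite Rminus_0_r in HK. apply Rabs_def2 in HK.
  eapply Rle_lt_trans; [apply (H p); lia|]. lra.
Qed.

Lemma lim_inv_half : is_lim_seq (fun N => / (/ 2 + INR N)) 0.
Proof.
  replace (Finite 0) with (Rbar_inv p_infty) by reflexivity.
  apply is_lim_seq_inv; [|discriminate].
  apply (is_lim_seq_plus _ _ (/ 2) p_infty p_infty); [apply is_lim_seq_const|apply is_lim_seq_INR|reflexivity].
Qed.

Lemma cotp_expansion_01 (x : R) : 0 < x < 1 ->
  zlim (fun m => / (x + IZR m)) (PI * cotp x).
Proof.
  intros Hx. apply is_lim_seq_of_dyadic_bound with (fun N => / (/ 2 + INR N)) (PI ^ 2).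
  - apply lim_inv_half.
  - intros; apply zs_inv_cotp_bound; auto.
Qed.

Lemma zs_abs_diff_le (f g : Z -> R) (N M : nat) :
  (forall m, (Z.of_nat N < Z.abs m)%Z -> Rabs (f m) <= g m) -> (N <= M)%nat ->
  Rabs (zs M f - zs N f) <= zs M g - zs N g.
Proof.
  intros H HM. induction HM.
  - rewrite !Rminus_diag, Rabs_R0; lra.
  - cbn [zs].
    replace (zs m f + (f (Z.of_nat (S m)) + f (- Z.of_nat (S m))%Z) - zs N f)
      with ((zs m f - zs N f) + (f (Z.of_nat (S m)) + f (- Z.of_nat (S m))%Z)) by ring.
    eapply Rle_trans; [apply Rabs_triang|].
    assert (Rabs (f (Z.of_nat (S m)) + f (- Z.of_nat (S m))%Z) <= g (Z.of_nat (S m)) + g (- Z.of_nat (S m))%Z).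
    { eapply Rle_trans; [apply Rabs_triang|]. apply Rplus_le_compat; apply H; lia. }
    lra.
Qed.

Lemma inv_pow_le_sq (x : R) (j : nat) (m : Z) : 0 < x < 1 -> (2 <= j)%nat -> (1 < Z.abs m)%Z ->
  Rabs (/ (x + IZR m) ^ j) <= / (x + IZR m) ^ 2.
Proof.
  intros Hx Hj Hm.
  assert (A : 1 <= Rabs (x + IZR m)).
  { destruct (Z_lt_le_dec 0 m) as [p|p].
    - assert (1 <= IZR m) by (apply IZR_le; lia). rewrite Rabs_pos_eq; lra.
    - assert (IZR m <= -2) by (apply IZR_le; lia). rewrite Rabs_left; lra. }
  rewrite Rabs_inv, <- RPow_abs. rewrite <- (pow2_abs (x + IZR m)).
  apply Rinv_le_contravar; [apply pow_lt; lra|]. apply Rle_pow; auto.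
Qed.

(** For |m| > 1 the higher powers are dominated by the squares, whose tails are small uniformly in
    [x]. *)
Lemma zs_inv_pow_cauchy (x : R) (j p N M : nat) : 0 < x < 1 -> (2 <= j)%nat ->
  (2 ^ p <= N)%nat -> (N <= M)%nat ->
  Rabs (zs M (fun m => / (x + IZR m) ^ j) - zs N (fun m => / (x + IZR m) ^ j)) <= PI ^ 2 / 2 ^ S p.
Proof.
  intros Hx Hj Hp HM.
  assert (0 < 2 ^ p)%nat by (apply Nat.neq_0_lt_0, Nat.pow_nonzero; lia).
  eapply Rle_trans.
  - apply (zs_abs_diff_le _ (fun m => / (x + IZR m) ^ 2)); [|exact HM].
    intros m Hm. apply inv_pow_le_sq; auto. lia.
  - destruct (zs_inv_sq_bounds x p Hx) as [L U].
    assert (zs (2 ^ p) (fun m => / (x + IZR m) ^ 2) <= zs N (fun m => / (x + IZR m) ^ 2)).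
    { apply zs_incr; [|exact Hp]. intros m. apply Rlt_le, Rinv_0_lt_compat.
      apply pow2_gt_0, frac_ne; auto. }
    generalize (U M). lra.
Qed.

Lemma ex_lim_zs_inv_pow (x : R) (j : nat) : 0 < x < 1 -> (2 <= j)%nat ->
  ex_finite_lim_seq (fun N => zs N (fun m => / (x + IZR m) ^ j)).
Proof.
  intros Hx Hj. apply ex_lim_seq_cauchy_corr. intros eps.
  destruct (pow2_tail_small (PI ^ 2) eps (cond_pos eps)) as [p Hp].
  exists (2 ^ p)%nat. intros n m Hn Hm. eapply Rle_lt_trans; [|exact Hp].
  destruct (Nat.le_ge_cases n m) as [H|H].
  - rewrite Rabs_minus_sym. apply zs_inv_pow_cauchy; auto.
  - apply zs_inv_pow_cauchy; auto.
Qed.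

Lemma CVU_zs_inv_pow (j : nat) (x : R) (r : posreal) : (2 <= j)%nat -> 
  (forall y, Boule x r y -> 0 < y < 1) ->
  CVU (fun N y => zs N (fun m => / (y + IZR m) ^ j))
      (fun y => real (Lim_seq (fun N => zs N (fun m => / (y + IZR m) ^ j)))) x r.
Proof.
  intros Hj HB eps He.
  destruct (pow2_tail_small (PI ^ 2) eps He) as [p Hp].
  exists (2 ^ p)%nat. intros n y Hn Hy. apply HB in Hy.
  eapply Rle_lt_trans; [|exact Hp].
  assert (L := Lim_seq_correct' _ (ex_lim_zs_inv_pow y j Hy Hj)).
  set (l := real _) in *.
  assert (L2 := is_lim_seq_abs _ _ (is_lim_seq_minus' _ _ _ _ L (is_lim_seq_const (zs n (fun m => / (y + IZR m) ^ j))))).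
  refine (is_lim_seq_le_loc _ _ _ _ _ L2 (is_lim_seq_const (PI ^ 2 / 2 ^ S p))).
  exists n. intros M HM. apply zs_inv_pow_cauchy; auto.
Qed.

(** Induction by termwise differentiation: the derivative of [cotp] is -pi (1 + cot^2), so each step
    raises the degree by one, and division by -j keeps the polynomial monic. Being monic, it can
    later be solved for the top power of the cotangent. *)
Lemma cotp_power_expansion_01 (j : nat) : (1 <= j)%nat -> exists g, QP j g /\
  forall x, 0 < x < 1 ->
    zlim (fun m => / (x + IZR m) ^ j) (PI ^ j * (cotp x ^ j + g (cotp x))).
Proof.
  intros Hj. induction Hj as [|j Hj IH].
  - exists (fun _ => 0); split; [apply QP_0|]. intros x Hx.
    replace (PI ^ 1 * (cotp x ^ 1 + 0)) with (PI * cotp x) by ring.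
    apply is_lim_seq_ext with (2 := cotp_expansion_01 x Hx).
    intros N; apply zs_ext; intros; now rewrite pow_1.
  - destruct IH as (g & Hg & L). destruct (QP_derive j g Hg) as (g' & Hg' & Dg).
    assert (J0 : INR j <> 0) by (apply not_0_INR; lia).
    (* The witness is what remains of (1 + c^2) (j c^(j-1) + g'(c)) / j after removal of the leading
       term c^(j+1). *)
    exists (fun c => c ^ pred j + (/ INR j) * (g' c + c * (c * g' c))). split.
    + apply QP_plus.
      * apply QP_le with (S (pred j)); [lia|apply QP_pow].
      * apply QP_scal; [auto with isq|]. apply QP_plus.
        -- apply QP_le with (pred j); [lia|exact Hg'].
        -- apply QP_le with (S (S (pred j))); [lia|]. apply QP_mul_var, QP_mul_var, Hg'.
    + intros x Hx.
      assert (Sx := sin_pi_pos x Hx).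
      assert (r0 : 0 < Rmin x (1 - x)) by (apply Rmin_pos; lra).
      set (r := mkposreal _ r0).
      assert (HB : forall y, Boule x r y -> 0 < y < 1).
      { intros y Hy. unfold Boule in Hy; simpl in Hy. apply Rabs_def2 in Hy.
        generalize (Rmin_l x (1 - x)) (Rmin_r x (1 - x)); lra. }
      set (G := fun y => real (Lim_seq (fun N => zs N (fun m => / (y + IZR m) ^ S j)))).
      assert (CV := CVU_zs_inv_pow (S j) x r ltac:(lia) HB). fold G in CV.
      assert (bx : Boule x r x) by (unfold Boule; rewrite Rminus_diag, Rabs_R0; apply cond_pos).
      assert (D : derivable_pt_lim (fun y => PI ^ j * (cotp y ^ j + g (cotp y))) x (- INR j * G x)).
      { apply (CVU_derivable (fun N y => zs N (fun m => / (y + IZR m) ^ j))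
          (fun N y => - INR j * zs N (fun m => / (y + IZR m) ^ S j)) _ (fun y => - INR j * G y) x r);
          [| | |exact bx].
        - intros eps He. assert (e2 : 0 < eps / INR j).
          { apply Rdiv_lt_0_compat; [auto|]. apply lt_0_INR; lia. }
          destruct (CV _ e2) as [K HK]. exists K. intros n y Hn Hy.
          replace (- INR j * G y - - INR j * zs n (fun m => / (y + IZR m) ^ S j))
            with (- INR j * (G y - zs n (fun m => / (y + IZR m) ^ S j))) by ring.
          rewrite Rabs_mult, Rabs_Ropp, (Rabs_pos_eq (INR j)) by apply pos_INR.
          apply Rlt_le_trans with (INR j * (eps / INR j)).
          + apply Rmult_lt_compat_l; [apply lt_0_INR; lia|]. apply HK; auto.
          + apply Req_le; field; auto.
        - intros y Hy. apply is_lim_seq_Reals, L, HB, Hy.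
        - intros n y Hy. apply is_derive_Reals. rewrite <- zs_scal.
          apply (zs_is_derive n (fun m y => / (y + IZR m) ^ j)). intros m.
          apply is_derive_inv_pow, frac_ne, HB, Hy. }
      assert (D2 : is_derive (fun y => PI ^ j * (cotp y ^ j + g (cotp y))) x
         (PI ^ j * (INR j * cotp x ^ pred j + g' (cotp x)) * (- PI * (1 + cotp x ^ 2)))).
      { assert (dc := is_derive_cotp x ltac:(lra)).
        evar_last.
        - apply is_derive_scal. apply @is_derive_plus.
          + apply is_derive_pow, dc.
          + apply (is_derive_comp g cotp); [apply Dg|exact dc].
        - unfold plus, scal; simpl; unfold mult; simpl. ring. }
      apply is_derive_Reals in D2. assert (E := uniqueness_limite _ _ _ _ D D2).
      assert (LG : zlim (fun m => / (x + IZR m) ^ S j) (G x)).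
      { apply Lim_seq_correct', ex_lim_zs_inv_pow; auto; lia. }
      replace (PI ^ S j * _) with (G x); [exact LG|].
      apply Rmult_eq_reg_l with (- INR j); [|lra]. rewrite E.
      destruct j as [|i]; [lia|]. simpl pred. rewrite <- !tech_pow_Rmult.
      change (cotp x ^ 2) with (cotp x * (cotp x * 1)).
      revert J0. generalize (INR (S i)) (PI ^ i) (g' (cotp x)) (cotp x ^ i).
      generalize (cotp x). intros. rewrite pow_O. field. assumption.
Qed.

Lemma is_lim_seq_inv_pow_shift (x : R) (j : nat) : (1 <= j)%nat ->
  is_lim_seq (fun N => / (x + INR N) ^ j) 0.
Proof.
  intros Hj.
  assert (L : is_lim_seq (fun N => / (x + INR N)) 0).
  { replace (Finite 0) with (Rbar_inv p_infty) by reflexivity.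
    apply is_lim_seq_inv; [|discriminate].
    apply (is_lim_seq_plus _ _ x p_infty p_infty); [apply is_lim_seq_const|apply is_lim_seq_INR|reflexivity]. }
  induction Hj.
  - apply is_lim_seq_ext with (2 := L). intros; now rewrite pow_1.
  - apply is_lim_seq_ext with (fun N => / (x + INR N) * / (x + INR N) ^ m).
    + intros; simpl. now rewrite Rinv_mult.
    + replace 0 with (0 * 0) by ring. apply is_lim_seq_mult'; auto.
Qed.

Lemma is_lim_seq_inv_pow_shift_neg (x : R) (j : nat) : (1 <= j)%nat ->
  is_lim_seq (fun N => / (x - INR N) ^ j) 0.
Proof.
  intros Hj. apply is_lim_seq_ext with (fun N => (-1) ^ j * / (- x + INR N) ^ j).
  - intros N. replace (x - INR N) with (-1 * (- x + INR N)) by ring.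
    rewrite Rpow_mult_distr, Rinv_mult, <- (pow_inv (-1)). replace (/ -1) with (-1) by field. reflexivity.
  - replace 0 with ((-1) ^ j * 0) by ring. apply lim_scal.
    apply is_lim_seq_inv_pow_shift; auto.
Qed.

(** A translation by one changes a symmetric partial sum by two boundary terms, both of which tend
    to 0. *)
Lemma lim_zs_inv_pow_succ (x l : R) (j : nat) : (1 <= j)%nat ->
  zlim (fun m => / (x + IZR m) ^ j) l <->
  zlim (fun m => / (x + 1 + IZR m) ^ j) l.
Proof.
  intros Hj.
  assert (E : forall N, zs N (fun m => / (x + 1 + IZR m) ^ j) =
     zs N (fun m => / (x + IZR m) ^ j) + (/ (x + 1 + INR N) ^ j - / (x - INR N) ^ j)).
  { intros N. assert (Sh := zs_shift N (fun m => / (x + IZR m) ^ j)). cbv beta in Sh.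
    rewrite plus_IZR, opp_IZR, <- INR_IZR_INZ in Sh.
    replace (x + (INR N + 1)) with (x + 1 + INR N) in Sh by ring.
    replace (x + - INR N) with (x - INR N) in Sh by ring.
    replace (zs N (fun m => / (x + 1 + IZR m) ^ j)) with (zs N (fun m => / (x + IZR (m + 1)) ^ j)); [lra|].
    apply zs_ext. intros m. rewrite plus_IZR. do 2 f_equal. ring. }
  assert (T : is_lim_seq (fun N => / (x + 1 + INR N) ^ j - / (x - INR N) ^ j) 0).
  { replace 0 with (0 - 0) by ring. apply is_lim_seq_minus'.
    - apply is_lim_seq_inv_pow_shift; auto.
    - apply is_lim_seq_inv_pow_shift_neg; auto. }
  split; intros L.
  - apply is_lim_seq_ext with (1 := fun N => eq_sym (E N)).
    replace l with (l + 0) by ring. apply is_lim_seq_plus'; auto.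
  - apply is_lim_seq_ext with (fun N => zs N (fun m => / (x + 1 + IZR m) ^ j) - (/ (x + 1 + INR N) ^ j - / (x - INR N) ^ j)).
    + intros N; rewrite E; ring.
    + replace l with (l - 0) by ring. apply is_lim_seq_minus'; auto.
Qed.

Lemma lim_zs_inv_pow_shift (x l : R) (j : nat) (k : Z) : (1 <= j)%nat ->
  zlim (fun m => / (x + IZR m) ^ j) l ->
  zlim (fun m => / (x + IZR k + IZR m) ^ j) l.
Proof.
  intros Hj L. revert k.
  assert (Ext : forall x y, x = y -> zlim (fun m => / (x + IZR m) ^ j) l ->
     zlim (fun m => / (y + IZR m) ^ j) l) by (intros ? ? ->; auto).
  apply Z.peano_ind.
  - revert L; apply Ext; ring.
  - intros k H. apply lim_zs_inv_pow_succ in H; auto. revert H; apply Ext. rewrite succ_IZR; ring.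
  - intros k H. apply lim_zs_inv_pow_succ; auto. revert H; apply Ext.
    unfold Z.pred; rewrite plus_IZR. simpl; ring.
Qed.

Lemma cotp_succ (x : R) : cotp (x + 1) = cotp x.
Proof.
  unfold cotp. rewrite Rmult_plus_distr_l, Rmult_1_r, neg_sin, neg_cos.
  unfold Rdiv. rewrite Rinv_opp. ring.
Qed.

Lemma cotp_shift (x : R) (k : Z) : cotp (x + IZR k) = cotp x.
Proof.
  revert k. apply Z.peano_ind.
  - now rewrite Rplus_0_r.
  - intros k H. rewrite succ_IZR, <- Rplus_assoc, cotp_succ; auto.
  - intros k H. rewrite <- H, <- (cotp_succ (x + IZR (Z.pred k))). f_equal.
    unfold Z.pred; rewrite plus_IZR; simpl; ring.
Qed.

Lemma sin_pi_shift_ne (x : R) (k : Z) : sin (PI * x) <> 0 -> sin (PI * (x + IZR k)) <> 0.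
Proof.
  intros H E. assert (S := sin2_shift_Z (PI * x) k).
  replace (PI * x + IZR k * PI) with (PI * (x + IZR k)) in S by ring. rewrite E in S.
  assert (sin (PI * x) * sin (PI * x) = 0) by (simpl in S; lra).
  apply Rmult_integral in H0; tauto.
Qed.

Lemma frac_decomp (x : R) : sin (PI * x) <> 0 -> exists y k, 0 < y < 1 /\ x = y + IZR k.
Proof.
  intros H. exists (frac_part x), (Int_part x).
  assert (B := base_fp x). assert (E : x = frac_part x + IZR (Int_part x)) by (unfold frac_part; ring).
  split; [|exact E]. destruct B as [B1 B2].
  destruct (Req_dec (frac_part x) 0) as [Z|Z]; [|lra].
  exfalso. apply H. assert (Sh := sin2_shift_Z 0 (Int_part x)). rewrite sin_0 in Sh.
  replace (0 + IZR (Int_part x) * PI) with (PI * x) in Sh by (replace (IZR (Int_part x)) with x by lra; ring).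
  assert (S2 : sin (PI * x) * sin (PI * x) = 0) by lra.
  apply Rmult_integral in S2. tauto.
Qed.

Lemma cotp_power_expansion (j : nat) : (1 <= j)%nat -> exists g, QP j g /\
  forall x, sin (PI * x) <> 0 ->
    zlim (fun m => / (x + IZR m) ^ j) (PI ^ j * (cotp x ^ j + g (cotp x))).
Proof.
  intros Hj. destruct (cotp_power_expansion_01 j Hj) as (g & Hg & L).
  exists g; split; [exact Hg|]. intros x Hx.
  destruct (frac_decomp x Hx) as (y & k & Hy & ->). rewrite cotp_shift.
  apply lim_zs_inv_pow_shift; auto.
Qed.

(** Partial sums of nonnegative terms stay below their limit, and the limit is periodic in [x],
    which leads back to the case 0 < x < 1. *)
Lemma zs_inv_sq_le (x : R) (N : nat) : sin (PI * x) <> 0 ->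
  zs N (fun m => / (x + IZR m) ^ 2) <= PI ^ 2 / sin (PI * x) ^ 2.
Proof.
  intros Hx. destruct (frac_decomp x Hx) as (y & k & Hy & E).
  assert (L : exists l : R, zlim (fun m => / (x + IZR m) ^ 2) l /\ l <= PI ^ 2 / sin (PI * x) ^ 2).
  { destruct (ex_lim_zs_inv_pow y 2 Hy ltac:(lia)) as [l Hl]. exists l; split.
    - rewrite E. apply lim_zs_inv_pow_shift; auto.
    - rewrite E. replace (PI * (y + IZR k)) with (PI * y + IZR k * PI) by ring. rewrite sin2_shift_Z.
      refine (is_lim_seq_le _ _ _ _ _ Hl (is_lim_seq_const _)). intros n.
      apply (zs_inv_sq_bounds y 0 Hy). }
  destruct L as (l & Hl & Hle). eapply Rle_trans; [|exact Hle].
  apply (is_lim_seq_incr_compare _ _ Hl). intros n. apply zs_incr; [|lia].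
  intros m. apply inv_sq_nonneg.
Qed.

(** * One-dimensional sums and partial fractions *)

Lemma Rinv_pow_0 (k : nat) : (1 <= k)%nat -> / 0 ^ k = 0.
Proof. intros H. rewrite pow_i by lia. apply Rinv_0. Qed.

Lemma is_lim_seq_zs_subst (f g : Z -> R) (l : R) : (forall m, f m = g m) ->
  zlim f l -> zlim g l.
Proof. intros H. apply is_lim_seq_ext. intros; apply zs_ext; auto. Qed.

(** The values are 1, 0 and -1; through them the one-dimensional sums at quarter shifts become
    rational multiples of powers of pi. *)
Lemma cotp_quarter (al : Z) : (1 <= al <= 3)%Z -> sin (PI * (IZR al / 4)) <> 0 /\ isQ (cotp (IZR al / 4)).
Proof.
  intros H. assert (HPI := PI_RGT_0). assert (H1 : 1 <= IZR al <= 3) by (split; apply IZR_le; lia).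
  split; [apply Rgt_not_eq, sin_pi_pos; lra|].
  assert (S2 := sqrt_lt_R0 2 ltac:(lra)).
  assert (al = 1 \/ al = 2 \/ al = 3)%Z as [->| [->| ->]] by lia; unfold cotp.
  - replace (PI * (1 / 4)) with (PI / 4) by field. rewrite sin_PI4, cos_PI4.
    replace (1 / sqrt 2 / (1 / sqrt 2)) with 1 by (field; lra). apply isQ_IZR.
  - replace (PI * (2 / 4)) with (PI / 2) by field. rewrite cos_PI2. unfold Rdiv. rewrite Rmult_0_l. apply isQ_IZR.
  - replace (PI * (3 / 4)) with (3 * (PI / 4)) by field. rewrite sin_3PI4, cos_3PI4.
    replace (-1 / sqrt 2 / (1 / sqrt 2)) with (-1) by (field; lra). apply isQ_IZR.
Qed.

Lemma quarter_sum_value (al : Z) (k : nat) : (1 <= al <= 3)%Z -> (1 <= k)%nat ->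
  exists q, isQ q /\ zlim (fun m => / (IZR al / 4 + IZR m) ^ k) (PI ^ k * q).
Proof.
  intros Ha Hk. destruct (cotp_quarter al Ha) as [H1 H2].
  destruct (cotp_power_expansion k Hk) as (g & Hg & L).
  exists (cotp (IZR al / 4) ^ k + g (cotp (IZR al / 4))). split; [|apply L, H1].
  apply isQ_plus; [auto with isq|]. apply QP_isQ with k; auto.
Qed.

(** With |n| <= N the odd numbers 2 n + 1 run from -2 N + 1 to 2 N + 1; the last one exceeds the
    range and is subtracted. *)
Lemma zs_even_odd (f : Z -> R) (N : nat) :
  zs (2 * N) f = zs N (fun n => f (2 * n)%Z) + zs N (fun n => f (2 * n + 1)%Z) - f (2 * Z.of_nat N + 1)%Z.
Proof.
  induction N.
  - simpl. ring.
  - replace (2 * S N)%nat with (S (S (2 * N))) by lia. cbn [zs]. rewrite IHN.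
    replace (Z.of_nat (S (2 * N))) with (2 * Z.of_nat N + 1)%Z by lia.
    replace (Z.of_nat (S (S (2 * N)))) with (2 * Z.of_nat (S N))%Z by lia.
    replace (- (2 * Z.of_nat N + 1))%Z with (2 * (- Z.of_nat (S N)) + 1)%Z by lia.
    replace (- (2 * Z.of_nat (S N)))%Z with (2 * (- Z.of_nat (S N)))%Z by lia.
    ring.
Qed.

Lemma inv_pow_even_nonneg (x : R) (k : nat) : 0 <= / x ^ (2 * k).
Proof.
  rewrite pow_mult. destruct (Req_dec ((x ^ 2) ^ k) 0) as [->|H]; [rewrite Rinv_0; lra|].
  apply Rlt_le, Rinv_0_lt_compat. assert (0 <= (x ^ 2) ^ k) by apply pow_le, pow2_ge_0. lra.
Qed.

(** The even integers reproduce the sum with factor 2^(-2k), and the odd ones give the same factor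
    times the sum shifted by 1/2, known from the cotangent at pi/2. This linear equation determines
    the value. The term m = 0 is 0 by the convention for inverses. *)
Lemma zeta_even_value (k : nat) : (1 <= k)%nat ->
  exists q, isQ q /\ zlim (fun m => / (IZR m) ^ (2 * k)) (PI ^ (2 * k) * q).
Proof.
  intros Hk. destruct (quarter_sum_value 2 (2 * k) ltac:(lia) ltac:(lia)) as (q & Hq & L).
  set (P := 2 ^ (2 * k)).
  assert (HP : 4 <= P).
  { unfold P. rewrite pow_mult. replace (2 ^ 2) with 4 by ring. 
    rewrite <- (pow_1 4) at 1. apply Rle_pow; [lra|lia]. }
  set (h := fun N => zs N (fun m => / (2 / 4 + IZR m) ^ (2 * k))) in L.
  set (z := fun N => zs N (fun m => / (IZR m) ^ (2 * k))).
  assert (E : forall N, z (2 * N)%nat = / P * (z N + h N) - / (1 + INR (2 * N)) ^ (2 * k)).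
  { intros N. unfold z. rewrite zs_even_odd. rewrite Rmult_plus_distr_l. unfold h, z.
    rewrite <- !zs_scal.
    replace (IZR (2 * Z.of_nat N + 1)) with (1 + INR (2 * N)).
    2:{ rewrite INR_IZR_INZ, plus_IZR. rewrite Rplus_comm. do 2 f_equal. lia. }
    f_equal. f_equal.
    - apply zs_ext. intros m. rewrite mult_IZR, Rpow_mult_distr, Rinv_mult. reflexivity.
    - apply zs_ext. intros m. rewrite <- Rinv_mult. unfold P. rewrite <- Rpow_mult_distr.
      f_equal. f_equal. rewrite plus_IZR, mult_IZR. field. }
  assert (hle : forall N, h N <= PI ^ (2 * k) * q).
  { apply (is_lim_seq_incr_compare _ _ L). intros N. apply zs_incr; [|lia]. intros; apply inv_pow_even_nonneg. }
  assert (zinc : forall N M, (N <= M)%nat -> z N <= z M).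
  { apply zs_incr. intros; apply inv_pow_even_nonneg. }
  (* From z N <= z (2 N) <= (z N + h N) / P with P >= 4 the increasing partial sums are bounded, so
     that convergence comes from the same relation as the value. *)
  assert (zb : forall N, z N <= PI ^ (2 * k) * q).
  { intros N. assert (I := zinc N (2 * N)%nat ltac:(lia)). rewrite E in I.
    assert (0 <= / (1 + INR (2 * N)) ^ (2 * k)) by apply inv_pow_even_nonneg.
    assert (I2 : z N <= / P * (z N + h N)) by lra.
    apply Rmult_le_compat_l with (r := P) in I2; [|lra].
    rewrite <- Rmult_assoc, Rinv_r, Rmult_1_l in I2 by lra.
    assert (0 <= h N). { eapply Rle_trans; [|apply (zs_incr _ (fun m => inv_pow_even_nonneg (2/4 + IZR m) k) 0 N); lia]. apply inv_pow_even_nonneg. }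
    assert (0 <= z N). { eapply Rle_trans; [|apply (zinc O N); lia]. apply inv_pow_even_nonneg. }
    generalize (hle N). nra. }
  assert (ex : ex_finite_lim_seq z) by (apply ex_finite_lim_seq_incr with (PI ^ (2 * k) * q); auto).
  destruct ex as [l Hl].
  assert (El : l = / P * (l + PI ^ (2 * k) * q) - 0).
  { assert (L1 : is_lim_seq (fun N => z (2 * N)%nat) l).
    { apply (is_lim_seq_subseq z l (fun N => (2 * N)%nat)); [|exact Hl].
      apply eventually_subseq. intros; lia. }
    assert (L2 : is_lim_seq (fun N => z (2 * N)%nat) (/ P * (l + PI ^ (2 * k) * q) - 0)).
    { apply is_lim_seq_ext with (1 := fun N => eq_sym (E N)).
      apply is_lim_seq_minus'.
      - apply lim_scal. apply is_lim_seq_plus'; [exact Hl|exact L].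
      - apply (is_lim_seq_subseq (fun N => / (1 + INR N) ^ (2 * k)) 0 (fun N => (2 * N)%nat)).
        + apply eventually_subseq. intros; lia.
        + apply is_lim_seq_inv_pow_shift; lia. }
    apply is_lim_seq_unique in L1. apply is_lim_seq_unique in L2. rewrite L1 in L2. now injection L2. }
  exists (q / (P - 1)). split.
  - unfold P. auto with isq.
  - replace (PI ^ (2 * k) * (q / (P - 1))) with l; [exact Hl|].
    assert (E2 : l * P = l + PI ^ (2 * k) * q) by (rewrite El at 1; field; lra).
    apply Rmult_eq_reg_r with (P - 1); [|lra].
    transitivity (PI ^ (2 * k) * q); [lra|]. generalize (PI ^ (2 * k)). intros; field; lra.
Qed.

(** At shift 0 odd powers cancel in pairs, and even powers give zeta values. *)
Lemma quarter_sum_rational (al : Z) (k : nat) : (0 <= al <= 3)%Z -> (1 <= k)%nat ->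
  exists q, isQ q /\ zlim (fun m => / (IZR al / 4 + IZR m) ^ k) (PI ^ k * q).
Proof.
  intros Ha Hk. destruct (Z.eq_dec al 0) as [->|H].
  2:{ apply quarter_sum_value; [lia|auto]. }
  assert (X : exists q, isQ q /\ zlim (fun m => / (IZR m) ^ k) (PI ^ k * q)).
  { destruct (Nat.Even_or_Odd k) as [[e ->]|[e ->]].
    - apply zeta_even_value; lia.
    - exists 0; split; [auto with isq|]. rewrite Rmult_0_r.
      apply is_lim_seq_ext with (fun _ => 0); [|apply is_lim_seq_const]. intros N.
      assert (E := zs_opp N (fun m => / IZR m ^ (2 * e + 1))). cbv beta in E.
      rewrite (zs_ext N _ (fun m => -1 * / IZR m ^ (2 * e + 1))) in E.
      2:{ intros m. rewrite opp_IZR. replace (- IZR m) with (-1 * IZR m) by ring.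
          rewrite Rpow_mult_distr, Rinv_mult, pow_add, pow_mult. replace ((-1) ^ 2) with 1 by ring.
          rewrite pow1, Rmult_1_l, pow_1. f_equal. field. }
      rewrite zs_scal in E. lra. }
  destruct X as (q & Hq & L). exists q; split; [exact Hq|].
  revert L; apply is_lim_seq_zs_subst. intros m. do 2 f_equal. field.
Qed.

(** Induction on the total degree through 1 / (x y) = (1 / (x + y)) (1 / x + 1 / y), which lowers
    one exponent and yields a Pascal recurrence for the coefficients. The value [cx O = 1] makes the
    leading term of the reciprocity law the inverted lattice sum itself. *)
Lemma partial_fractions (n : nat) : forall j s, (j + s = S n)%nat ->
  exists cx cy : nat -> R, (forall i, isQ (cx i)) /\ (forall i, isQ (cy i)) /\
    ((1 <= j)%nat -> cx O = 1) /\
    forall x y, x <> 0 -> y <> 0 -> x + y <> 0 ->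
      / x ^ j * / y ^ s =
      ns j (fun i => cx i * (/ x ^ (j - i) * / (x + y) ^ (s + i))) +
      ns s (fun k => cy k * (/ y ^ (s - k) * / (x + y) ^ (j + k))).
Proof.
  assert (one : forall s, (1 <= s)%nat -> forall f : nat -> R,
     ns s (fun k => match k with O => 1 | _ => 0 end * f k) = f O).
  { intros s Hs f. destruct s; [lia|]. rewrite ns_shift.
    rewrite (ns_ext s _ (fun _ => 0)) by (intros; ring). rewrite ns_const. ring. }
  assert (q01 : forall i : nat, isQ (match i with O => 1 | _ => 0 end)) by (intros [|i]; apply isQ_IZR).
  induction n as [n IH] using (well_founded_induction lt_wf). intros j s E.
  destruct j as [|j].
  { exists (fun _ => 0), (fun k => match k with O => 1 | _ => 0 end).
    repeat split; [intros; apply isQ_IZR|auto|lia|]. intros x y Hx Hy Hm. cbn [ns].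
    rewrite one by lia. rewrite Nat.sub_0_r. simpl pow. field. apply pow_nonzero; auto. }
  destruct s as [|s].
  { exists (fun k => match k with O => 1 | _ => 0 end), (fun _ => 0).
    repeat split; [auto|intros; apply isQ_IZR|]. intros x y Hx Hy Hm.
    rewrite one by lia. rewrite Nat.sub_0_r. cbn [ns Nat.add]. rewrite !pow_O, Rinv_1. ring. }
  destruct (IH (j + s)%nat ltac:(lia) (S j) s ltac:(lia)) as (ax & ay & Qax & Qay & A0 & A).
  destruct (IH (j + s)%nat ltac:(lia) j (S s) ltac:(lia)) as (bx & by_ & Qbx & Qby & B0 & B).
  exists (fun i => ax i + match i with O => 0 | S i' => bx i' end).
  exists (fun k => by_ k + match k with O => 0 | S k' => ay k' end).
  split; [intros [|i]; auto with isq|]. split; [intros [|i]; auto with isq|].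
  split; [intros _; rewrite A0 by lia; ring|].
  intros x y Hx Hy Hm.
  assert (E1 : / x ^ S j * / y ^ S s = / (x + y) * (/ x ^ j * / y ^ S s + / x ^ S j * / y ^ s)).
  { assert (Px := pow_nonzero x j Hx). assert (Py := pow_nonzero y s Hy).
    simpl pow. revert Px Py. generalize (x ^ j) (y ^ s). intros. field. auto. }
  rewrite E1, (A x y Hx Hy Hm), (B x y Hx Hy Hm).
  rewrite !Rmult_plus_distr_l, <- !ns_scal.
  rewrite (ns_ext (S j) (fun i => (ax i + _) * _) (fun i => ax i * (/ x ^ (S j - i) * / (x + y) ^ (S s + i)) +
      match i with O => 0 | S i' => bx i' end * (/ x ^ (S j - i) * / (x + y) ^ (S s + i)))) by (intros; ring).
  rewrite (ns_ext (S s) (fun i => (by_ i + _) * _) (fun i => by_ i * (/ y ^ (S s - i) * / (x + y) ^ (S j + i)) +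
      match i with O => 0 | S i' => ay i' end * (/ y ^ (S s - i) * / (x + y) ^ (S j + i)))) by (intros; ring).
  rewrite !ns_plus.
  rewrite (ns_shift j (fun i => match i with O => 0 | S i' => bx i' end * _)).
  rewrite (ns_shift s (fun i => match i with O => 0 | S i' => ay i' end * _)).
  rewrite !Rmult_0_l, !Rplus_0_l.
  assert (T1 : ns j (fun k => / (x + y) * (bx k * (/ x ^ (j - k) * / (x + y) ^ (S s + k)))) =
     ns j (fun k => bx k * (/ x ^ (S j - S k) * / (x + y) ^ (S s + S k)))).
  { apply ns_ext; intros k _. rewrite Nat.sub_succ, (Nat.add_succ_r (S s)).
    rewrite <- (tech_pow_Rmult (x + y) (S s + k)), Rinv_mult. ring. }
  assert (T2 : ns (S s) (fun k => / (x + y) * (by_ k * (/ y ^ (S s - k) * / (x + y) ^ (j + k)))) =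
     ns (S s) (fun k => by_ k * (/ y ^ (S s - k) * / (x + y) ^ (S j + k)))).
  { apply ns_ext; intros k _. change (S j + k)%nat with (S (j + k)).
    rewrite <- (tech_pow_Rmult (x + y) (j + k)), Rinv_mult. ring. }
  assert (T3 : ns (S j) (fun k => / (x + y) * (ax k * (/ x ^ (S j - k) * / (x + y) ^ (s + k)))) =
     ns (S j) (fun k => ax k * (/ x ^ (S j - k) * / (x + y) ^ (S s + k)))).
  { apply ns_ext; intros k _. change (S s + k)%nat with (S (s + k)).
    rewrite <- (tech_pow_Rmult (x + y) (s + k)), Rinv_mult. ring. }
  assert (T4 : ns s (fun k => / (x + y) * (ay k * (/ y ^ (s - k) * / (x + y) ^ (S j + k)))) =
     ns s (fun k => ay k * (/ y ^ (S s - S k) * / (x + y) ^ (S j + S k)))).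
  { apply ns_ext; intros k _. rewrite Nat.sub_succ, (Nat.add_succ_r (S j)).
    rewrite <- (tech_pow_Rmult (x + y) (S j + k)), Rinv_mult. ring. }
  rewrite T1, T2, T3, T4. ring.
Qed.

Definition z0 (x : R) : R := if Req_EM_T x 0 then 1 else 0.

(* Since [/ 0 = 0], vanishing denominators only contribute the two [z0] corrections. *)
Lemma partial_fractions_total (j s : nat) : (1 <= j)%nat -> (1 <= s)%nat ->
  exists cx cy : nat -> R, (forall i, isQ (cx i)) /\ (forall i, isQ (cy i)) /\ cx O = 1 /\
    forall x y, (x = 0 -> y = 0) ->
      / x ^ j * / y ^ s =
      ns j (fun i => cx i * (/ x ^ (j - i) * / (x + y) ^ (s + i))) +
      ns s (fun k => cy k * (/ y ^ (s - k) * / (x + y) ^ (j + k)))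
      - ns j cx * (z0 y * / (x + y) ^ (j + s)) + (-1) ^ j * (z0 (x + y) * / y ^ (j + s)).
Proof.
  intros Hj Hs. destruct (partial_fractions (j + s - 1) j s ltac:(lia)) as (cx & cy & Qx & Qy & C0 & H).
  exists cx, cy. repeat split; auto.
  intros x y Hxy. unfold z0.
  destruct (Req_EM_T y 0) as [->|Hy].
  - rewrite Rplus_0_r. rewrite (ns_ext s _ (fun _ => 0)).
    2:{ intros k Hk. rewrite Rinv_pow_0 by lia. ring. }
    rewrite ns_const, !Rinv_pow_0 by lia.
    rewrite (ns_ext j _ (fun i => / x ^ (j + s) * cx i)).
    2:{ intros i Hi. rewrite <- Rinv_mult, <- pow_add. replace (j - i + (s + i))%nat with (j + s)%nat by lia. ring. }
    rewrite ns_scal. ring.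
  - destruct (Req_dec x 0) as [->|Hx]; [tauto|].
    destruct (Req_EM_T (x + y) 0) as [Hm|Hm].
    + rewrite Hm. rewrite (ns_ext s _ (fun _ => 0)).
      2:{ intros k Hk. rewrite (Rinv_pow_0 (j + k)) by lia. ring. }
      rewrite (ns_ext j _ (fun _ => 0)).
      2:{ intros k Hk. rewrite (Rinv_pow_0 (s + k)) by lia. ring. }
      rewrite !ns_const. replace x with (-1 * y) by lra.
      rewrite Rpow_mult_distr, !pow_add, !Rinv_mult, <- (pow_inv (-1)). replace (/ -1) with (-1) by field. ring.
    + rewrite (H x y Hx Hy Hm). ring.
Qed.

(** * Absolute convergence *)

Lemma zs_split (N : nat) (f : Z -> R) :
  zs N f = f 0%Z + ns N (fun k => f (Z.of_nat (S k)) + f (- Z.of_nat (S k))%Z).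
Proof. induction N; cbn [zs ns]; [ring|]. rewrite IHN; ring. Qed.

(** Applied to the square roots a and b of two integers at distance at least [L], so that terms of
    exponent 3/2 telescope. *)
Lemma sparse_step (a b L : R) : 0 < a -> 0 < b -> 0 < L -> L <= b * b - a * a ->
  / (b * b * b) <= 2 / L * (/ a - / b).
Proof.
  intros Ha Hb HL H. assert (Hab : a < b) by nra.
  apply Rmult_le_reg_r with (a * (b * b * b) * L); [repeat apply Rmult_lt_0_compat; lra|].
  replace (/ (b * b * b) * (a * (b * b * b) * L)) with (a * L) by (field; lra).
  replace (2 / L * (/ a - / b) * (a * (b * b * b) * L)) with (2 * (b * b) * (b - a)) by (field; lra).
  apply Rle_trans with (b * L); [nra|].
  apply Rle_trans with (b * ((b + a) * (b - a))); [nra|].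
  replace (2 * (b * b) * (b - a)) with (b * (2 * b * (b - a))) by ring.
  apply Rmult_le_compat_l; [lra|]. apply Rmult_le_compat_r; lra.
Qed.

(* Gaps of length at least [L] make the sum of [n^(-3/2)] telescope against [2 / (L sqrt n)]. *)
Lemma sparse_sum (u : nat -> bool) (L : R) (N : nat) : 0 < L ->
  (forall k, (1 <= k)%nat -> u k = true -> L <= INR k) ->
  (forall p q, (1 <= p)%nat -> (p < q)%nat -> u p = true -> u q = true -> L <= INR q - INR p) ->
  ns N (fun k => if u (S k) then / (INR (S k) * sqrt (INR (S k))) else 0) <= 3 / (L * sqrt L).
Proof.
  intros HL H1 H2. assert (sL := sqrt_lt_R0 L HL).
  set (w := fun k => if u (S k) then / (INR (S k) * sqrt (INR (S k))) else 0).
  (* The invariant refers to the last marked index n. The first marked term costs at most 1 / (L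
     sqrt L) and leaves a reserve 2 / (L sqrt n) <= 2 / (L sqrt L), hence the constant 3. *)
  assert (inv : (ns N w = 0 /\ forall k, (1 <= k <= N)%nat -> u k = false) \/
    exists n, (1 <= n <= N)%nat /\ u n = true /\
      ns N w <= 3 / (L * sqrt L) - 2 / L * / sqrt (INR n)).
  { induction N as [|N IH]; [left; split; [reflexivity|lia]|].
    cbn [ns]. unfold w at 2 4. destruct (u (S N)) eqn:E.
    - right. exists (S N). split; [lia|]. split; [exact E|].
      assert (Hm : 0 < INR (S N)) by (apply lt_0_INR; lia).
      assert (sm := sqrt_lt_R0 _ Hm). assert (dm := sqrt_sqrt (INR (S N)) (Rlt_le _ _ Hm)).
      destruct IH as [[Z0 Z1]|(n & Hn & Un & IH)].
      + rewrite Z0, Rplus_0_l. assert (HLm := H1 (S N) ltac:(lia) E).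
        assert (sqrt L <= sqrt (INR (S N))) by (apply sqrt_le_1; lra).
        assert (dL := sqrt_sqrt L (Rlt_le _ _ HL)).
        assert (I1 : / sqrt (INR (S N)) <= / sqrt L) by (apply Rinv_le_contravar; lra).
        assert (I2 : / INR (S N) <= / L) by (apply Rinv_le_contravar; lra).
        assert (P1 := Rinv_0_lt_compat _ sm). assert (P2 := Rinv_0_lt_compat _ HL).
        assert (P3 := Rinv_0_lt_compat _ Hm). assert (P4 := Rinv_0_lt_compat _ sL).
        unfold Rdiv. rewrite !Rinv_mult. nra.
      + assert (G := H2 n (S N) ltac:(lia) ltac:(lia) Un E).
        assert (Hn0 : 0 < INR n) by (apply lt_0_INR; lia).
        assert (sn := sqrt_lt_R0 _ Hn0). assert (dn := sqrt_sqrt (INR n) (Rlt_le _ _ Hn0)).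
        assert (St := sparse_step (sqrt (INR n)) (sqrt (INR (S N))) L sn sm HL ltac:(lra)).
        rewrite dm in St. lra.
    - rewrite Rplus_0_r. destruct IH as [[Z0 Z1]|(n & Hn & Un & IH)].
      + left; split; [exact Z0|]. intros k Hk. destruct (Nat.eq_dec k (S N)) as [->|]; [exact E|apply Z1; lia].
      + right. exists n. split; [lia|]. auto. }
  destruct inv as [[-> _]|(n & Hn & _ & H)].
  - apply Rlt_le, Rdiv_lt_0_compat; [lra|]. apply Rmult_lt_0_compat; lra.
  - assert (Hn0 : 0 < INR n) by (apply lt_0_INR; lia).
    assert (0 < 2 / L * / sqrt (INR n)).
    { apply Rmult_lt_0_compat; [apply Rdiv_lt_0_compat; lra|]. apply Rinv_0_lt_compat, sqrt_lt_R0, Hn0. }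
    lra.
Qed.

Definition below (t e : R) : bool := if Rlt_dec t e then true else false.

(** A layer decomposition: if i is the last level with t < 4^(-i), then t >= 4^(-i-1), and that
    single summand already bounds 1 / t; the summand 1 covers t >= 1. *)
Lemma inv_le_levels (t : R) (I : nat) : / 4 ^ I <= t ->
  / t <= 1 + ns I (fun i => 4 ^ S i * (if below t (/ 4 ^ i) then 1 else 0)).
Proof.
  intros H. assert (P : forall i, 0 < 4 ^ i) by (intros; apply pow_lt; lra).
  assert (Ht : 0 < t) by (assert (0 < / 4 ^ I) by apply Rinv_0_lt_compat, P; lra).
  assert (nn : forall I, 0 <= ns I (fun i => 4 ^ S i * (if below t (/ 4 ^ i) then 1 else 0))).
  { intros J. replace 0 with (ns J (fun _ => 0)) at 1 by (rewrite ns_const; ring). apply ns_le. intros k _.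
    cbv beta. apply Rmult_le_pos; [apply Rlt_le, P|]. destruct (below t (/ 4 ^ k)); lra. }
  induction I; cbn [ns].
  - simpl in H. rewrite Rinv_1 in H. rewrite Rplus_0_r. rewrite <- Rinv_1.
    apply Rinv_le_contravar; lra.
  - unfold below at 2. destruct (Rlt_dec t (/ 4 ^ I)) as [l|l].
    + assert (/ t <= 4 ^ S I).
      { rewrite <- (Rinv_inv (4 ^ S I)). apply Rinv_le_contravar; [apply Rinv_0_lt_compat, P|exact H]. }
      generalize (nn I). lra.
    + assert (IH := IHI ltac:(lra)). lra.
Qed.

Lemma ns_swap (N M : nat) (f : nat -> nat -> R) :
  ns N (fun n => ns M (fun m => f n m)) = ns M (fun m => ns N (fun n => f n m)).
Proof.
  induction N; cbn [ns]; [now rewrite ns_const, Rmult_0_r|]. rewrite IHN, <- ns_plus. reflexivity.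
Qed.

(** The indices where [th] is below 4^(-i) start no earlier than a multiple of 4^i and are equally
    far apart, so their layer of the sum is of order 4^i / (4^i)^(3/2) = 2^(-i), and the layers form
    a geometric series. *)
Lemma gap_sum_bounded (th : nat -> R) (c : R) : 0 < c ->
  (forall k, (1 <= k)%nat -> c <= INR k * th k) ->
  (forall p q, (1 <= p)%nat -> (p < q)%nat -> c <= (INR q - INR p) * (th p + th q)) ->
  exists B, forall N, ns N (fun k => / (INR (S k) * sqrt (INR (S k))) * / th (S k)) <= B.
Proof.
  intros Hc H1 H2.
  assert (P : forall i, 0 < 4 ^ i) by (intros; apply pow_lt; lra).
  assert (s2 : 0 < sqrt (c / 2)) by (apply sqrt_lt_R0; lra).
  (* The first 3 bounds the sum of n^(-3/2); 12 is 4 times 3, the 4 coming from the weight 4^(i+1)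
     of a layer; the last 2 is the geometric series. *)
  exists (3 + 12 / (c / 2 * sqrt (c / 2)) * 2). intros N.
  destruct (nfloor_ex (INR N / c)) as [I0 [_ HI]].
  { apply Rmult_le_pos; [apply pos_INR|]. apply Rlt_le, Rinv_0_lt_compat, Hc. }
  (* As [th k] >= c / N for k <= N, the levels below an [I] with 4^I >= N / c are enough; the final
     bound does not depend on [I]. *)
  set (I := S I0).
  assert (HI4 : INR N / c <= 4 ^ I).
  { apply Rle_trans with (INR I); [unfold I; rewrite S_INR; lra|].
    generalize (Nat.pow_gt_lin_r 4 I ltac:(lia)). intros H.
    replace (4 ^ I) with (INR (4 ^ I)); [apply le_INR; lia|]. rewrite pow_INR. f_equal. simpl; lra. }
  set (w := fun k => / (INR (S k) * sqrt (INR (S k)))).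
  assert (w0 : forall k, 0 < w k).
  { intros k. unfold w. assert (0 < INR (S k)) by (apply lt_0_INR; lia).
    apply Rinv_0_lt_compat, Rmult_lt_0_compat; [assumption|]. apply sqrt_lt_R0; assumption. }
  apply Rle_trans with (ns N (fun k => w k + ns I (fun i => 4 ^ S i * (if below (th (S k)) (/ 4 ^ i) then w k else 0)))).
  - apply ns_le. intros k Hk. fold (w k).
    assert (Hk0 : 0 < INR (S k)) by (apply lt_0_INR; lia).
    assert (HkN : INR (S k) <= INR N) by (apply le_INR; lia).
    assert (T := H1 (S k) ltac:(lia)).
    assert (T0 : 0 < th (S k)) by nra.
    assert (L := inv_le_levels (th (S k)) I).
    apply Rle_trans with (w k * (1 + ns I (fun i => 4 ^ S i * (if below (th (S k)) (/ 4 ^ i) then 1 else 0)))).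
    + apply Rmult_le_compat_l; [apply Rlt_le, w0|]. apply L.
      rewrite <- (Rinv_inv (th (S k))). apply Rinv_le_contravar; [apply Rinv_0_lt_compat, T0|].
      eapply Rle_trans; [|exact HI4].
      apply Rmult_le_reg_r with (c * th (S k)); [apply Rmult_lt_0_compat; lra|].
      replace (/ th (S k) * (c * th (S k))) with c by (field; lra).
      replace (INR N / c * (c * th (S k))) with (INR N * th (S k)) by (field; lra). nra.
    + rewrite Rmult_plus_distr_l, Rmult_1_r, <- ns_scal. apply Req_le. f_equal.
      apply ns_ext. intros i _. destruct (below _ _); ring.
  - rewrite ns_plus, ns_swap. apply Rplus_le_compat.
    + assert (Sp := sparse_sum (fun _ => true) 1 N ltac:(lra)). cbv beta iota in Sp.
      rewrite sqrt_1, Rmult_1_r in Sp. replace (3 / 1) with 3 in Sp by field. apply Sp.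
      * intros k Hk _. apply (le_INR 1); auto.
      * intros p q _ Hpq _ _. rewrite <- minus_INR by lia. apply (le_INR 1); lia.
    + apply Rle_trans with (ns I (fun i => 12 / (c / 2 * sqrt (c / 2)) * (/ 2) ^ i)).
      * apply ns_le. intros i _. rewrite ns_scal.
        assert (P2 : 0 < 2 ^ i) by (apply pow_lt; lra).
        assert (E4 : 4 ^ i = 2 ^ i * 2 ^ i) by (rewrite <- Rpow_mult_distr; f_equal; lra).
        assert (Lp : 0 < c / 2 * 4 ^ i) by (apply Rmult_lt_0_compat; [lra|apply P]).
        assert (Sp := sparse_sum (fun k => below (th k) (/ 4 ^ i)) (c / 2 * 4 ^ i) N Lp).
        assert (sq : sqrt (c / 2 * 4 ^ i) = sqrt (c / 2) * 2 ^ i).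
        { rewrite sqrt_mult by (try apply Rlt_le, P; lra). f_equal. rewrite E4. apply sqrt_square; lra. }
        rewrite sq in Sp.
        assert (bel : forall t, below t (/ 4 ^ i) = true -> t * 4 ^ i < 1).
        { intros t. unfold below. destruct (Rlt_dec t (/ 4 ^ i)) as [l|]; [intros _|discriminate].
          apply Rmult_lt_compat_r with (r := 4 ^ i) in l; [|apply P].
          rewrite Rinv_l in l; [exact l|]. apply Rgt_not_eq, P. }
        apply Rle_trans with (4 ^ S i * (3 / (c / 2 * 4 ^ i * (sqrt (c / 2) * 2 ^ i)))).
        -- apply Rmult_le_compat_l; [apply Rlt_le, P|]. apply Sp.
           ++ intros k Hk Bk. apply bel in Bk. assert (T := H1 k Hk).
              assert (K0 := pos_INR k). assert (Pi := P i).
              assert (c * 4 ^ i <= INR k * (th k * 4 ^ i)) by nra. nra.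
           ++ intros p q Hp Hpq Bp Bq. apply bel in Bp. apply bel in Bq.
              assert (T := H2 p q Hp Hpq). assert (D : 0 < INR q - INR p) by (apply lt_INR in Hpq; lra).
              assert (Pi := P i).
              assert (c * 4 ^ i <= (INR q - INR p) * (th p * 4 ^ i + th q * 4 ^ i)) by nra. nra.
        -- apply Req_le. rewrite pow_inv. simpl pow. rewrite E4. revert P2. generalize (2 ^ i).
           revert s2. generalize (sqrt (c / 2)). intros. field. repeat split; lra.
      * rewrite ns_scal. apply Rmult_le_compat_l.
        -- apply Rlt_le, Rdiv_lt_0_compat; [lra|]. apply Rmult_lt_0_compat; lra.
        -- assert (G : ns I (fun i => (/ 2) ^ i) = 2 - 2 * (/ 2) ^ I).
           { generalize I. clear. induction I; cbn [ns]; [simpl; ring|]. rewrite IHI. simpl. field. }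
           change (ns I (fun i => (/ 2) ^ i) <= 2). rewrite G. assert (0 < (/ 2) ^ I) by (apply pow_lt; lra). lra.
Qed.

Lemma abs_sin_le_dist (X : R) (m : Z) : Rabs (sin (PI * X)) <= PI * Rabs (X + IZR m).
Proof.
  assert (S := sin2_shift_Z (PI * X) m). replace (PI * X + IZR m * PI) with (PI * (X + IZR m)) in S by ring.
  assert (E : Rabs (sin (PI * X)) = Rabs (sin (PI * (X + IZR m)))).
  { apply Rsqr_eq_abs_0. unfold Rsqr. simpl in S. lra. }
  rewrite E. set (y := X + IZR m). assert (HPI := PI_RGT_0).
  assert (pos : forall z, 0 <= z -> Rabs (sin z) <= z).
  { intros z Hz. assert (B := SIN_bound z). apply Rabs_le.
    destruct (Rle_lt_dec z 1) as [l|l]; [|lra].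
    assert (PI > 1) by (generalize PI2_1; lra).
    assert (0 <= sin z) by (apply sin_ge_0; lra).
    destruct (Req_dec z 0) as [->|]; [rewrite sin_0; lra|].
    assert (sin z < z) by (apply sin_lt_x; lra). lra. }
  destruct (Rle_lt_dec 0 y) as [l|l].
  - rewrite (Rabs_pos_eq y) by auto. apply pos. apply Rmult_le_pos; lra.
  - rewrite (Rabs_left y) by auto. replace (PI * y) with (- (PI * - y)) by ring.
    rewrite sin_neg, Rabs_Ropp. apply pos. apply Rmult_le_pos; lra.
Qed.

(** No denominator is smaller than |sin (pi X)| / pi, so all but two factors are bounded pointwise
    and the remaining squares are summed. *)
Lemma zs_inv_pow_bound (X : R) (j N : nat) : (2 <= j)%nat -> sin (PI * X) <> 0 ->
  Rabs (zs N (fun m => / (X + IZR m) ^ j)) <= (PI / Rabs (sin (PI * X))) ^ j.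
Proof.
  intros Hj HX. assert (HPI := PI_RGT_0). assert (S0 := Rabs_pos_lt _ HX).
  set (t := PI / Rabs (sin (PI * X))). assert (T0 : 0 < t) by (apply Rdiv_lt_0_compat; lra).
  assert (D : forall m, / Rabs (X + IZR m) <= t).
  { intros m. assert (A := abs_sin_le_dist X m).
    assert (0 < Rabs (X + IZR m)) by nra.
    apply Rmult_le_reg_r with (Rabs (X + IZR m) * Rabs (sin (PI * X))); [apply Rmult_lt_0_compat; lra|].
    unfold t. replace (PI / Rabs (sin (PI * X)) * (Rabs (X + IZR m) * Rabs (sin (PI * X)))) with (PI * Rabs (X + IZR m)) by (field; lra).
    replace (/ Rabs (X + IZR m) * (Rabs (X + IZR m) * Rabs (sin (PI * X)))) with (Rabs (sin (PI * X))) by (field; lra).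
    exact A. }
  eapply Rle_trans; [apply zs_abs|].
  apply Rle_trans with (zs N (fun m => t ^ (j - 2) * / (X + IZR m) ^ 2)).
  - apply zs_le. intros m _. rewrite Rabs_inv, <- RPow_abs, <- (pow2_abs (X + IZR m)).
    replace j with ((j - 2) + 2)%nat at 1 by lia. rewrite pow_add, Rinv_mult.
    apply Rmult_le_compat_r.
    + rewrite pow2_abs. rewrite <- (Nat.mul_1_r 2). apply inv_pow_even_nonneg.
    + rewrite <- pow_inv. apply pow_incr. split; [|apply D].
      rewrite <- Rabs_inv. apply Rabs_pos.
  - rewrite zs_scal. replace (t ^ j) with (t ^ (j - 2) * t ^ 2) by (rewrite <- pow_add; f_equal; lia).
    apply Rmult_le_compat_l; [apply pow_le; lra|].
    eapply Rle_trans; [apply zs_inv_sq_le, HX|]. apply Req_le. unfold t.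
    rewrite <- (pow2_abs (sin (PI * X))). field. lra.
Qed.

(** For exponent 1 absolute values cannot be summed over all m. Up to |m| of order 2 |X|, comparison
    with the sum of squares in the manner of Cauchy and Schwarz costs a factor sqrt (1 + |X|);
    beyond that, pairing m with -m gives 2 X / (X^2 - m^2), whose tail telescopes to a constant. *)
Lemma zs_inv_bound (X : R) (N : nat) : sin (PI * X) <> 0 ->
  Rabs (zs N (fun m => / (X + IZR m))) <= 4 * sqrt (1 + Rabs X) * (PI / Rabs (sin (PI * X))).
Proof.
  intros HX. assert (HPI := PI_RGT_0). assert (S0 := Rabs_pos_lt _ HX).
  set (t := PI / Rabs (sin (PI * X))).
  assert (T1 : 1 <= t).
  { unfold t. apply Rmult_le_reg_r with (Rabs (sin (PI * X))); [lra|].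
    replace (PI / Rabs (sin (PI * X)) * Rabs (sin (PI * X))) with PI by (field; lra).
    assert (B := SIN_bound (PI * X)). assert (Rabs (sin (PI * X)) <= 1) by (apply Rabs_le; lra).
    generalize PI2_1; lra. }
  assert (A0 := Rabs_pos X).
  assert (sq1 : 1 <= sqrt (1 + Rabs X)) by (rewrite <- sqrt_1 at 1; apply sqrt_le_1; lra).
  assert (small : forall N, INR N <= 2 * Rabs X + 1 ->
     Rabs (zs N (fun m => / (X + IZR m))) <= 2 * sqrt (1 + Rabs X) * t).
  { clear N. intros N HN. set (M := 2 * INR N + 1). assert (N0 := pos_INR N).
    assert (M0 : 0 < M) by (unfold M; lra).
    assert (sM := sqrt_lt_R0 M M0). assert (dM := sqrt_sqrt M (Rlt_le _ _ M0)).
    (* The weight that balances la t^2 / 2 against M / (2 la) in the inequality between arithmetic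
       and geometric mean. *)
    set (la := sqrt M / t). assert (la0 : 0 < la) by (apply Rdiv_lt_0_compat; lra).
    apply Rle_trans with (sqrt M * t).
    - eapply Rle_trans; [apply zs_abs|].
      apply Rle_trans with (zs N (fun m => la / 2 * / (X + IZR m) ^ 2 + / (2 * la))).
      + apply zs_le. intros m _. rewrite Rabs_inv, <- (pow2_abs (X + IZR m)), <- pow_inv.
        set (r := / Rabs (X + IZR m)).
        assert (0 <= (la * r - 1) ^ 2) by apply pow2_ge_0.
        apply Rmult_le_reg_r with (2 * la); [lra|].
        replace ((la / 2 * r ^ 2 + / (2 * la)) * (2 * la)) with (la * la * (r * r) + 1) by (field; lra). nra.
      + rewrite zs_plus, zs_scal, zs_const. fold M.
        assert (Q := zs_inv_sq_le X N HX).
        assert (Q2 : zs N (fun m => / (X + IZR m) ^ 2) <= t ^ 2).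
        { eapply Rle_trans; [exact Q|]. apply Req_le. unfold t. rewrite <- (pow2_abs (sin (PI * X))). field. lra. }
        apply Rle_trans with (la / 2 * t ^ 2 + M * / (2 * la)).
        * apply Rplus_le_compat_r, Rmult_le_compat_l; lra.
        * apply Req_le. rewrite <- dM at 1. unfold la. field. lra.
    - apply Rmult_le_compat_r; [lra|].
      replace (2 * sqrt (1 + Rabs X)) with (sqrt (4 * (1 + Rabs X))).
      + apply sqrt_le_1; unfold M; lra.
      + rewrite sqrt_mult by lra. f_equal. replace 4 with (2 * 2) by ring. apply sqrt_square; lra. }
  destruct (Rle_lt_dec (INR N) (2 * Rabs X + 1)) as [l|l].
  { eapply Rle_trans; [apply small, l|]. nra. }
  (* The cut-off K = floor (2 |X|) + 1 ensures X^2 <= m^2 / 4 throughout the tail. *)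
  destruct (nfloor_ex (2 * Rabs X)) as [k [Hk1 Hk2]]; [lra|].
  set (K := S k). assert (EK : INR K = INR k + 1) by (unfold K; now rewrite S_INR).
  assert (KN : (K <= N)%nat) by (apply INR_le; lra).
  assert (tail : Rabs (zs N (fun m => / (X + IZR m)) - zs K (fun m => / (X + IZR m))) <= 8 / 3 * Rabs X * (/ INR K - / INR N)).
  { clear l. induction KN as [|N HN IH].
    - rewrite !Rminus_diag, Rabs_R0. lra.
    - cbn [zs]. rewrite opp_IZR, <- INR_IZR_INZ.
      replace (zs N (fun m => / (X + IZR m)) + (/ (X + INR (S N)) + / (X + - INR (S N))) - zs K (fun m => / (X + IZR m)))
        with ((zs N (fun m => / (X + IZR m)) - zs K (fun m => / (X + IZR m))) + (/ (X + INR (S N)) + / (X + - INR (S N)))) by ring.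
      eapply Rle_trans; [apply Rabs_triang|].
      assert (KN : INR K <= INR N) by (apply le_INR; lia).
      assert (K0 := pos_INR k).
      rewrite S_INR. set (n := INR N) in *.
      assert (X2 : X * X = Rabs X * Rabs X) by (rewrite <- Rabs_mult, Rabs_pos_eq; [reflexivity|apply Rle_0_sqr]).
      assert (Hx : Rabs X < (n + 1) / 2) by lra.
      assert (Den : 3 / 4 * ((n + 1) * (n + 1)) <= (n + 1) * (n + 1) - X * X) by (rewrite X2; nra).
      assert (Den0 : 0 < (n + 1) * (n + 1)) by nra.
      assert (HxP : - (n + 1) < X < n + 1) by (destruct (Rabs_def2 X (n + 1) ltac:(lra)); lra).
      replace (/ (X + (n + 1)) + / (X + - (n + 1))) with (- (2 * X / ((n + 1) * (n + 1) - X * X))).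
      2:{ field. repeat split; nra. }
      rewrite Rabs_Ropp. unfold Rdiv at 1. rewrite !Rabs_mult, (Rabs_pos_eq 2), (Rabs_pos_eq (/ _)) by (try (apply Rlt_le, Rinv_0_lt_compat); lra).
      assert (I : / ((n + 1) * (n + 1) - X * X) <= 4 / 3 * / (n * (n + 1))).
      { replace (4 / 3 * / (n * (n + 1))) with (/ (3 / 4 * (n * (n + 1)))) by (field; lra).
        apply Rinv_le_contravar; nra. }
      assert (E : / n - / (n + 1) = / (n * (n + 1))) by (field; lra).
      assert (Fin : 2 * Rabs X * / ((n + 1) * (n + 1) - X * X) <= 8 / 3 * Rabs X * (/ n - / (n + 1))).
      { rewrite E. replace (8 / 3 * Rabs X * / (n * (n + 1))) with (2 * Rabs X * (4 / 3 * / (n * (n + 1)))) by (field; lra).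
        apply Rmult_le_compat_l; lra. }
      lra. }
  assert (K0 := pos_INR k).
  assert (tb : 8 / 3 * Rabs X * (/ INR K - / INR N) <= 2).
  { assert (0 < / INR N) by (apply Rinv_0_lt_compat; lra).
    assert (0 < / INR K) by (apply Rinv_0_lt_compat; lra).
    apply Rle_trans with (8 / 3 * Rabs X * / INR K); [apply Rmult_le_compat_l; lra|].
    apply Rmult_le_reg_r with (INR K); [lra|]. rewrite Rmult_assoc, Rinv_l by lra. lra. }
  assert (sK := small K ltac:(lra)).
  replace (zs N (fun m => / (X + IZR m))) with
    ((zs N (fun m => / (X + IZR m)) - zs K (fun m => / (X + IZR m))) + zs K (fun m => / (X + IZR m))) by ring.
  eapply Rle_trans; [apply Rabs_triang|]. nra.
Qed.

Lemma zs_inv_pow_uniform_bound (X : R) (j N : nat) : (1 <= j)%nat -> sin (PI * X) <> 0 ->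
  Rabs (zs N (fun m => / (X + IZR m) ^ j)) <= 4 * sqrt (1 + Rabs X) * (PI / Rabs (sin (PI * X))) ^ j.
Proof.
  intros Hj HX. destruct (Nat.eq_dec j 1) as [->|H].
  - rewrite (zs_ext N _ (fun m => / (X + IZR m))) by (intros; now rewrite pow_1).
    rewrite pow_1. apply zs_inv_bound, HX.
  - eapply Rle_trans; [apply zs_inv_pow_bound; [lia|exact HX]|].
    rewrite <- (Rmult_1_l (_ ^ j)) at 1. apply Rmult_le_compat_r.
    + apply pow_le, Rmult_le_pos; [apply Rlt_le, PI_RGT_0|].
      apply Rlt_le, Rinv_0_lt_compat, Rabs_pos_lt, HX.
    + assert (1 <= sqrt (1 + Rabs X)); [|lra]. rewrite <- sqrt_1 at 1.
      assert (A := Rabs_pos X). apply sqrt_le_1; lra.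
Qed.

(* Up to the constant, [|sin (pi q tau)|] is the distance from [q tau] to the integers: [tau] is badly approximable. *)
Definition Bad (tau : R) : Prop :=
  exists c, 0 < c /\ forall q : Z, q <> 0%Z -> c <= Rabs (IZR q) * Rabs (sin (PI * (IZR q * tau))).

Lemma abs_sin_4_le (x : R) : Rabs (sin (4 * x)) <= 4 * Rabs (sin x).
Proof.
  assert (D : forall y, Rabs (sin (2 * y)) <= 2 * Rabs (sin y)).
  { intros y. rewrite sin_2a, !Rabs_mult, (Rabs_pos_eq 2) by lra.
    assert (C := abs_cos_le_1 y).
    assert (S := Rabs_pos (sin y)). assert (C0 := Rabs_pos (cos y)). nra. }
  replace (4 * x) with (2 * (2 * x)) by ring. generalize (D (2 * x)) (D x). lra.
Qed.

Lemma abs_sin_shift_Z (x : R) (k : Z) : Rabs (sin (x + IZR k * PI)) = Rabs (sin x).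
Proof. apply Rsqr_eq_abs_0. unfold Rsqr. generalize (sin2_shift_Z x k). simpl. lra. Qed.

(** Quadrupling clears the denominators: 4 times the point is an integer plus (4 n + be) tau. *)
Lemma abs_sin_lattice_ge (tau : R) (al be n : Z) :
  Rabs (sin (PI * (IZR (4 * n + be) * tau))) <= 4 * Rabs (sin (PI * (IZR al / 4 + (IZR be / 4 + IZR n) * tau))).
Proof.
  eapply Rle_trans; [|apply abs_sin_4_le].
  rewrite <- (abs_sin_shift_Z _ al). apply Req_le. do 2 f_equal.
  rewrite plus_IZR, mult_IZR. field.
Qed.

Lemma lattice_sin_ne (tau : R) (al be n : Z) : Bad tau -> (4 * n + be <> 0)%Z ->
  sin (PI * (IZR al / 4 + (IZR be / 4 + IZR n) * tau)) <> 0.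
Proof.
  intros (c & Hc & H) Hq E. specialize (H _ Hq). assert (L := abs_sin_lattice_ge tau al be n).
  rewrite E, Rabs_R0 in L. assert (P := Rabs_pos (sin (PI * (IZR (4 * n + be) * tau)))).
  replace (Rabs (sin (PI * (IZR (4 * n + be) * tau)))) with 0 in H by lra. lra.
Qed.

Lemma lattice_coord_zero (be n : Z) : IZR be / 4 + IZR n = 0 <-> (4 * n + be = 0)%Z.
Proof.
  split; intros H.
  - apply eq_IZR. rewrite plus_IZR, mult_IZR. lra.
  - apply (f_equal IZR) in H. rewrite plus_IZR, mult_IZR in H. lra.
Qed.

(** The addition formula gives |sin (v - u)| <= |sin u| + |sin v|, and two arguments differ, up to
    sign, by 4 (q - p) pi tau, where bad approximability applies: two indices with small sines
    cannot be close. *)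
Lemma lattice_gap_sum (tau : R) (be e : Z) : Bad tau -> (0 <= be <= 3)%Z -> (e = 1 \/ e = -1)%Z ->
  exists B, forall N, ns N (fun k => / (INR (S k) * sqrt (INR (S k))) *
    / Rabs (sin (PI * (IZR (4 * (e * Z.of_nat (S k)) + be) * tau)))) <= B.
Proof.
  intros (c & Hc & H) Hb He.
  (* The 8 comes from |4 e k + be| <= 8 k; in the gap condition the factor is only 4. *)
  apply (gap_sum_bounded (fun k => Rabs (sin (PI * (IZR (4 * (e * Z.of_nat k) + be) * tau)))) (c / 8)); [lra| |].
  - intros k Hk. assert (Hk1 : 1 <= INR k) by (apply (le_INR 1); auto).
    assert (T := H (4 * (e * Z.of_nat k) + be)%Z ltac:(lia)).
    set (s := Rabs (sin _)) in *. assert (S0 : 0 <= s) by apply Rabs_pos.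
    assert (A : Rabs (IZR (4 * (e * Z.of_nat k) + be)) <= 8 * INR k).
    { rewrite plus_IZR, !mult_IZR, <- INR_IZR_INZ.
      assert (0 <= IZR be <= 3) by (split; apply IZR_le; lia).
      apply Rabs_le. destruct He as [-> | ->]; lra. }
    nra.
  - intros p q Hp Hpq. assert (Hpq1 : 0 < INR q - INR p) by (apply lt_INR in Hpq; lra).
    assert (T := H (4 * (Z.of_nat q - Z.of_nat p))%Z ltac:(lia)).
    set (sp := Rabs (sin (PI * (IZR (4 * (e * Z.of_nat p) + be) * tau)))).
    set (sq := Rabs (sin (PI * (IZR (4 * (e * Z.of_nat q) + be) * tau)))).
    assert (A : Rabs (sin (PI * (IZR (4 * (Z.of_nat q - Z.of_nat p)) * tau))) <= sp + sq).
    { set (u := PI * (IZR (4 * (e * Z.of_nat p) + be) * tau)) in sp.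
      set (v := PI * (IZR (4 * (e * Z.of_nat q) + be) * tau)) in sq.
      assert (E : Rabs (sin (PI * (IZR (4 * (Z.of_nat q - Z.of_nat p)) * tau))) = Rabs (sin (v - u))).
      { unfold u, v. rewrite !plus_IZR, !mult_IZR, minus_IZR. destruct He as [-> | ->].
        - do 2 f_equal. ring.
        - rewrite <- Rabs_Ropp, <- sin_neg. do 2 f_equal. ring. }
      rewrite E, sin_minus. unfold Rminus. eapply Rle_trans; [apply Rabs_triang|].
      rewrite Rabs_Ropp, !Rabs_mult.
      assert (Cu : Rabs (cos u) <= 1) by apply abs_cos_le_1.
      assert (Cv : Rabs (cos v) <= 1) by apply abs_cos_le_1.
      fold sp sq. assert (0 <= sp) by apply Rabs_pos. assert (0 <= sq) by apply Rabs_pos.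
      assert (C0 := Rabs_pos (cos u)). assert (C1 := Rabs_pos (cos v)). nra. }
    assert (Ab : Rabs (IZR (4 * (Z.of_nat q - Z.of_nat p))) = 4 * (INR q - INR p)).
    { rewrite mult_IZR, minus_IZR, <- !INR_IZR_INZ. apply Rabs_pos_eq. lra. }
    rewrite Ab in T. nra.
Qed.

(** The product y^(-s) th^(-j) splits into y^(-(s-j-1)), bounded since y >= 1/4, into (y
    th)^(-(j-1)), bounded by bad approximability, and into y^(-2) / th. With the factor sqrt k the
    last part becomes k^(-3/2) / th, the shape summed above. *)
Lemma lattice_term_bound (c t0 y th S r k A : R) (j s : nat) :
  (1 <= j)%nat -> (j + 1 <= s)%nat -> 0 < c -> 0 < k -> k / 4 <= y -> 1 / 4 <= y -> 0 < th -> c <= 4 * (y * th) ->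
  0 < S -> th <= 4 * S -> 0 <= r -> r <= A * sqrt k -> 0 <= A ->
  / y ^ s * (4 * r * (PI / S) ^ j) <=
    (4 * A * 16 * ((4 * PI) ^ j * (4 ^ (s - j - 1) * (4 / c) ^ (j - 1)))) * (/ (k * sqrt k) * / th).
Proof.
  intros Hj Hs Hc Hk Hy Hy4 Hth Hyth HS HthS Hr HrA HA.
  assert (HPI := PI_RGT_0). assert (y0 : 0 < y) by lra. assert (sk := sqrt_lt_R0 k Hk).
  assert (dk := sqrt_sqrt k (Rlt_le _ _ Hk)).
  assert (b1 : PI / S <= 4 * PI * / th).
  { apply Rmult_le_reg_r with (S * th); [apply Rmult_lt_0_compat; lra|].
    replace (PI / S * (S * th)) with (PI * th) by (field; lra).
    replace (4 * PI * / th * (S * th)) with (PI * (4 * S)) by (field; lra). nra. }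
  assert (b2 : (PI / S) ^ j <= (4 * PI) ^ j * (/ th) ^ j).
  { rewrite <- Rpow_mult_distr. apply pow_incr. split; [|exact b1]. apply Rlt_le, Rdiv_lt_0_compat; lra. }
  assert (ty : / (y * th) <= 4 / c).
  { apply Rmult_le_reg_r with (c * (y * th)); [repeat apply Rmult_lt_0_compat; lra|].
    replace (/ (y * th) * (c * (y * th))) with c by (field; lra).
    replace (4 / c * (c * (y * th))) with (4 * (y * th)) by (field; lra). lra. }
  assert (E : / y ^ s * (/ th) ^ j = (/ y) ^ (s - j - 1) * (/ (y * th)) ^ (j - 1) * ((/ y) ^ 2 * / th)).
  { assert (E' : forall a b, / y ^ (a + b + 2) * (/ th) ^ (b + 1) = (/ y) ^ a * (/ (y * th)) ^ b * ((/ y) ^ 2 * / th)).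
    { intros a b. rewrite <- pow_inv, !pow_add, Rinv_mult, Rpow_mult_distr. ring. }
    rewrite <- E'. do 3 f_equal; lia. }
  assert (iy : / y <= 4) by (replace 4 with (/ (1 / 4)) by field; apply Rinv_le_contravar; lra).
  assert (ik : / y <= 4 / k).
  { replace (4 / k) with (/ (k / 4)) by (field; lra). apply Rinv_le_contravar; lra. }
  assert (iy0 := Rinv_0_lt_compat y y0). assert (it0 := Rinv_0_lt_compat th Hth).
  assert (p1 : (/ y) ^ (s - j - 1) <= 4 ^ (s - j - 1)) by (apply pow_incr; lra).
  assert (yth0 : 0 < y * th) by (apply Rmult_lt_0_compat; lra).
  assert (p2 : (/ (y * th)) ^ (j - 1) <= (4 / c) ^ (j - 1)).
  { apply pow_incr. split; [apply Rlt_le, Rinv_0_lt_compat, yth0|exact ty]. }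
  assert (p3 : (/ y) ^ 2 <= 16 * / (k * k)).
  { apply Rle_trans with ((4 / k) ^ 2); [apply pow_incr; lra|]. apply Req_le. field. lra. }
  assert (q1 : 0 <= (/ y) ^ (s - j - 1)) by (apply pow_le; lra).
  assert (q2 : 0 <= (/ (y * th)) ^ (j - 1)) by (apply pow_le, Rlt_le, Rinv_0_lt_compat, yth0).
  assert (q3 : 0 <= (/ y) ^ 2) by (apply pow_le; lra).
  assert (q4 : 0 <= (4 * PI) ^ j) by (apply pow_le; lra).
  assert (ys : 0 <= / y ^ s) by (apply Rlt_le, Rinv_0_lt_compat, pow_lt, y0).
  apply Rle_trans with (/ y ^ s * (4 * (A * sqrt k) * ((4 * PI) ^ j * (/ th) ^ j))).
  { apply Rmult_le_compat_l; [exact ys|]. apply Rmult_le_compat; [lra| |lra|exact b2].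
    apply pow_le, Rlt_le, Rdiv_lt_0_compat; lra. }
  replace (/ y ^ s * (4 * (A * sqrt k) * ((4 * PI) ^ j * (/ th) ^ j)))
    with (4 * A * sqrt k * (4 * PI) ^ j * (/ y ^ s * (/ th) ^ j)) by ring.
  rewrite E.
  replace (4 * A * 16 * ((4 * PI) ^ j * (4 ^ (s - j - 1) * (4 / c) ^ (j - 1))) * (/ (k * sqrt k) * / th))
    with (4 * A * sqrt k * (4 * PI) ^ j * (4 ^ (s - j - 1) * (4 / c) ^ (j - 1) * (16 * / (k * k) * / th))).
  2:{ revert sk dk. generalize (4 ^ (s - j - 1)) ((4 / c) ^ (j - 1)) ((4 * PI) ^ j) (sqrt k).
      intros w1 w2 w3 w4 W4 W5. rewrite <- W5. field. repeat split; lra. }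
  apply Rmult_le_compat_l.
  { repeat apply Rmult_le_pos; lra. }
  apply Rmult_le_compat.
  - apply Rmult_le_pos; assumption.
  - apply Rmult_le_pos; lra.
  - apply Rmult_le_compat; assumption.
  - apply Rmult_le_compat_r; lra.
Qed.

Lemma lattice_domination (tau : R) (al be : Z) (j s : nat) :
  Bad tau -> (0 <= al <= 3)%Z -> (0 <= be <= 3)%Z -> (1 <= j)%nat -> (j + 1 <= s)%nat ->
  exists (g : Z -> R) (B : R),
    (forall N n, Rabs (/ (IZR be / 4 + IZR n) ^ s *
       zs N (fun m => / (IZR al / 4 + (IZR be / 4 + IZR n) * tau + IZR m) ^ j)) <= g n) /\
    forall N, zs N g <= B.
Proof.
  intros Hbad Ha Hb Hj Hs.
  destruct (lattice_gap_sum tau be 1 Hbad Hb ltac:(lia)) as [B1 HB1].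
  destruct (lattice_gap_sum tau be (-1) Hbad Hb ltac:(lia)) as [B2 HB2].
  assert (Hbad' := Hbad). destruct Hbad' as (c & Hc & H).
  set (A := sqrt (3 + 2 * Rabs tau)).
  set (C := 4 * A * 16 * ((4 * PI) ^ j * (4 ^ (s - j - 1) * (4 / c) ^ (j - 1)))).
  set (X := fun n => IZR al / 4 + (IZR be / 4 + IZR n) * tau).
  (* At n = 0 a bound by powers of |n| is void, so this term keeps its own bound; the terms with n >
     0 and n < 0 are summed by [B1] and [B2]. *)
  set (g := fun n => if Z.eq_dec n 0 then
       Rabs (/ (IZR be / 4 + IZR n) ^ s) * (4 * sqrt (1 + Rabs (X n)) * (PI / Rabs (sin (PI * X n))) ^ j)
     else C * (/ (IZR (Z.abs n) * sqrt (IZR (Z.abs n))) * / Rabs (sin (PI * (IZR (4 * n + be) * tau))))).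
  exists g, (g 0%Z + (C * B1 + C * B2)).
  assert (HPI := PI_RGT_0).
  assert (A0 : 0 <= A) by apply sqrt_pos.
  assert (C0 : 0 <= C).
  { unfold C. repeat apply Rmult_le_pos; try lra; apply pow_le; try lra.
    apply Rlt_le, Rdiv_lt_0_compat; lra. }
  split.
  - intros N n. rewrite Rabs_mult. fold (X n).
    destruct (Z.eq_dec (4 * n + be) 0) as [E|E].
    + assert (n = 0%Z) by lia. subst n. unfold g. simpl Z.eq_dec. destruct (Z.eq_dec 0 0); [|lia].
      apply lattice_coord_zero in E. rewrite E, Rinv_pow_0 by lia. rewrite Rabs_R0. lra.
    + assert (Hsin := lattice_sin_ne tau al be n Hbad E). fold (X n) in Hsin.
      assert (U := zs_inv_pow_uniform_bound (X n) j N Hj Hsin).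
      unfold g. destruct (Z.eq_dec n 0) as [_|Hn].
      * apply Rmult_le_compat_l; [apply Rabs_pos|exact U].
      * eapply Rle_trans; [apply Rmult_le_compat_l; [apply Rabs_pos|exact U]|].
        rewrite Rabs_inv, <- RPow_abs.
        assert (k1 : 1 <= IZR (Z.abs n)) by (apply IZR_le; lia).
        assert (bb : 0 <= IZR be <= 3) by (split; apply IZR_le; lia).
        assert (aa : 0 <= IZR al <= 3) by (split; apply IZR_le; lia).
        assert (yk : IZR (Z.abs n) / 4 <= Rabs (IZR be / 4 + IZR n) <= IZR (Z.abs n) + 1).
        { destruct (Z_lt_le_dec 0 n) as [p|p].
          - rewrite Z.abs_eq in * by lia. rewrite Rabs_pos_eq; lra.
          - rewrite Z.abs_neq, opp_IZR in * by lia. rewrite Rabs_left; lra. }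
        unfold C. apply (lattice_term_bound c tau); try assumption; try lra.
        -- assert (T := H _ E). assert (0 <= Rabs (sin (PI * (IZR (4 * n + be) * tau)))) by apply Rabs_pos.
           destruct H0 as [l|l]; [exact l|]. rewrite <- l in T. lra.
        -- assert (T := H _ E). replace (Rabs (IZR (4 * n + be))) with (4 * Rabs (IZR be / 4 + IZR n)) in T; [lra|].
           rewrite <- (Rabs_pos_eq 4) at 1 by lra. rewrite <- Rabs_mult. f_equal.
           rewrite plus_IZR, mult_IZR. field.
        -- apply Rabs_pos_lt, Hsin.
        -- apply abs_sin_lattice_ge.
        -- apply sqrt_pos.
        -- unfold A. rewrite <- sqrt_mult by (generalize (Rabs_pos tau); lra).
           apply sqrt_le_1; [generalize (Rabs_pos (X n)); lra| |].
           ++ apply Rmult_le_pos; generalize (Rabs_pos tau); lra.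
           ++ unfold X. eapply Rle_trans; [apply Rplus_le_compat_l, Rabs_triang|].
              rewrite Rabs_mult, (Rabs_pos_eq (IZR al / 4)) by lra.
              assert (t0 := Rabs_pos tau). nra.
  - intros N. rewrite zs_split. apply Rplus_le_compat_l. rewrite ns_plus.
    apply Rplus_le_compat.
    + rewrite (ns_ext N _ (fun k => C * (/ (INR (S k) * sqrt (INR (S k))) *
         / Rabs (sin (PI * (IZR (4 * (1 * Z.of_nat (S k)) + be) * tau)))))).
      * rewrite ns_scal. apply Rmult_le_compat_l; auto.
      * intros k _. unfold g. destruct (Z.eq_dec (Z.of_nat (S k)) 0) as [e|_]; [lia|].
        rewrite Z.abs_eq by lia. rewrite <- INR_IZR_INZ, Z.mul_1_l. reflexivity.
    + rewrite (ns_ext N _ (fun k => C * (/ (INR (S k) * sqrt (INR (S k))) *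
         / Rabs (sin (PI * (IZR (4 * (-1 * Z.of_nat (S k)) + be) * tau)))))).
      * rewrite ns_scal. apply Rmult_le_compat_l; auto.
      * intros k _. unfold g. destruct (Z.eq_dec (- Z.of_nat (S k)) 0) as [e|_]; [lia|].
        rewrite Z.abs_neq, Z.opp_involutive by lia. rewrite <- INR_IZR_INZ.
        replace (-1 * Z.of_nat (S k))%Z with (- Z.of_nat (S k))%Z by lia. reflexivity.
Qed.

(* The Eisenstein series [sum_m 1 / (x + m)^j]. *)
Definition EL (j : nat) (x : R) : R := real (Lim_seq (fun N => zs N (fun m => / (x + IZR m) ^ j))).

Lemma EL_lim (j : nat) (x : R) : (1 <= j)%nat -> sin (PI * x) <> 0 ->
  zlim (fun m => / (x + IZR m) ^ j) (EL j x).
Proof.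
  intros Hj Hx. destruct (cotp_power_expansion j Hj) as (g & _ & L).
  apply Lim_seq_correct'. eexists; apply L, Hx.
Qed.

Lemma EL_cotp (j : nat) : (1 <= j)%nat -> exists g, QP j g /\
  forall x, sin (PI * x) <> 0 -> EL j x = PI ^ j * (cotp x ^ j + g (cotp x)).
Proof.
  intros Hj. destruct (cotp_power_expansion j Hj) as (g & Hg & L). exists g; split; [exact Hg|].
  intros x Hx. unfold EL. now rewrite (is_lim_seq_unique _ _ (L x Hx)).
Qed.

Lemma EL_shift (j : nat) (x : R) (k : Z) : (1 <= j)%nat -> sin (PI * x) <> 0 ->
  EL j (x + IZR k) = EL j x.
Proof.
  intros Hj Hx. destruct (EL_cotp j Hj) as (g & _ & E).
  rewrite !E, cotp_shift; auto. apply sin_pi_shift_ne, Hx.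
Qed.

(* The lattice sum with a = al / 4 and b = be / 4; as [/ 0 = 0], the term n + b = 0 is absent. *)
Definition LS (tau : R) (s j : nat) (al be : Z) (l : R) : Prop :=
  zlim (fun n => / (IZR be / 4 + IZR n) ^ s *
     EL j (IZR al / 4 + (IZR be / 4 + IZR n) * tau)) l.

(** Reciprocity exchanges the roles of [m] and [n], which is legitimate for sums over squares;
    domination identifies their limit with the iterated sum. *)
Lemma LS_square (tau : R) (al be : Z) (j s : nat) :
  Bad tau -> (0 <= al <= 3)%Z -> (0 <= be <= 3)%Z -> (1 <= j)%nat -> (j + 1 <= s)%nat ->
  exists l, LS tau s j al be l /\
    is_lim_seq (fun N => zs N (fun n => / (IZR be / 4 + IZR n) ^ s *
       zs N (fun m => / (IZR al / 4 + (IZR be / 4 + IZR n) * tau + IZR m) ^ j))) l.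
Proof.
  intros Hbad Ha Hb Hj Hs.
  destruct (lattice_domination tau al be j s Hbad Ha Hb Hj Hs) as (g & B & Hg & HB).
  apply (zs_tannery (fun N n => / (IZR be / 4 + IZR n) ^ s *
       zs N (fun m => / (IZR al / 4 + (IZR be / 4 + IZR n) * tau + IZR m) ^ j)) _ g B); auto.
  intros n. destruct (Z.eq_dec (4 * n + be) 0) as [E|E].
  - apply lattice_coord_zero in E. rewrite E, Rinv_pow_0 by lia.
    apply is_lim_seq_ext with (fun _ => 0); [intros; ring|]. rewrite Rmult_0_l. apply is_lim_seq_const.
  - apply lim_scal. apply EL_lim; [exact Hj|].
    apply lattice_sin_ne; auto.
Qed.

Lemma LS_unique (tau : R) (s j : nat) (al be : Z) (l l' : R) :
  LS tau s j al be l -> LS tau s j al be l' -> l = l'.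
Proof.
  intros H H'. apply is_lim_seq_unique in H. apply is_lim_seq_unique in H'.
  rewrite H in H'. now injection H'.
Qed.

Lemma LS_lim_square (tau : R) (al be : Z) (j s : nat) (l : R) :
  Bad tau -> (0 <= al <= 3)%Z -> (0 <= be <= 3)%Z -> (1 <= j)%nat -> (j + 1 <= s)%nat ->
  LS tau s j al be l ->
    is_lim_seq (fun N => zs N (fun n => / (IZR be / 4 + IZR n) ^ s *
       zs N (fun m => / (IZR al / 4 + (IZR be / 4 + IZR n) * tau + IZR m) ^ j))) l.
Proof.
  intros Hbad Ha Hb Hj Hs H.
  destruct (LS_square tau al be j s Hbad Ha Hb Hj Hs) as (l' & H1 & H2).
  now rewrite (LS_unique _ _ _ _ _ _ _ H H1).
Qed.

(** * Reciprocity *)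

Lemma is_lim_seq_ns (M : nat) (u : nat -> nat -> R) (l : nat -> R) :
  (forall i, (i < M)%nat -> is_lim_seq (u i) (l i)) ->
  is_lim_seq (fun N => ns M (fun i => u i N)) (ns M l).
Proof.
  induction M; intros H; cbn [ns]; [apply is_lim_seq_const|].
  apply is_lim_seq_plus'; [apply IHM; auto|apply H; auto].
Qed.

Definition dbl (N : nat) (f : Z -> Z -> R) : R := zs N (fun n => zs N (fun m => f n m)).

Lemma dbl_plus (N : nat) (f g : Z -> Z -> R) : dbl N (fun n m => f n m + g n m) = dbl N f + dbl N g.
Proof.
  unfold dbl. rewrite <- zs_plus. apply zs_ext; intros n. apply zs_plus.
Qed.

Lemma dbl_scal (N : nat) (c : R) (f : Z -> Z -> R) : dbl N (fun n m => c * f n m) = c * dbl N f.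
Proof.
  unfold dbl. rewrite <- zs_scal. apply zs_ext; intros n. apply zs_scal.
Qed.

Lemma dbl_ns (N M : nat) (f : nat -> Z -> Z -> R) :
  dbl N (fun n m => ns M (fun i => f i n m)) = ns M (fun i => dbl N (f i)).
Proof.
  induction M; cbn [ns].
  - unfold dbl. rewrite (zs_ext N _ (fun _ => 0)) by (intros; rewrite zs_const; ring). rewrite zs_const; ring.
  - rewrite dbl_plus, IHM. reflexivity.
Qed.

Lemma dbl_prod (N : nat) (f g : Z -> R) : dbl N (fun n m => f n * g m) = zs N f * zs N g.
Proof.
  unfold dbl. rewrite Rmult_comm, <- zs_scal. apply zs_ext; intros n. rewrite zs_scal; ring.
Qed.

Lemma dbl_swap (N : nat) (f : Z -> Z -> R) : dbl N f = dbl N (fun m n => f n m).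
Proof. apply zs_swap. Qed.

Definition quarter_val (al : Z) (k : nat) : R :=
  real (Lim_seq (fun N => zs N (fun m => / (IZR al / 4 + IZR m) ^ k))) / PI ^ k.

Lemma quarter_val_spec (al : Z) (k : nat) : (0 <= al <= 3)%Z -> (1 <= k)%nat ->
  isQ (quarter_val al k) /\
  zlim (fun m => / (IZR al / 4 + IZR m) ^ k) (PI ^ k * quarter_val al k).
Proof.
  intros Ha Hk. destruct (quarter_sum_rational al k Ha Hk) as (q & Hq & L).
  assert (P : PI ^ k <> 0) by (apply pow_nonzero, PI_neq0).
  assert (E : quarter_val al k = q).
  { unfold quarter_val. rewrite (is_lim_seq_unique _ _ L). simpl. field. exact P. }
  rewrite E. auto.
Qed.

Lemma zs_z0_quarter (al : Z) : (0 <= al <= 3)%Z ->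
  exists e, isQ e /\ forall N, zs N (fun m => z0 (IZR al / 4 + IZR m)) = e.
Proof.
  intros Ha. exists (z0 (IZR al / 4 + IZR 0)).
  assert (z : forall m, (4 * m + al <> 0)%Z -> z0 (IZR al / 4 + IZR m) = 0).
  { intros m Hm. unfold z0. destruct (Req_EM_T _ _) as [e|]; [|reflexivity].
    apply lattice_coord_zero in e. contradiction. }
  split.
  - unfold z0. destruct (Req_EM_T _ _); apply isQ_IZR.
  - induction N; cbn [zs]; [reflexivity|]. rewrite IHN, (z (Z.of_nat (S N))), (z (- Z.of_nat (S N))%Z) by lia. ring.
Qed.

Lemma z0_scal (c x : R) : c <> 0 -> z0 (c * x) = z0 x.
Proof.
  intros Hc. unfold z0. destruct (Req_EM_T (c * x) 0) as [e|e], (Req_EM_T x 0) as [f|f]; try reflexivity.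
  - apply Rmult_integral in e. tauto.
  - rewrite f, Rmult_0_r in e. tauto.
Qed.

Lemma Bad_ne (tau : R) : Bad tau -> tau <> 0.
Proof.
  intros (c & Hc & H) ->. specialize (H 1%Z ltac:(lia)). rewrite !Rmult_0_r, sin_0, Rabs_R0 in H. lra.
Qed.

(** With Y = - tau (n + b) the sum x + Y = m + a is free of n. Hence the terms in x and x + Y are
    lattice terms for 1 / tau with m and n exchanged, and those in Y and x + Y separate the
    variables. The coefficients are chosen before [tau], so that one identity serves an element and
    its conjugate. *)
Lemma LS_reciprocity (j s : nat) (al be : Z) :
  (0 <= al <= 3)%Z -> (0 <= be <= 3)%Z -> (1 <= j)%nat -> (j + 1 <= s)%nat ->
  exists (cx d : nat -> R) (e1 e2 : R),
    (forall i, isQ (cx i)) /\ cx O = 1 /\ (forall k, (k < s)%nat -> isQ (d k)) /\ isQ e1 /\ isQ e2 /\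
    forall tau l l', Bad tau -> Bad (/ tau) -> LS tau s j al be l ->
      (forall i, (i < j)%nat -> LS (/ tau) (s + i) (j - i) be al (l' i)) ->
      l = (- tau) ^ s * (ns j (fun i => cx i * (/ tau ^ (j - i) * l' i)) +
        PI ^ (j + s) * (ns s (fun k => d k * / (- tau) ^ (s - k)) + e1 + e2 * / (- tau) ^ (j + s))).
Proof.
  intros Ha Hb Hj Hs.
  destruct (partial_fractions_total j s Hj ltac:(lia)) as (cx & cy & Qx & Qy & C0 & PF).
  destruct (zs_z0_quarter al Ha) as (za & Qza & Eza).
  destruct (zs_z0_quarter be Hb) as (zb & Qzb & Ezb).
  assert (Qsum : forall M, isQ (ns M cx)).
  { induction M; cbn [ns]; auto with isq. }
  exists cx, (fun k => cy k * (quarter_val be (s - k) * quarter_val al (j + k))),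
    (- (ns j cx * (zb * quarter_val al (j + s)))), ((-1) ^ j * (za * quarter_val be (j + s))).
  split; [exact Qx|]. split; [exact C0|].
  split. { intros k Hk. apply isQ_mult; [apply Qy|]. apply isQ_mult; apply quarter_val_spec; auto; lia. }
  split. { apply isQ_opp, isQ_mult; [apply Qsum|]. apply isQ_mult; [exact Qzb|]. apply quarter_val_spec; auto; lia. }
  split. { apply isQ_mult; [auto with isq|]. apply isQ_mult; [exact Qza|]. apply quarter_val_spec; auto; lia. }
  intros tau l l' Hbad Hbad' HL HL'.
  assert (t0 := Bad_ne _ Hbad).
  assert (HLq := LS_lim_square tau al be j s l Hbad Ha Hb Hj Hs HL).
  set (a := fun m => IZR al / 4 + IZR m). set (b := fun n => IZR be / 4 + IZR n).
  set (x := fun n m => IZR al / 4 + b n * tau + IZR m).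
  set (Y := fun n => - tau * b n).
  assert (xY : forall n m, x n m + Y n = a m) by (intros; unfold x, Y, a; ring).
  assert (xa : forall n m, x n m = tau * (IZR be / 4 + a m * / tau + IZR n)).
  { intros; unfold x, a, b. field. exact t0. }
  (* The proviso of the partial fractions: by bad approximability a lattice point vanishes only
     where n + b does. *)
  assert (x0 : forall n m, x n m = 0 -> Y n = 0).
  { intros n m E. destruct (Z.eq_dec (4 * n + be) 0) as [Z0|Z0].
    - apply lattice_coord_zero in Z0. unfold Y, b. rewrite Z0. ring.
    - exfalso. apply (lattice_sin_ne tau al be n Hbad Z0). fold (b n).
      assert (S := abs_sin_le_dist (IZR al / 4 + b n * tau) m). fold (x n m) in S.
      rewrite E, Rabs_R0, Rmult_0_r in S. apply Rabs_eq_0. generalize (Rabs_pos (sin (PI * (IZR al / 4 + b n * tau)))). lra. }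
  (* [T1] leads to lattice sums at 1 / tau and [T2] to products of one-dimensional sums; [T3] and
     [T4] are the corrections at vanishing denominators, in which [z0] leaves a single free
     index. *)
  set (T1 := fun i n m => cx i * (/ tau ^ (j - i) * (/ a m ^ (s + i) * / (IZR be / 4 + a m * / tau + IZR n) ^ (j - i)))).
  set (T2 := fun k n m => cy k * (/ (- tau) ^ (s - k) * (/ b n ^ (s - k) * / a m ^ (j + k)))).
  set (T3 := fun n m => - ns j cx * (z0 (b n) * / a m ^ (j + s))).
  set (T4 := fun n m => (-1) ^ j * (/ (- tau) ^ (j + s) * (/ b n ^ (j + s) * z0 (a m)))).
  assert (PFnm : forall n m, / b n ^ s * / x n m ^ j = (- tau) ^ s * (
     ns j (fun i => T1 i n m) +
     ns s (fun k => T2 k n m) +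
     T3 n m + T4 n m)).
  { intros n m. unfold T1, T2, T3, T4.
    assert (E : / b n ^ s = (- tau) ^ s * / Y n ^ s).
    { unfold Y. rewrite Rpow_mult_distr, Rinv_mult, <- Rmult_assoc, Rinv_r; [ring|].
      apply pow_nonzero; lra. }
    rewrite E, Rmult_assoc, (Rmult_comm (/ Y n ^ s)), (PF _ _ (x0 n m)), xY. f_equal.
    replace (z0 (Y n)) with (z0 (b n)) by (symmetry; apply z0_scal; lra).
    rewrite (ns_ext j (fun i => cx i * (/ x n m ^ (j - i) * / a m ^ (s + i)))
       (fun i => cx i * (/ tau ^ (j - i) * (/ a m ^ (s + i) * / (IZR be / 4 + a m * / tau + IZR n) ^ (j - i))))).
    2:{ intros i _. rewrite xa, Rpow_mult_distr, Rinv_mult. ring. }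
    rewrite (ns_ext s (fun k => cy k * (/ Y n ^ (s - k) * / a m ^ (j + k)))
       (fun k => cy k * (/ (- tau) ^ (s - k) * (/ b n ^ (s - k) * / a m ^ (j + k))))).
    2:{ intros k _. unfold Y. rewrite Rpow_mult_distr, Rinv_mult. ring. }
    unfold Y. rewrite (Rpow_mult_distr (- tau) (b n) (j + s)), Rinv_mult. ring. }
  assert (lim1 : forall i, (i < j)%nat -> is_lim_seq (fun N => dbl N (T1 i))
     (cx i * (/ tau ^ (j - i) * l' i))).
  { intros i Hi.
    assert (Sq := LS_lim_square (/ tau) be al (j - i) (s + i) (l' i) Hbad' Hb Ha ltac:(lia) ltac:(lia) (HL' i Hi)).
    apply is_lim_seq_ext with (fun N => cx i * (/ tau ^ (j - i) *
       zs N (fun m => / a m ^ (s + i) * zs N (fun n => / (IZR be / 4 + a m * / tau + IZR n) ^ (j - i))))).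
    - intros N. unfold T1. rewrite !dbl_scal. do 2 f_equal. rewrite dbl_swap. unfold dbl.
      apply zs_ext; intros m. symmetry. apply zs_scal.
    - apply lim_scal. apply lim_scal.
      exact Sq. }
  assert (limb : forall k, (1 <= k)%nat -> zlim (fun n => / b n ^ k) (PI ^ k * quarter_val be k)).
  { intros; apply quarter_val_spec; auto. }
  assert (lima : forall k, (1 <= k)%nat -> zlim (fun n => / a n ^ k) (PI ^ k * quarter_val al k)).
  { intros; apply quarter_val_spec; auto. }
  assert (lim2 : forall k, (k < s)%nat -> is_lim_seq (fun N => dbl N (T2 k))
     (PI ^ (j + s) * (cy k * (quarter_val be (s - k) * quarter_val al (j + k)) * / (- tau) ^ (s - k)))).
  { intros k Hk.
    replace (PI ^ (j + s) * (cy k * (quarter_val be (s - k) * quarter_val al (j + k)) * / (- tau) ^ (s - k)))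
      with (cy k * (/ (- tau) ^ (s - k) * ((PI ^ (s - k) * quarter_val be (s - k)) * (PI ^ (j + k) * quarter_val al (j + k))))).
    2:{ replace (PI ^ (j + s)) with (PI ^ (s - k) * PI ^ (j + k)) by (rewrite <- pow_add; f_equal; lia). ring. }
    apply is_lim_seq_ext with (fun N => cy k * (/ (- tau) ^ (s - k) * (zs N (fun n => / b n ^ (s - k)) * zs N (fun m => / a m ^ (j + k))))).
    - intros N. unfold T2. now rewrite !dbl_scal, dbl_prod.
    - apply lim_scal. apply lim_scal.
      apply is_lim_seq_mult'; [apply limb|apply lima]; lia. }
  assert (lim3 : is_lim_seq (fun N => dbl N T3)
     (PI ^ (j + s) * - (ns j cx * (zb * quarter_val al (j + s))))).
  { replace (PI ^ (j + s) * - (ns j cx * (zb * quarter_val al (j + s)))) with (- ns j cx * (zb * (PI ^ (j + s) * quarter_val al (j + s)))) by ring.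
    apply is_lim_seq_ext with (fun N => - ns j cx * (zb * zs N (fun m => / a m ^ (j + s)))).
    - intros N. unfold T3. rewrite dbl_scal, dbl_prod. unfold b. now rewrite Ezb.
    - apply lim_scal. apply lim_scal.
      apply lima; lia. }
  assert (lim4 : is_lim_seq (fun N => dbl N T4)
     (PI ^ (j + s) * ((-1) ^ j * (za * quarter_val be (j + s)) * / (- tau) ^ (j + s)))).
  { replace (PI ^ (j + s) * ((-1) ^ j * (za * quarter_val be (j + s)) * / (- tau) ^ (j + s)))
      with ((-1) ^ j * (/ (- tau) ^ (j + s) * ((PI ^ (j + s) * quarter_val be (j + s)) * za))) by ring.
    apply is_lim_seq_ext with (fun N => (-1) ^ j * (/ (- tau) ^ (j + s) * (zs N (fun n => / b n ^ (j + s)) * za))).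
    - intros N. unfold T4. rewrite !dbl_scal, dbl_prod. unfold a. now rewrite Eza.
    - apply lim_scal. apply lim_scal.
      apply is_lim_seq_mult'; [|apply is_lim_seq_const]. apply limb; lia. }
  assert (G : is_lim_seq (fun N => zs N (fun n => / b n ^ s * zs N (fun m => / x n m ^ j)))
     ((- tau) ^ s * (ns j (fun i => cx i * (/ tau ^ (j - i) * l' i)) +
        ns s (fun k => PI ^ (j + s) * (cy k * (quarter_val be (s - k) * quarter_val al (j + k)) * / (- tau) ^ (s - k))) +
        PI ^ (j + s) * - (ns j cx * (zb * quarter_val al (j + s))) +
        PI ^ (j + s) * ((-1) ^ j * (za * quarter_val be (j + s)) * / (- tau) ^ (j + s))))).
  { apply is_lim_seq_ext with (fun N => (- tau) ^ s * (
      ns j (fun i => dbl N (T1 i)) +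
      ns s (fun k => dbl N (T2 k)) +
      dbl N T3 +
      dbl N T4)).
    - intros N. rewrite <- !dbl_ns, <- !dbl_plus, <- dbl_scal.
      unfold dbl. apply zs_ext; intros n. rewrite <- zs_scal. apply zs_ext; intros m.
      symmetry. apply PFnm.
    - apply lim_scal.
      apply is_lim_seq_plus'; [|exact lim4]. apply is_lim_seq_plus'; [|exact lim3].
      apply is_lim_seq_plus'.
      + apply (is_lim_seq_ns j _ _ lim1).
      + apply (is_lim_seq_ns s _ _ lim2). }
  assert (E : l = _) by (assert (U1 := is_lim_seq_unique _ _ HLq); assert (U2 := is_lim_seq_unique _ _ G);
     unfold x, b in U2; rewrite U1 in U2; injection U2 as U2; exact U2).
  rewrite E, ns_scal. ring.
Qed.

(** * Conjugate pairs *)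

(* [x] and [y] are conjugate elements of the quadratic field generated by [de]. *)
Definition InK (de x y : R) : Prop :=
  exists p q, isQ p /\ isQ q /\ x = p + q * de /\ y = p - q * de.

Definition Kgen (de : R) : Prop := isQ (de ^ 2) /\ ~ isQ de.

Lemma InK_Q (de x : R) : isQ x -> InK de x x.
Proof. intros H. exists x, 0. repeat split; auto 10 with isq; ring. Qed.

Lemma InK_sym (de x y : R) : InK de x y -> InK de y x.
Proof. intros (p & q & Hp & Hq & -> & ->). exists p, (- q). repeat split; auto 10 with isq; ring. Qed.

Lemma InK_plus (de x y x' y' : R) : InK de x y -> InK de x' y' -> InK de (x + x') (y + y').
Proof.
  intros (p & q & Hp & Hq & -> & ->) (p' & q' & Hp' & Hq' & -> & ->).
  exists (p + p'), (q + q'). repeat split; auto 10 with isq; ring.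
Qed.

Lemma InK_mult (de x y x' y' : R) : Kgen de -> InK de x y -> InK de x' y' -> InK de (x * x') (y * y').
Proof.
  intros [Hd _] (p & q & Hp & Hq & -> & ->) (p' & q' & Hp' & Hq' & -> & ->).
  exists (p * p' + q * q' * de ^ 2), (p * q' + q * p'). repeat split; auto 10 with isq; ring.
Qed.

Lemma InK_opp (de x y : R) : InK de x y -> InK de (- x) (- y).
Proof. intros (p & q & Hp & Hq & -> & ->). exists (- p), (- q). repeat split; auto 10 with isq; ring. Qed.

Lemma InK_minus (de x y x' y' : R) : InK de x y -> InK de x' y' -> InK de (x - x') (y - y').
Proof. intros; apply InK_plus; [|apply InK_opp]; assumption. Qed.

Lemma InK_solve (de x y x' y' k k' : R) : Kgen de ->
  InK de (x - k * y) (x' - k' * y') -> InK de k k' -> InK de y y' -> InK de x x'.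
Proof.
  intros Hd H K Y. replace x with (x - k * y + k * y) by ring.
  replace x' with (x' - k' * y' + k' * y') by ring.
  apply InK_plus, InK_mult; assumption.
Qed.

Lemma InK_lin_zero (de p q : R) : ~ isQ de -> isQ p -> isQ q -> p + q * de = 0 -> p = 0 /\ q = 0.
Proof.
  intros Hd Hp Hq E. destruct (Req_dec q 0) as [->|H]; [lra|].
  exfalso; apply Hd. replace de with (- p / q) by (field_simplify_eq; lra). auto with isq.
Qed.

Lemma InK_zero_iff (de x y : R) : ~ isQ de -> InK de x y -> (x = 0 <-> y = 0).
Proof.
  intros Hd (p & q & Hp & Hq & -> & ->). split; intros E.
  - destruct (InK_lin_zero de p q) as [-> ->]; auto; ring.
  - destruct (InK_lin_zero de p (- q)) as [-> E2]; auto with isq; [lra|]. rewrite <- (Ropp_involutive q), E2; ring.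
Qed.

(** Division by the norm p^2 - q^2 de^2. An element and its conjugate vanish together, so the
    convention for the inverse of 0 respects conjugation. *)
Lemma InK_inv (de x y : R) : Kgen de -> InK de x y -> InK de (/ x) (/ y).
Proof.
  intros [Hd Hn] H. assert (Z := InK_zero_iff de x y Hn H).
  destruct (Req_dec x 0) as [E|E].
  - assert (y = 0) by tauto. subst. rewrite Rinv_0. apply InK_Q. apply isQ_IZR.
  - assert (Ey : y <> 0) by tauto. destruct H as (p & q & Hp & Hq & -> & ->).
    exists (p / (p ^ 2 - q ^ 2 * de ^ 2)), (- q / (p ^ 2 - q ^ 2 * de ^ 2)).
    assert (p ^ 2 - q ^ 2 * de ^ 2 <> 0).
    { replace (p ^ 2 - q ^ 2 * de ^ 2) with ((p + q * de) * (p - q * de)) by ring.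
      apply Rmult_integral_contrapositive_currified; auto. }
    assert (isQ (p ^ 2 - q ^ 2 * de ^ 2)) by (apply isQ_minus; [|apply isQ_mult]; auto with isq).
    split; [auto with isq|]. split; [auto with isq|]. split; field; rewrite Rpow_mult_distr; auto.
Qed.

Lemma InK_pow (de x y : R) (n : nat) : Kgen de -> InK de x y -> InK de (x ^ n) (y ^ n).
Proof.
  intros Hd H; induction n; simpl; [apply InK_Q, isQ_IZR|apply InK_mult; auto].
Qed.

Lemma InK_ns (de : R) (M : nat) (u v : nat -> R) :
  (forall i, (i < M)%nat -> InK de (u i) (v i)) -> InK de (ns M u) (ns M v).
Proof.
  induction M; intros H; cbn [ns]; [apply InK_Q, isQ_IZR|]. apply InK_plus; auto.
Qed.

(** Being different from its conjugate encodes the irrationality of [t]. *)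
Definition Kirr (de t t' : R) : Prop := InK de t t' /\ t <> t'.

Lemma Kirr_not_Q (de t t' : R) : Kgen de -> Kirr de t t' -> ~ isQ t.
Proof.
  intros [_ Hn] [(p & q & Hp & Hq & -> & ->) H] Ht.
  destruct (InK_lin_zero de (p - (p + q * de)) q) as [_ E]; auto with isq; [ring|].
  apply H. rewrite E. ring.
Qed.

Lemma Kirr_sym (de t t' : R) : Kirr de t t' -> Kirr de t' t.
Proof. intros [H1 H2]; split; [apply InK_sym|]; auto. Qed.

Lemma Kirr_ne (de t t' : R) : Kgen de -> Kirr de t t' -> t <> 0.
Proof. intros Hd H E. apply (Kirr_not_Q _ _ _ Hd H). rewrite E. apply isQ_IZR. Qed.

Lemma Kirr_inv (de t t' : R) : Kgen de -> Kirr de t t' -> Kirr de (/ t) (/ t').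
Proof.
  intros Hd H. split; [apply InK_inv; [|apply H]; auto|]. intros E. apply H.
  rewrite <- (Rinv_inv t), E. apply Rinv_inv.
Qed.

Lemma Kirr_shift (de t t' : R) (k : Z) : Kirr de t t' -> Kirr de (t + IZR k) (t' + IZR k).
Proof.
  intros [H1 H2]. split; [apply InK_plus; [|apply InK_Q, isQ_IZR]; auto|]. intros E. apply H2. lra.
Qed.

Lemma Kirr_unshift (de t t' : R) (k : Z) : Kirr de t t' -> Kirr de (t - IZR k) (t' - IZR k).
Proof. intros H. unfold Rminus. rewrite <- opp_IZR. apply Kirr_shift, H. Qed.

Lemma isQ_frac (x : R) : isQ x -> exists a b : Z, b <> 0%Z /\ IZR b * x = IZR a.
Proof.
  intros [[a b] ->]. exists a, (Zpos b). split; [discriminate|]. unfold Q2R; simpl.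
  field. apply IZR_neq. discriminate.
Qed.

(** Vieta's relations for A x^2 + B x + C, which treat the two conjugate roots symmetrically. *)
Definition QF (A B C : Z) (t t' : R) : Prop :=
  A <> 0%Z /\ IZR A * (t + t') = - IZR B /\ IZR A * (t * t') = IZR C.

Lemma Kirr_QF (de t t' : R) : Kgen de -> Kirr de t t' -> exists A B C, QF A B C t t'.
Proof.
  intros [Hd _] [(p & q & Hp & Hq & -> & ->) _].
  assert (Q1 : isQ (2 * p)) by auto with isq. assert (Q2 : isQ (p * p - q * q * de ^ 2)) by auto with isq.
  destruct (isQ_frac _ Q1) as (a & b & Hb & E1), (isQ_frac _ Q2) as (c & d & Hd' & E2).
  exists (b * d)%Z, (- (a * d))%Z, (c * b)%Z. split; [lia|].
  rewrite opp_IZR, !mult_IZR. split; [|rewrite <- E2; ring].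
  rewrite <- E1. ring.
Qed.

(** With u = t / 2: sin 2u = 2 sin u cos u >= 2 u cos^2 u >= u, since 2 cos^2 u - 1 = cos 2u >=
    0. *)
Lemma sin_ge_half (t : R) : 0 <= t <= PI / 2 -> t / 2 <= sin t.
Proof.
  intros Ht. set (u := t / 2). assert (E : t = 2 * u) by (unfold u; field). rewrite E in *.
  assert (H := sin_ge_mul_cos u ltac:(lra)).
  assert (C0 : 0 <= cos (2 * u)) by (apply cos_ge_0; lra).
  assert (C1 : 0 <= cos u) by (apply cos_ge_0; lra).
  rewrite sin_2a. rewrite cos_2a_cos in C0.
  apply Rle_trans with (2 * (u * cos u) * cos u); [|apply Rmult_le_compat_r; lra]. nra.
Qed.

Lemma abs_sin_pi_ge (x : R) : exists p : Z, Rabs (x - IZR p) <= / 2 /\ Rabs (x - IZR p) <= Rabs (sin (PI * x)).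
Proof.
  destruct (archimed (x - / 2)) as [H1 H2]. set (p := up (x - / 2)) in *. exists p.
  assert (B : Rabs (x - IZR p) <= / 2) by (apply Rabs_le; lra). split; [exact B|].
  rewrite <- (abs_sin_shift_Z _ (- p)). rewrite opp_IZR.
  replace (PI * x + - IZR p * PI) with (PI * (x - IZR p)) by ring.
  set (y := x - IZR p) in *. assert (HPI := PI2_1).
  assert (pos : forall z, 0 <= z <= / 2 -> z <= Rabs (sin (PI * z))).
  { intros z Hz. assert (S := sin_ge_half (PI * z) ltac:(nra)).
    eapply Rle_trans; [|apply Rle_abs]. nra. }
  destruct (Rle_lt_dec 0 y) as [l|l].
  - rewrite (Rabs_pos_eq y) in * by auto. apply pos; lra.
  - rewrite (Rabs_left y) in * by auto. replace (PI * y) with (- (PI * - y)) by ring.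
    rewrite sin_neg, Rabs_Ropp. apply pos; lra.
Qed.

(** Liouville's argument: A p^2 + B p q + C q^2 is a nonzero integer with the factor p - q t, while
    the other factor is at most |q| M. With p the integer nearest to q t this bounds |q| |q t - p|
    from below by 1 / M. *)
Lemma Bad_quadratic (A B C : Z) (t : R) : A <> 0%Z ->
  IZR A * t ^ 2 + IZR B * t + IZR C = 0 -> ~ isQ t -> Bad t.
Proof.
  intros HA E Hirr.
  set (M := Rabs (IZR A) * (2 * Rabs t + 1) + Rabs (IZR B)).
  assert (A1 : 1 <= Rabs (IZR A)) by (rewrite <- abs_IZR; apply IZR_le; lia).
  assert (t0 := Rabs_pos t). assert (B0 := Rabs_pos (IZR B)).
  assert (HM : 1 <= M) by (unfold M; nra).
  exists (/ M). split; [apply Rinv_0_lt_compat; lra|]. intros q Hq.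
  assert (q1 : 1 <= Rabs (IZR q)) by (rewrite <- abs_IZR; apply IZR_le; lia).
  destruct (abs_sin_pi_ge (IZR q * t)) as (p & Hp1 & Hp2).
  apply Rle_trans with (Rabs (IZR q) * Rabs (IZR q * t - IZR p)); [|apply Rmult_le_compat_l; [lra|exact Hp2]].
  assert (q0 : IZR q <> 0) by (apply IZR_neq; exact Hq).
  assert (A0 : IZR A <> 0) by (apply IZR_neq; exact HA).
  set (F := (A * (p * p) + B * (p * q) + C * (q * q))%Z).
  assert (EF : IZR F = (IZR p - IZR q * t) * (IZR A * (IZR p + IZR q * t) + IZR B * IZR q)).
  { unfold F. rewrite !plus_IZR, !mult_IZR.
    replace (IZR C) with (- (IZR A * t ^ 2 + IZR B * t)) by lra. ring. }
  assert (F0 : F <> 0%Z).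
  { intros Z0. rewrite Z0 in EF. symmetry in EF. apply Rmult_integral in EF. apply Hirr. destruct EF as [e|e].
    - replace t with (IZR p / IZR q) by (field_simplify_eq; [lra|exact q0]). auto with isq.
    - replace t with ((- IZR A * IZR p - IZR B * IZR q) / (IZR A * IZR q)).
      + auto 10 with isq.
      + field_simplify_eq; [lra|auto]. }
  assert (F1 : 1 <= Rabs (IZR F)) by (rewrite <- abs_IZR; apply IZR_le; lia).
  rewrite EF, Rabs_mult in F1.
  replace (Rabs (IZR p - IZR q * t)) with (Rabs (IZR q * t - IZR p)) in F1 by apply Rabs_minus_sym.
  set (e := Rabs (IZR q * t - IZR p)) in *. assert (e0 : 0 <= e) by apply Rabs_pos.
  assert (G : Rabs (IZR A * (IZR p + IZR q * t) + IZR B * IZR q) <= Rabs (IZR q) * M).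
  { eapply Rle_trans; [apply Rabs_triang|]. rewrite !Rabs_mult.
    assert (P : Rabs (IZR p + IZR q * t) <= 2 * (Rabs (IZR q) * Rabs t) + Rabs (IZR q)).
    { replace (IZR p + IZR q * t) with (- (IZR q * t - IZR p) + 2 * (IZR q * t)) by ring.
      eapply Rle_trans; [apply Rabs_triang|]. rewrite Rabs_Ropp, !Rabs_mult, (Rabs_pos_eq 2) by lra.
      fold e. lra. }
    unfold M. nra. }
  apply Rmult_le_reg_r with M; [lra|]. rewrite Rinv_l by lra. nra.
Qed.

Lemma Kirr_Bad (de t t' : R) : Kgen de -> Kirr de t t' -> Bad t.
Proof.
  intros Hd H. destruct (Kirr_QF de t t' Hd H) as (A & B & C & HA & E1 & E2).
  apply (Bad_quadratic A B C t HA); [|apply (Kirr_not_Q de t t'); auto].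
  rewrite <- E2. replace (IZR B) with (- (IZR A * (t + t'))) by lra. ring.
Qed.

(** Division by pi^(j+s) leaves the number that is to lie in the quadratic field; [Lim_seq] makes it
    a total function, so that identities can be rewritten without carrying limits along. *)
Definition nv (t : R) (s j : nat) (al be : Z) : R :=
  real (Lim_seq (fun N => zs N (fun n => / (IZR be / 4 + IZR n) ^ s *
     EL j (IZR al / 4 + (IZR be / 4 + IZR n) * t)))) / PI ^ (j + s).

Lemma nv_spec (t : R) (s j : nat) (al be : Z) :
  Bad t -> (0 <= al <= 3)%Z -> (0 <= be <= 3)%Z -> (1 <= j)%nat -> (j + 1 <= s)%nat ->
  LS t s j al be (PI ^ (j + s) * nv t s j al be).
Proof.
  intros Hb Ha Hb' Hj Hs. destruct (LS_square t al be j s Hb Ha Hb' Hj Hs) as (l & Hl & _).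
  assert (E : PI ^ (j + s) * nv t s j al be = l).
  { unfold nv. rewrite (is_lim_seq_unique _ _ Hl). simpl. field. apply pow_nonzero, PI_neq0. }
  now rewrite E.
Qed.

(** Translation adds k (n + be / 4) to the argument: the integer k n disappears by periodicity, and
    k be / 4 moves the residue [al]. *)
Lemma nv_translate (t : R) (k : Z) (s j : nat) (al be : Z) :
  Bad t -> (1 <= j)%nat -> (1 <= s)%nat ->
  nv (t + IZR k) s j al be = nv t s j ((al + k * be) mod 4) be.
Proof.
  intros Hb Hj Hs. unfold nv. f_equal. f_equal. apply Lim_seq_ext. intros N. apply zs_ext. intros n.
  destruct (Z.eq_dec (4 * n + be) 0) as [E|E].
  - apply lattice_coord_zero in E. rewrite E, Rinv_pow_0 by lia. ring.
  - f_equal. rewrite <- (EL_shift j (IZR ((al + k * be) mod 4) / 4 + (IZR be / 4 + IZR n) * t) ((al + k * be) / 4 + n * k));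
      [|exact Hj|apply lattice_sin_ne; auto].
    f_equal. assert (D := Z.div_mod (al + k * be) 4 ltac:(lia)).
    apply (f_equal IZR) in D. rewrite !plus_IZR, !mult_IZR in D. rewrite !plus_IZR, mult_IZR. lra.
Qed.

Lemma nv_unshift (de t t' : R) (k : Z) (s j : nat) (al be : Z) :
  Kgen de -> Kirr de t t' -> (1 <= j)%nat -> (1 <= s)%nat ->
  nv t s j al be = nv (t - IZR k) s j ((al + k * be) mod 4) be.
Proof.
  intros Hd K Hj Hs. rewrite <- nv_translate; [f_equal; ring| |auto|auto].
  apply (Kirr_Bad de _ (t' - IZR k) Hd), Kirr_unshift, K.
Qed.

Lemma nv_reciprocity (j s : nat) (al be : Z) :
  (0 <= al <= 3)%Z -> (0 <= be <= 3)%Z -> (1 <= j)%nat -> (j + 1 <= s)%nat ->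
  exists (cx d : nat -> R) (e1 e2 : R),
    (forall i, isQ (cx i)) /\ cx O = 1 /\ (forall k, (k < s)%nat -> isQ (d k)) /\ isQ e1 /\ isQ e2 /\
    forall t, Bad t -> Bad (/ t) ->
      nv t s j al be = (- t) ^ s * (ns j (fun i => cx i * (/ t ^ (j - i) * nv (/ t) (s + i) (j - i) be al)) +
        (ns s (fun k => d k * / (- t) ^ (s - k)) + e1 + e2 * / (- t) ^ (j + s))).
Proof.
  intros Ha Hb Hj Hs. destruct (LS_reciprocity j s al be Ha Hb Hj Hs) as (cx & d & e1 & e2 & Qc & C0 & Qd & Q1 & Q2 & R).
  exists cx, d, e1, e2. repeat split; auto. intros t Ht Ht'.
  assert (E := R t (PI ^ (j + s) * nv t s j al be) (fun i => PI ^ (j + s) * nv (/ t) (s + i) (j - i) be al) Ht Ht').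
  assert (P : PI ^ (j + s) <> 0) by (apply pow_nonzero, PI_neq0).
  apply Rmult_eq_reg_l with (PI ^ (j + s)); [|exact P]. rewrite E.
  - rewrite (ns_ext j _ (fun i => PI ^ (j + s) * (cx i * (/ t ^ (j - i) * nv (/ t) (s + i) (j - i) be al)))) by (intros; ring).
    rewrite ns_scal. ring.
  - apply nv_spec; auto.
  - intros i Hi. replace (j + s)%nat with ((j - i) + (s + i))%nat by lia. apply nv_spec; auto; lia.
Qed.

(** The multiplier of the i = 0 term in the reciprocity law; for t nonzero and s > j it is (-1)^s
    t^(s-j), a contraction when |t| < 1. *)
Definition kap (t : R) (s j : nat) : R := (- t) ^ s * / t ^ j.

(** All residues are taken together because translation and inversion permute them. *)
Definition Gall (de : R) (s j : nat) (t t' : R) : Prop :=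
  forall al be, (0 <= al <= 3)%Z -> (0 <= be <= 3)%Z -> InK de (nv t s j al be) (nv t' s j al be).

(** Every admissible [s] is covered, since reciprocity raises [s] by the amount by which it lowers
    [j]. *)
Definition Lower (de : R) (j : nat) : Prop :=
  forall i s t t', (1 <= i)%nat -> (i < j)%nat -> (i + 1 <= s)%nat -> Kirr de t t' -> Gall de s i t t'.

(** Apart from the i = 0 term, the reciprocity law contains only rational functions of [t] over the
    rationals and lattice sums of smaller [j], and it holds with the same coefficients at the
    conjugate. *)
Lemma InK_reciprocity (de : R) (j s : nat) (al be : Z) (t t' : R) :
  Kgen de -> Lower de j -> (0 <= al <= 3)%Z -> (0 <= be <= 3)%Z -> (1 <= j)%nat -> (j + 1 <= s)%nat ->
  Kirr de t t' ->
  InK de (nv t s j al be - kap t s j * nv (/ t) s j be al) (nv t' s j al be - kap t' s j * nv (/ t') s j be al).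
Proof.
  intros Hd Low Ha Hb Hj Hs Ht.
  destruct (nv_reciprocity j s al be Ha Hb Hj Hs) as (cx & d & e1 & e2 & Qc & C0 & Qd & Q1 & Q2 & R).
  assert (Ht' := Kirr_sym _ _ _ Ht). assert (Hti := Kirr_inv _ _ _ Hd Ht).
  assert (Ki := proj1 Ht). assert (Kn := InK_opp _ _ _ Ki).
  set (rest := fun t => (- t) ^ s * (ns (j - 1) (fun i => cx (S i) * (/ t ^ (j - S i) * nv (/ t) (s + S i) (j - S i) be al)) +
        (ns s (fun k => d k * / (- t) ^ (s - k)) + e1 + e2 * / (- t) ^ (j + s)))).
  assert (E : forall t, Bad t -> Bad (/ t) -> nv t s j al be - kap t s j * nv (/ t) s j be al = rest t).
  { intros x Hx Hx'. rewrite (R x Hx Hx'). unfold rest, kap. destruct j as [|j']; [lia|].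
    rewrite ns_shift, C0, Nat.sub_0_r, Nat.add_0_r. rewrite !Nat.sub_succ, Nat.sub_0_r. ring. }
  rewrite !E.
  - unfold rest. apply InK_mult; [exact Hd|apply InK_pow; auto|]. apply InK_plus.
    + apply InK_ns. intros i Hi. apply InK_mult; [exact Hd|apply InK_Q, Qc|].
      apply InK_mult; [exact Hd|apply InK_inv, InK_pow; auto|]. apply Low; auto; lia.
    + apply InK_plus; [apply InK_plus|].
      * apply InK_ns. intros k Hk. apply InK_mult; [exact Hd|apply InK_Q; auto|apply InK_inv, InK_pow; auto].
      * apply InK_Q, Q1.
      * apply InK_mult; [exact Hd|apply InK_Q; auto|apply InK_inv, InK_pow; auto].
  - apply (Kirr_Bad de t' t); auto.
  - apply (Kirr_Bad de (/ t') (/ t)); auto. apply Kirr_sym; auto.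
  - apply (Kirr_Bad de t t'); auto.
  - apply (Kirr_Bad de (/ t) (/ t')); auto.
Qed.

(** * The continued fraction cycle *)

Definition state : Type := (Z * Z * Z * Z * Z)%type.

Definition rt (sD : R) (st : state) : R := let '(A, B, _, _, _) := st in (- IZR B + sD) / (2 * IZR A).

(* A state is a form [A x^2 + B x + C] of discriminant [sD^2] whose roots [rt (- sD) < 0 < rt sD] have opposite signs,
   together with a residue vector mod 4. *)
Definition Inv (D : Z) (st : state) : Prop :=
  let '(A, B, C, al, be) := st in
  (0 < A)%Z /\ (C < 0)%Z /\ (B * B - 4 * A * C = D)%Z /\ (0 <= al <= 3)%Z /\ (0 <= be <= 3)%Z.

(* The continued fraction step: the root [t] becomes [1 / (t - floor t)]. *)
Definition next (sD : R) (st : state) : state :=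
  let '(A, B, C, al, be) := st in
  let k := Int_part (rt sD st) in
  ((- (A * k * k + B * k + C))%Z, (- (B + 2 * k * A))%Z, (- A)%Z, be, ((al + k * be) mod 4)%Z).

(** Conjugation maps this square root of the discriminant to its negative, so [rt (- sD)] is the
    conjugate of [rt sD]. *)
Definition SD (de sD : R) (D : Z) : Prop := 0 < sD /\ sD ^ 2 = IZR D /\ InK de sD (- sD).

Lemma rt_facts (de sD : R) (D A B C al be : Z) : Kgen de -> SD de sD D -> Inv D (A, B, C, al, be) ->
  let t := rt sD (A, B, C, al, be) in let t' := rt (- sD) (A, B, C, al, be) in
  Kirr de t t' /\ t' < 0 < t /\ IZR A * (t + t') = - IZR B /\ IZR A * (t * t') = IZR C.
Proof.
  intros Hd (S0 & S2 & SK) (HA & HC & HD & Ha & Hb) t t'.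
  assert (A0 : 0 < IZR A) by (apply IZR_lt; exact HA).
  assert (C0 : IZR C < 0) by (apply IZR_lt; exact HC).
  assert (E1 : IZR A * (t + t') = - IZR B) by (unfold t, t', rt; field; lra).
  assert (E2 : IZR A * (t * t') = IZR C).
  { unfold t, t', rt. apply (f_equal IZR) in HD. rewrite minus_IZR, !mult_IZR in HD. rewrite <- S2 in HD.
    apply Rmult_eq_reg_r with (4 * IZR A); [|lra].
    transitivity ((- IZR B + sD) * (- IZR B + - sD)); [field; lra|]. lra. }
  assert (E3 : t - t' = sD / IZR A) by (unfold t, t', rt; field; lra).
  assert (D0 : 0 < t - t') by (rewrite E3; apply Rdiv_lt_0_compat; lra).
  assert (P : t * t' < 0) by nra.
  split; [|split; [split; nra|auto]].
  split; [|lra].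
  unfold t, t', rt, Rdiv. apply InK_mult; [exact Hd| |apply InK_Q; auto with isq].
  apply InK_plus; [apply InK_Q; auto with isq|exact SK].
Qed.

Lemma Int_part_bounds (de t t' : R) : Kgen de -> Kirr de t t' -> 0 < t - IZR (Int_part t) < 1.
Proof.
  intros Hd H. destruct (base_fp t) as [H1 H2]. unfold frac_part in *.
  split; [|exact H2]. destruct (Rge_le _ _ H1) as [l|l]; [exact l|].
  exfalso. apply (Kirr_not_Q de t t' Hd H). replace t with (IZR (Int_part t)) by lra. apply isQ_IZR.
Qed.

Lemma kap_bound (u : R) (s j : nat) : 0 < u < 1 -> (j + 1 <= s)%nat -> Rabs (kap u s j) < 1.
Proof.
  intros Hu Hs. unfold kap. rewrite Rabs_mult, <- RPow_abs, Rabs_Ropp, Rabs_inv, <- RPow_abs, (Rabs_pos_eq u) by lra.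
  replace s with ((s - j) + j)%nat by lia. rewrite pow_add, Rmult_assoc, Rinv_r, Rmult_1_r by (apply pow_nonzero; lra).
  apply pow_lt_1_compat; [lra|lia].
Qed.

Definition stv (sD : R) (s j : nat) (st : state) : R :=
  let '(_, _, _, al, be) := st in nv (rt sD st) s j al be.

(** The form for t - k has coefficients A, B2, C2, and inversion reverses their order; the overall
    sign change restores a positive leading coefficient, because C2 = A (t - k) (t' - k) is
    negative. *)
Lemma next_spec (de sD : R) (D : Z) (s j : nat) (st : state) :
  Kgen de -> SD de sD D -> Lower de j -> (1 <= j)%nat -> (j + 1 <= s)%nat -> Inv D st ->
  Inv D (next sD st) /\
  exists ka ka', InK de ka ka' /\ Rabs ka < 1 /\
    InK de (stv sD s j st - ka * stv sD s j (next sD st))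
           (stv (- sD) s j st - ka' * stv (- sD) s j (next sD st)).
Proof.
  intros Hd HS Low Hj Hs HI. destruct st as [[[[A B] C] al] be].
  destruct (rt_facts de sD D A B C al be Hd HS HI) as (K & [T1 T2] & E1 & E2).
  set (t := rt sD (A, B, C, al, be)) in *. set (t' := rt (- sD) (A, B, C, al, be)) in *.
  assert (FP := Int_part_bounds de t t' Hd K).
  destruct HS as (S0 & S2 & SK). destruct HI as (HA & HC & HD & Ha & Hb).
  assert (Enext : next sD (A, B, C, al, be) =
    ((- (A * Int_part t * Int_part t + B * Int_part t + C))%Z, (- (B + 2 * Int_part t * A))%Z, (- A)%Z, be,
      ((al + Int_part t * be) mod 4)%Z)) by reflexivity.
  set (k := Int_part t) in *.
  set (C2 := (A * k * k + B * k + C)%Z) in *. set (B2 := (B + 2 * k * A)%Z) in *.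
  assert (A0 : 0 < IZR A) by (apply IZR_lt; exact HA).
  assert (k0 : (0 <= k)%Z).
  { assert (-1 < k)%Z by (apply lt_IZR; lra). lia. }
  assert (k1 : 0 <= IZR k) by (apply IZR_le; exact k0).
  assert (EC2 : IZR C2 = IZR A * ((t - IZR k) * (t' - IZR k))).
  { unfold C2. rewrite !plus_IZR, !mult_IZR, <- E2. replace (IZR B) with (- (IZR A * (t + t'))) by lra. ring. }
  assert (C20 : IZR C2 < 0).
  { rewrite EC2. assert (0 < IZR A * ((t - IZR k) * (IZR k - t'))) by (repeat apply Rmult_lt_0_compat; lra). lra. }
  assert (D2 : (B2 * B2 - 4 * A * C2 = D)%Z) by (rewrite <- HD; unfold B2, C2; ring).
  assert (D2R : IZR B2 * IZR B2 - 4 * IZR A * IZR C2 = sD ^ 2).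
  { apply (f_equal IZR) in D2. rewrite minus_IZR, !mult_IZR in D2. rewrite S2. exact D2. }
  assert (Hm := Z.mod_pos_bound (al + k * be) 4 ltac:(lia)).
  assert (Ek : forall sg, sg ^ 2 = sD ^ 2 -> (- IZR B + sg) / (2 * IZR A) - IZR k <> 0 ->
     (- IZR (- B2) + sg) / (2 * IZR (- C2)) = / ((- IZR B + sg) / (2 * IZR A) - IZR k)).
  { intros sg Hsg Hne. rewrite <- Hsg in D2R.
    assert (Eq : (- IZR B + sg) / (2 * IZR A) - IZR k = (- IZR B2 + sg) / (2 * IZR A)).
    { unfold B2. rewrite plus_IZR, !mult_IZR. field. lra. }
    rewrite Eq in *. assert (N2 : - IZR B2 + sg <> 0).
    { intros e. apply Hne. rewrite e. unfold Rdiv; ring. }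
    rewrite !opp_IZR. field_simplify_eq; [|repeat split; lra]. lra. }
  assert (Ek1 : rt sD (next sD (A, B, C, al, be)) = / (t - IZR k)).
  { rewrite Enext. apply (Ek sD); [reflexivity|]. change (t - IZR k <> 0). lra. }
  assert (Ek2 : rt (- sD) (next sD (A, B, C, al, be)) = / (t' - IZR k)).
  { rewrite Enext. apply (Ek (- sD)); [ring|]. change (t' - IZR k <> 0). lra. }
  split.
  - rewrite Enext. assert (C2 < 0)%Z by (apply lt_IZR; exact C20).
    split; [lia|]. split; [lia|]. split; [|lia]. rewrite <- D2. ring.
  - assert (Ku : Kirr de (t - IZR k) (t' - IZR k)) by (apply Kirr_unshift, K).
    (* Translation by k has multiplier 1, and inversion contributes [kap] at t - k, which lies in
       (0, 1). On the conjugate side no bound is claimed. *)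
    exists (kap (t - IZR k) s j), (kap (t' - IZR k) s j).
    split. { unfold kap. apply InK_mult; [exact Hd| |apply InK_inv; [exact Hd|]]; apply InK_pow; auto; [apply InK_opp|]; apply Ku. }
    split; [apply kap_bound; auto|].
    assert (W : forall sg, stv sg s j (next sD (A, B, C, al, be)) = nv (rt sg (next sD (A, B, C, al, be))) s j be ((al + k * be) mod 4)).
    { intros sg. rewrite Enext. reflexivity. }
    rewrite !W, Ek1, Ek2. unfold stv. fold t t'.
    rewrite (nv_unshift de t t' k), (nv_unshift de t' t k) by (auto using Kirr_sym; lia).
    apply InK_reciprocity; auto. lia.
Qed.

Lemma pigeonhole_seq (X : Type) (f : nat -> X) (l : list X) : (forall i, In (f i) l) ->
  exists i d, (1 <= d)%nat /\ f i = f (i + d)%nat.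
Proof.
  intros H. apply NNPP. intros N.
  assert (Inj : forall i k, f i = f k -> i = k).
  { intros i k E. destruct (Nat.lt_total i k) as [L|[L|L]]; [|exact L|]; exfalso; apply N.
    - exists i, (k - i)%nat. split; [lia|]. rewrite E. f_equal; lia.
    - exists k, (i - k)%nat. split; [lia|]. rewrite <- E. f_equal; lia. }
  assert (ND : NoDup (map f (seq 0 (S (length l))))).
  { apply Injective_map_NoDup; [exact Inj|apply seq_NoDup]. }
  apply NoDup_incl_length with (l' := l) in ND.
  - rewrite length_map, length_seq in ND. lia.
  - intros x Hx. apply in_map_iff in Hx. destruct Hx as (i & <- & _). apply H.
Qed.

Definition zrange (n : Z) : list Z := map (fun k => (Z.of_nat k - n)%Z) (seq 0 (Z.to_nat (2 * n + 1))).

Lemma in_zrange (n z : Z) : (- n <= z <= n)%Z -> In z (zrange n).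
Proof.
  intros H. apply in_map_iff. exists (Z.to_nat (z + n)). split; [lia|]. apply in_seq. lia.
Qed.

Definition all_states (n : Z) : list state :=
  list_prod (list_prod (list_prod (list_prod (zrange n) (zrange n)) (zrange n)) (zrange n)) (zrange n).

(** With A > 0 > C the discriminant is B^2 + 4 A |C|, a sum of nonnegative terms that bounds all
    three coefficients; the added 3 accommodates the residues. *)
Lemma Inv_finite (D : Z) (st : state) : Inv D st -> In st (all_states (D + 3)).
Proof.
  destruct st as [[[[A B] C] al] be]. intros (HA & HC & HD & Ha & Hb).
  assert (B2 : (0 <= B * B)%Z) by nia.
  assert (P : (1 <= A * - C)%Z) by nia.
  repeat apply in_prod; apply in_zrange; nia.
Qed.

Lemma stv_InK (de sD : R) (D : Z) (s j : nat) (st : state) :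
  Kgen de -> SD de sD D -> Lower de j -> (1 <= j)%nat -> (j + 1 <= s)%nat -> Inv D st ->
  InK de (stv sD s j st) (stv (- sD) s j st).
Proof.
  intros Hd HS Low Hj Hs HI.
  set (f := fun i => Nat.iter i (next sD) st).
  assert (If : forall i, Inv D (f i)).
  { induction i; [exact HI|]. apply (next_spec de sD D s j); auto. }
  destruct (pigeonhole_seq _ f _ (fun i => Inv_finite D (f i) (If i))) as (i & d & Hd1 & E).
  (* The multipliers multiply along the orbit; for n = 0 the multiplier is 1, hence the strict bound
     only from one step on. *)
  assert (Rel : forall n i, exists ka ka', InK de ka ka' /\ ((1 <= n)%nat -> Rabs ka < 1) /\ Rabs ka <= 1 /\
     InK de (stv sD s j (f i) - ka * stv sD s j (f (i + n)%nat))
            (stv (- sD) s j (f i) - ka' * stv (- sD) s j (f (i + n)%nat))).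
  { induction n; intros i0.
    - exists 1, 1. repeat split; [apply InK_Q, isQ_IZR|lia|rewrite Rabs_R1; lra|].
      rewrite Nat.add_0_r. replace (stv sD s j (f i0) - 1 * stv sD s j (f i0)) with 0 by ring.
      replace (stv (- sD) s j (f i0) - 1 * stv (- sD) s j (f i0)) with 0 by ring. apply InK_Q, isQ_IZR.
    - destruct (IHn i0) as (k1 & k1' & K1 & _ & B1 & R1).
      destruct (next_spec de sD D s j (f (i0 + n)%nat) Hd HS Low Hj Hs (If _)) as (_ & k2 & k2' & K2 & B2 & R2).
      assert (Bk : Rabs (k1 * k2) < 1).
      { rewrite Rabs_mult. assert (0 <= Rabs k1) by apply Rabs_pos. assert (0 <= Rabs k2) by apply Rabs_pos. nra. }
      exists (k1 * k2), (k1' * k2'). split; [apply InK_mult; auto|]. split; [auto|]. split; [lra|].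
      rewrite Nat.add_succ_r. change (f (S (i0 + n))) with (next sD (f (i0 + n)%nat)).
      assert (R3 := InK_plus _ _ _ _ _ R1 (InK_mult _ _ _ _ _ Hd K1 R2)).
      replace (stv sD s j (f i0) - k1 * k2 * stv sD s j (next sD (f (i0 + n)%nat))) with
        (stv sD s j (f i0) - k1 * stv sD s j (f (i0 + n)%nat) +
         k1 * (stv sD s j (f (i0 + n)%nat) - k2 * stv sD s j (next sD (f (i0 + n)%nat)))) by ring.
      replace (stv (- sD) s j (f i0) - k1' * k2' * stv (- sD) s j (next sD (f (i0 + n)%nat))) with
        (stv (- sD) s j (f i0) - k1' * stv (- sD) s j (f (i0 + n)%nat) +
         k1' * (stv (- sD) s j (f (i0 + n)%nat) - k2' * stv (- sD) s j (next sD (f (i0 + n)%nat)))) by ring.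
      exact R3. }
  assert (Gi : InK de (stv sD s j (f i)) (stv (- sD) s j (f i))).
  (* On the cycle (1 - ka) v lies in the field; 1 - ka is nonzero as |ka| < 1, and 1 - ka' is its
     conjugate. *)
  { destruct (Rel d i) as (ka & ka' & K1 & B1 & _ & R1). specialize (B1 Hd1). rewrite <- E in R1.
    assert (K2 : InK de (1 - ka) (1 - ka')) by (apply InK_minus; [apply InK_Q, isQ_IZR|exact K1]).
    assert (N1 : 1 - ka <> 0) by (apply Rabs_def2 in B1; lra).
    assert (N2 : 1 - ka' <> 0) by (intros e; apply N1; apply (InK_zero_iff de _ _ (proj2 Hd) K2); exact e).
    assert (R2 := InK_mult _ _ _ _ _ Hd (InK_inv _ _ _ Hd K2) R1).
    replace (stv sD s j (f i)) with (/ (1 - ka) * (stv sD s j (f i) - ka * stv sD s j (f i))) by (field; exact N1).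
    replace (stv (- sD) s j (f i)) with (/ (1 - ka') * (stv (- sD) s j (f i) - ka' * stv (- sD) s j (f i))) by (field; exact N2).
    exact R2. }
  (* The recurrent state may come after a preperiod; the relation over the first i steps carries the
     result back to [st]. *)
  destruct (Rel i O) as (ka & ka' & K1 & _ & _ & R1). simpl Nat.add in R1.
  change (f O) with st in R1.
  apply (InK_solve de _ _ _ _ _ _ Hd R1 K1 Gi).
Qed.

(** Clearing denominators and choosing A > 0 turns the pair into a state, with A (t - t') as the
    square root of the discriminant. *)
Lemma Gall_opposite (de t t' : R) (s j : nat) :
  Kgen de -> Lower de j -> (1 <= j)%nat -> (j + 1 <= s)%nat -> Kirr de t t' -> t' < 0 < t -> Gall de s j t t'.
Proof.
  intros Hd Low Hj Hs K [T1 T2].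
  assert (QFpos : exists A B C, (0 < A)%Z /\ QF A B C t t').
  { destruct (Kirr_QF de t t' Hd K) as (A & B & C & HA & E1 & E2).
    destruct (Z_lt_le_dec 0 A) as [p|p].
    - exists A, B, C. split; [exact p|]. repeat split; auto.
    - exists (- A)%Z, (- B)%Z, (- C)%Z. split; [lia|]. split; [lia|]. rewrite !opp_IZR. lra. }
  destruct QFpos as (A & B & C & HA & _ & E1 & E2).
  assert (A0 : 0 < IZR A) by (apply IZR_lt; exact HA).
  set (sD := IZR A * (t - t')). set (D := (B * B - 4 * A * C)%Z).
  assert (HS : SD de sD D).
  { split; [apply Rmult_lt_0_compat; lra|]. split.
    - unfold sD, D. rewrite minus_IZR, !mult_IZR, <- E2. replace (IZR B) with (- (IZR A * (t + t'))) by lra. ring.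
    - unfold sD. replace (- (IZR A * (t - t'))) with (IZR A * (t' - t)) by ring.
      apply InK_mult; [exact Hd|apply InK_Q, isQ_IZR|]. apply InK_minus; [apply K|apply InK_sym, K]. }
  intros al be Ha Hb.
  assert (HI : Inv D (A, B, C, al, be)).
  { split; [exact HA|]. split; [|repeat split; lia]. apply lt_IZR. rewrite <- E2.
    assert (0 < IZR A * (t * - t')) by (repeat apply Rmult_lt_0_compat; lra). lra. }
  assert (G := stv_InK de sD D s j _ Hd HS Low Hj Hs HI). unfold stv, rt in G.
  replace ((- IZR B + sD) / (2 * IZR A)) with t in G by (rewrite <- E1; unfold sD; field; lra).
  replace ((- IZR B + - sD) / (2 * IZR A)) with t' in G by (rewrite <- E1; unfold sD; field; lra).
  exact G.
Qed.

Lemma Gall_sym (de t t' : R) (s j : nat) : Gall de s j t t' -> Gall de s j t' t.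
Proof. intros G al be Ha Hb. apply InK_sym, G; auto. Qed.

Lemma Gall_unshift (de t t' : R) (k : Z) (s j : nat) : Kgen de -> Kirr de t t' -> (1 <= j)%nat -> (1 <= s)%nat ->
  Gall de s j (t - IZR k) (t' - IZR k) -> Gall de s j t t'.
Proof.
  intros Hd K Hj Hs G al be Ha Hb.
  assert (Hm := Z.mod_pos_bound (al + k * be) 4 ltac:(lia)).
  rewrite (nv_unshift de t t' k), (nv_unshift de t' t k) by (auto using Kirr_sym; lia). apply G; lia.
Qed.

Lemma Gall_of_inv (de t t' : R) (s j : nat) :
  Kgen de -> Lower de j -> (1 <= j)%nat -> (j + 1 <= s)%nat -> Kirr de t t' ->
  Gall de s j (/ t) (/ t') -> Gall de s j t t'.
Proof.
  intros Hd Low Hj Hs K G al be Ha Hb.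
  assert (R1 := InK_reciprocity de j s al be t t' Hd Low Ha Hb Hj Hs K).
  assert (Kk : InK de (kap t s j) (kap t' s j)).
  { unfold kap. apply InK_mult; [exact Hd| |apply InK_inv; [exact Hd|]]; apply InK_pow; auto; [apply InK_opp|]; apply K. }
  apply (InK_solve de _ _ _ _ _ _ Hd R1 Kk (G be al Hb Ha)).
Qed.

(** Descent on |A|. Once the first root lies in (0, 1), a conjugate outside [0, 1] gives opposite
    signs, possibly after a translation by 1 and an exchange of the roots. Otherwise both roots lie
    in (0, 1), and inversion replaces A by C2 = A u u', which is smaller in absolute value. *)
Lemma Gall_all (de : R) (s j : nat) : Kgen de -> Lower de j -> (1 <= j)%nat -> (j + 1 <= s)%nat ->
  forall n A B C t t', (Z.abs_nat A <= n)%nat -> QF A B C t t' -> Kirr de t t' -> Gall de s j t t'.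
Proof.
  intros Hd Low Hj Hs. induction n as [|n IH]; intros A B C t t' Hn (HA & E1 & E2) K; [lia|].
  assert (FP := Int_part_bounds de t t' Hd K). set (k := Int_part t) in *.
  apply (Gall_unshift de t t' k s j Hd K Hj ltac:(lia)).
  assert (Ku : Kirr de (t - IZR k) (t' - IZR k)) by (apply Kirr_unshift, K).
  assert (U : QF A (B + 2 * k * A) (A * k * k + B * k + C) (t - IZR k) (t' - IZR k)).
  { split; [exact HA|]. rewrite !plus_IZR, !mult_IZR, <- E2.
    replace (IZR B) with (- (IZR A * (t + t'))) by lra. split; ring. }
  set (u := t - IZR k) in *. set (u' := t' - IZR k) in *. clearbody u u' k. clear E1 E2 K t t'.
  assert (Ku' := Kirr_sym _ _ _ Ku).
  destruct (Rlt_le_dec u' 0) as [L|L].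
  { apply Gall_opposite; auto. lra. }
  destruct (Rlt_le_dec 1 u') as [L1|L1].
  { apply Gall_sym. apply (Gall_unshift de u' u 1 s j Hd Ku' Hj ltac:(lia)).
    apply Gall_opposite; auto; [|lra].
    apply Kirr_unshift, Ku'. }
  assert (N0 := Kirr_ne _ _ _ Hd Ku'). assert (N1 : u' <> 1).
  { intros e. apply (Kirr_not_Q _ _ _ Hd Ku'). rewrite e. apply isQ_IZR. }
  destruct U as (_ & E1 & E2).
  set (B2 := (B + 2 * k * A)%Z) in *. set (C2 := (A * k * k + B * k + C)%Z) in *.
  assert (A0 : IZR A <> 0) by (apply IZR_neq; exact HA).
  apply Gall_of_inv; auto. apply (IH C2 B2 A); [| |apply Kirr_inv; auto].
  - assert (Rabs (IZR C2) < Rabs (IZR A)).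
    { rewrite <- E2, Rabs_mult. rewrite (Rabs_pos_eq (u * u')) by nra.
      assert (0 < Rabs (IZR A)) by (apply Rabs_pos_lt; exact A0). assert (u * u' < 1) by nra. nra. }
    rewrite <- !abs_IZR in H. apply lt_IZR in H. lia.
  - split.
    + intros Z0. rewrite Z0 in E2. apply Rmult_integral in E2. destruct E2 as [e|e]; [tauto|].
      apply Rmult_integral in e. lra.
    + rewrite <- E2. split; [|field; lra]. 
      transitivity (IZR A * (u + u')); [field; lra|exact E1].
Qed.

Lemma nv_InK (de : R) : Kgen de -> forall j s t t', (1 <= j)%nat -> (j + 1 <= s)%nat -> Kirr de t t' -> Gall de s j t t'.
Proof.
  intros Hd j. induction j as [j IH] using (well_founded_induction lt_wf). intros s t t' Hj Hs K.
  destruct (Kirr_QF de t t' Hd K) as (A & B & C & H).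
  apply (Gall_all de s j Hd) with (Z.abs_nat A) A B C; auto.
  intros i s' x x' Hi Hij Hs' Kx. apply IH; auto.
Qed.

Lemma quarter_sin_ne (t : R) (al n : Z) : Bad t -> n <> 0%Z -> sin (PI * (IZR al / 4 + IZR n * t)) <> 0.
Proof.
  intros H Hn. assert (N := lattice_sin_ne t al 0 n H ltac:(lia)).
  replace (0 / 4 + IZR n) with (IZR n) in N by field. exact N.
Qed.

(** * From lattice sums to trigonometric series *)

(** Meant for two sequences at conjugate arguments, whose sums must be conjugate as well. For s >= 1
    the inverse of 0 removes the term n = 0. *)
Definition Wp (de : R) (s : nat) (f f' : Z -> R) : Prop :=
  exists v v', InK de v v' /\
    zlim (fun n => / IZR n ^ s * f n) (PI ^ s * v) /\
    zlim (fun n => / IZR n ^ s * f' n) (PI ^ s * v').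

Lemma Wp_ext (de : R) (s : nat) (f f' g g' : Z -> R) : (1 <= s)%nat ->
  (forall n, n <> 0%Z -> f n = g n) -> (forall n, n <> 0%Z -> f' n = g' n) ->
  Wp de s f f' -> Wp de s g g'.
Proof.
  intros Hs E E' (v & v' & K & L & L'). exists v, v'. split; [exact K|].
  assert (X : forall h h' : Z -> R, (forall n, n <> 0%Z -> h n = h' n) -> forall n, / IZR n ^ s * h n = / IZR n ^ s * h' n).
  { intros h h' Eh n. destruct (Z.eq_dec n 0) as [->|Hn]; [|now rewrite Eh].
    rewrite Rinv_pow_0 by exact Hs. ring. }
  split; [revert L|revert L']; apply is_lim_seq_zs_subst; apply X; auto.
Qed.

Lemma Wp_plus (de : R) (s : nat) (f f' g g' : Z -> R) :
  Wp de s f f' -> Wp de s g g' -> Wp de s (fun n => f n + g n) (fun n => f' n + g' n).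
Proof.
  intros (v & v' & K & L & L') (w & w' & K2 & M & M'). exists (v + w), (v' + w').
  split; [apply InK_plus; auto|]. rewrite !Rmult_plus_distr_l. split.
  - apply is_lim_seq_ext with (fun N => zs N (fun n => / IZR n ^ s * f n) + zs N (fun n => / IZR n ^ s * g n)).
    + intros N. rewrite <- zs_plus. apply zs_ext; intros; ring.
    + apply is_lim_seq_plus'; auto.
  - apply is_lim_seq_ext with (fun N => zs N (fun n => / IZR n ^ s * f' n) + zs N (fun n => / IZR n ^ s * g' n)).
    + intros N. rewrite <- zs_plus. apply zs_ext; intros; ring.
    + apply is_lim_seq_plus'; auto.
Qed.

Lemma Wp_scal (de q : R) (s : nat) (f f' : Z -> R) : Kgen de -> isQ q ->
  Wp de s f f' -> Wp de s (fun n => q * f n) (fun n => q * f' n).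
Proof.
  intros Hd Hq (v & v' & K & L & L'). exists (q * v), (q * v').
  split; [apply InK_mult; auto; apply InK_Q, Hq|].
  replace (PI ^ s * (q * v)) with (q * (PI ^ s * v)) by ring.
  replace (PI ^ s * (q * v')) with (q * (PI ^ s * v')) by ring. split.
  - apply is_lim_seq_ext with (fun N => q * zs N (fun n => / IZR n ^ s * f n)).
    + intros N. rewrite <- zs_scal. apply zs_ext; intros; ring.
    + apply lim_scal; auto.
  - apply is_lim_seq_ext with (fun N => q * zs N (fun n => / IZR n ^ s * f' n)).
    + intros N. rewrite <- zs_scal. apply zs_ext; intros; ring.
    + apply lim_scal; auto.
Qed.

Lemma Wp_1 (de : R) (s : nat) : (1 <= s)%nat -> Wp de s (fun _ => 1) (fun _ => 1).
Proof.
  intros Hs. destruct (quarter_sum_rational 0 s ltac:(lia) Hs) as (q & Hq & L).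
  assert (L2 : zlim (fun n => / IZR n ^ s * 1) (PI ^ s * q)).
  { revert L. apply is_lim_seq_zs_subst. intros n. rewrite Rmult_1_r. do 2 f_equal. field. }
  exists q, q. split; [apply InK_Q, Hq|]. auto.
Qed.

(** As the Eisenstein series of weight d is pi^d times a monic polynomial in the cotangent, the top
    power is exchanged for a lattice sum plus lower powers. A degree below [s] is the condition
    [j + 1 <= s] on these lattice sums. *)
Lemma Wp_QP (de t t' : R) (s : nat) (al : Z) : Kgen de -> Kirr de t t' -> (0 <= al <= 3)%Z -> (1 <= s)%nat ->
  forall d f, (d <= s)%nat -> QP d f ->
    Wp de s (fun n => f (cotp (IZR al / 4 + IZR n * t))) (fun n => f (cotp (IZR al / 4 + IZR n * t'))).
Proof.
  intros Hd K Ha Hs. induction d as [|d IH]; intros f Hds Hf.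
  - apply Wp_ext with (fun _ => 0 * 1) (fun _ => 0 * 1); [exact Hs| | |].
    + intros; rewrite Hf; ring.
    + intros; rewrite Hf; ring.
    + apply Wp_scal; [exact Hd|apply isQ_IZR|]. apply Wp_1, Hs.
  - destruct Hf as (q & g & Hq & Hg & Ef). destruct d as [|d].
    + apply Wp_ext with (fun _ => q * 1) (fun _ => q * 1); [exact Hs| | |].
      * intros; rewrite Ef, Hg; simpl; ring.
      * intros; rewrite Ef, Hg; simpl; ring.
      * apply Wp_scal; [exact Hd|exact Hq|]. apply Wp_1, Hs.
    + destruct (EL_cotp (S d) ltac:(lia)) as (h & Hh & HEL).
      assert (Bt : Bad t) by (apply (Kirr_Bad de t t'); auto).
      assert (Bt' : Bad t') by (apply (Kirr_Bad de t' t); auto; apply Kirr_sym; auto).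
      assert (P : PI ^ S d <> 0) by (apply pow_nonzero, PI_neq0).
      assert (main : Wp de s (fun n => / PI ^ S d * EL (S d) (IZR al / 4 + IZR n * t)) (fun n => / PI ^ S d * EL (S d) (IZR al / 4 + IZR n * t'))).
      { exists (nv t s (S d) al 0), (nv t' s (S d) al 0).
        split; [apply (nv_InK de Hd (S d) s t t'); auto; lia|].
        assert (X : forall u, Bad u -> zlim (fun n => / IZR n ^ s * (/ PI ^ S d * EL (S d) (IZR al / 4 + IZR n * u))) (PI ^ s * nv u s (S d) al 0)).
        { intros u Hu. assert (L := nv_spec u s (S d) al 0 Hu Ha ltac:(lia) ltac:(lia) ltac:(lia)).
          unfold LS in L.
          replace (PI ^ s * nv u s (S d) al 0) with (/ PI ^ S d * (PI ^ (S d + s) * nv u s (S d) al 0)).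
          2:{ rewrite pow_add. revert P. generalize (PI ^ S d). intros; field; auto. }
          apply is_lim_seq_ext with (2 := is_lim_seq_mult' _ _ _ _ (is_lim_seq_const (/ PI ^ S d)) L).
          intros N. rewrite <- zs_scal. apply zs_ext; intros n.
          replace (0 / 4 + IZR n) with (IZR n) by field. ring. }
        split; apply X; auto. }
      assert (gh : Wp de s (fun n => g (cotp (IZR al / 4 + IZR n * t)) + (- q) * h (cotp (IZR al / 4 + IZR n * t)))
                           (fun n => g (cotp (IZR al / 4 + IZR n * t')) + (- q) * h (cotp (IZR al / 4 + IZR n * t')))).
      { apply (IH (fun c => g c + - q * h c)); [lia|]. apply QP_plus; [exact Hg|]. apply QP_scal; [auto with isq|exact Hh]. }
      assert (R := Wp_plus _ _ _ _ _ _ (Wp_scal de q s _ _ Hd Hq main) gh).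
      revert R. apply Wp_ext; [exact Hs| |].
      * intros n Hn. rewrite Ef, HEL by (apply quarter_sin_ne; auto). revert P. generalize (PI ^ S d). intros; field; auto.
      * intros n Hn. rewrite Ef, HEL by (apply quarter_sin_ne; auto). revert P. generalize (PI ^ S d). intros; field; auto.
Qed.

Lemma QP_low_split (d : nat) : forall f, QP (S d) f -> exists q g, isQ q /\ QP d g /\ forall c, f c = q + c * g c.
Proof.
  induction d; intros f (q & h & Hq & Hh & E).
  - exists q, (fun _ => 0). repeat split; [exact Hq|]. intros c. rewrite E, Hh. simpl; ring.
  - destruct (IHd h Hh) as (r & g & Hr & Hg & Eh). exists r, (fun c => q * c ^ d + g c). repeat split; [exact Hr| |].
    + exists q, g. auto.
    + intros c. rewrite E, Eh. simpl; ring.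
Qed.

(* Laurent polynomials in [c], written as a polynomial in [c] plus one in [c' = - 1 / c]. *)
Definition LP (d : nat) (h : R -> R -> R) : Prop :=
  exists F G, QP d F /\ QP d G /\ forall c c', c * c' = -1 -> h c c' = F c + G c'.

Lemma LP_plus (d : nat) (h k : R -> R -> R) : LP d h -> LP d k -> LP d (fun c c' => h c c' + k c c').
Proof.
  intros (F & G & HF & HG & E) (F2 & G2 & HF2 & HG2 & E2).
  exists (fun c => F c + F2 c), (fun c => G c + G2 c). repeat split; [apply QP_plus; auto|apply QP_plus; auto|].
  intros c c' H. rewrite E, E2 by exact H. ring.
Qed.

Lemma LP_scal (d : nat) (q : R) (h : R -> R -> R) : isQ q -> LP d h -> LP d (fun c c' => q * h c c').
Proof.
  intros Hq (F & G & HF & HG & E). exists (fun c => q * F c), (fun c => q * G c).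
  repeat split; [apply QP_scal; auto|apply QP_scal; auto|]. intros c c' H. rewrite E by exact H. ring.
Qed.

Lemma LP_swap (d : nat) (h : R -> R -> R) : LP d h -> LP d (fun c c' => h c' c).
Proof.
  intros (F & G & HF & HG & E). exists G, F. repeat split; auto. intros c c' H. rewrite E by lra. ring.
Qed.

(** The relation c c' = -1 lowers the powers of c' by one, and only the constant term of that part
    crosses over to the polynomial in c. *)
Lemma LP_mul_l (d : nat) (h : R -> R -> R) : LP (S d) h -> LP (S (S d)) (fun c c' => c * h c c').
Proof.
  intros (F & G & HF & HG & E). destruct (QP_low_split d G HG) as (q & g & Hq & Hg & EG).
  exists (fun c => c * F c + q * c ^ 1), (fun c => -1 * g c). repeat split.
  - apply QP_plus; [apply QP_mul_var, HF|]. apply QP_scal; [exact Hq|]. apply QP_le with 2%nat; [lia|apply QP_pow].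
  - apply QP_scal; [apply isQ_IZR|]. apply QP_le with d; [lia|exact Hg].
  - intros c c' H. rewrite E, EG by exact H.
    replace (c * (F c + (q + c' * g c'))) with (c * F c + q * c + c * c' * g c') by ring. rewrite H. ring.
Qed.

Lemma LP_mul_r (d : nat) (h : R -> R -> R) : LP (S d) h -> LP (S (S d)) (fun c c' => c' * h c c').
Proof. intros H. apply (LP_swap _ (fun c c' => c * h c' c)). apply (LP_mul_l d (fun c c' => h c' c)), LP_swap, H. Qed.

Lemma LP_trig (e f : nat) : LP (S (e + f)) (fun c c' => ((c + c') / 2) ^ e * ((c - c') / 2) ^ f).
Proof.
  assert (half : isQ (/ 2)) by (apply isQ_inv, isQ_IZR).
  induction e as [|e IH].
  - induction f as [|f IH].
    + exists (fun c => c ^ 0), (fun _ => 0). repeat split; [apply QP_pow|apply QP_0|]. intros; simpl; ring.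
    + assert (H := LP_plus _ _ _ (LP_scal _ (/ 2) _ half (LP_mul_l _ _ IH)) (LP_scal _ (- / 2) _ (isQ_opp _ half) (LP_mul_r _ _ IH))).
      destruct H as (F & G & HF & HG & E). exists F, G. repeat split; auto.
      intros c c' H. rewrite <- E by exact H. simpl. field.
  - assert (H := LP_plus _ _ _ (LP_scal _ (/ 2) _ half (LP_mul_l _ _ IH)) (LP_scal _ (/ 2) _ half (LP_mul_r _ _ IH))).
    destruct H as (F & G & HF & HG & E). exists F, G. repeat split; auto.
    intros c c' H. rewrite <- E by exact H. simpl. field.
Qed.

(** Here c' = - tan (pi w), so these are the half-angle formulas for cotangent and cosecant; because
    of them [rho / 2] takes the place of [rho] in the lattice sums. *)
Lemma cotp_half_facts (w : R) : sin (PI * w) <> 0 -> sin (PI * (w + / 2)) <> 0 ->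
  let c := cotp w in let c' := cotp (w + / 2) in
  c * c' = -1 /\ (c + c') / 2 = cos (2 * (PI * w)) / sin (2 * (PI * w)) /\ (c - c') / 2 = / sin (2 * (PI * w)).
Proof.
  intros H1 H2 c c'. unfold c, c', cotp. clear c c'.
  assert (Es : sin (PI * (w + / 2)) = cos (PI * w)).
  { rewrite cos_sin. f_equal. field. }
  assert (Ec : cos (PI * (w + / 2)) = - sin (PI * w)).
  { rewrite sin_cos, Ropp_involutive. f_equal. field. }
  rewrite Es in *. rewrite Ec, sin_2a, cos_2a.
  assert (E := sin2_cos2 (PI * w)). unfold Rsqr in E. set (S := sin (PI * w)) in *. set (C := cos (PI * w)) in *.
  split; [field; auto|]. split; [field; auto|]. field_simplify_eq; [nra|auto].
Qed.

(** The shift by 1/2 that produces c' is the residue [al + 2], which stays within 0 to 3 for [al] at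
    most 1. *)
Lemma Wp_LP (de t t' : R) (s : nat) (al : Z) (d : nat) (h : R -> R -> R) : Kgen de -> Kirr de t t' -> (0 <= al <= 1)%Z -> (1 <= s)%nat ->
  (d <= s)%nat -> LP d h ->
  Wp de s (fun n => h (cotp (IZR al / 4 + IZR n * t)) (cotp (IZR al / 4 + IZR n * t + / 2)))
          (fun n => h (cotp (IZR al / 4 + IZR n * t')) (cotp (IZR al / 4 + IZR n * t' + / 2))).
Proof.
  intros Hd K Ha Hs Hds (F & G & HF & HG & E).
  assert (Bt : Bad t) by (apply (Kirr_Bad de t t'); auto).
  assert (Bt' : Bad t') by (apply (Kirr_Bad de t' t); auto; apply Kirr_sym; auto).
  assert (H := Wp_plus _ _ _ _ _ _ (Wp_QP de t t' s al Hd K ltac:(lia) Hs d F Hds HF) (Wp_QP de t t' s (al + 2) Hd K ltac:(lia) Hs d G Hds HG)).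
  assert (X : forall u, Bad u -> forall n, n <> 0%Z -> F (cotp (IZR al / 4 + IZR n * u)) + G (cotp (IZR (al + 2) / 4 + IZR n * u)) =
     h (cotp (IZR al / 4 + IZR n * u)) (cotp (IZR al / 4 + IZR n * u + / 2))).
  { intros u Hu n Hn.
    assert (Eq : IZR al / 4 + IZR n * u + / 2 = IZR (al + 2) / 4 + IZR n * u) by (rewrite plus_IZR; field).
    rewrite E; [now rewrite Eq|].
    apply cotp_half_facts; [|rewrite Eq]; apply quarter_sin_ne; auto. }
  revert H. apply Wp_ext; [exact Hs| |]; intros n Hn; apply X; auto.
Qed.

Lemma powerRZ_inv_opp (x : R) (e : nat) : powerRZ (/ x) (- Z.of_nat e) = x ^ e.
Proof. rewrite powerRZ_neg', <- powerRZ_inv', Rinv_inv, <- pow_powerRZ. reflexivity. Qed.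

Lemma trig_cot_csc (e f : nat) (x : R) : sin x <> 0 ->
  trig (- Z.of_nat e) (Z.of_nat (e + f)) x = (cos x / sin x) ^ e * (/ sin x) ^ f.
Proof.
  intros H. unfold trig. rewrite powerRZ_inv_opp, <- pow_powerRZ, pow_add. unfold Rdiv.
  rewrite Rpow_mult_distr. ring.
Qed.

Lemma trig_tan_sec (e f : nat) (x : R) : cos x <> 0 ->
  trig (Z.of_nat (e + f)) (- Z.of_nat e) x = (sin x / cos x) ^ e * (/ cos x) ^ f.
Proof.
  intros H. unfold trig. rewrite powerRZ_inv_opp, <- pow_powerRZ, pow_add. unfold Rdiv.
  rewrite Rpow_mult_distr. ring.
Qed.

(** The identity sin^2 + cos^2 = 1, divided by sin^2 cos^2. *)
Lemma trig_pythagoras (a b : Z) (x : R) : sin x <> 0 -> cos x <> 0 ->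
  trig (a + 2) (b + 2) x = trig a (b + 2) x + trig (a + 2) b x.
Proof.
  intros Hs Hc. unfold trig.
  rewrite !(powerRZ_add (/ cos x) a 2), !(powerRZ_add (/ sin x) b 2) by (apply Rinv_neq_0_compat; auto).
  simpl (powerRZ _ 2). assert (E := sin2_cos2 x). unfold Rsqr in E.
  set (u := powerRZ (/ cos x) a). set (v := powerRZ (/ sin x) b). 
  assert (E2 : / cos x * / cos x * (/ sin x * / sin x) = / sin x * / sin x + / cos x * / cos x).
  { transitivity ((sin x * sin x + cos x * cos x) * (/ cos x * / cos x * (/ sin x * / sin x))).
    - rewrite E; ring.
    - field; auto. }
  transitivity (u * v * (/ cos x * / cos x * (/ sin x * / sin x))); [ring|]. rewrite E2. ring.
Qed.

Lemma Kirr_half (de t t' : R) : Kgen de -> Kirr de t t' -> Kirr de (t / 2) (t' / 2).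
Proof.
  intros Hd [H1 H2]. split; [|lra]. apply InK_mult; auto. apply InK_Q, isQ_inv, isQ_IZR.
Qed.

Definition Wtrig (de rho rho' : R) (s : nat) (a b : Z) : Prop :=
  Wp de s (fun n => trig a b (PI * IZR n * rho)) (fun n => trig a b (PI * IZR n * rho')).

Lemma Kirr_sincos_ne (de t t' : R) (n : Z) : Kgen de -> Kirr de t t' -> n <> 0%Z ->
  sin (PI * IZR n * t) <> 0 /\ cos (PI * IZR n * t) <> 0.
Proof.
  intros Hd K Hn. assert (Bt : Bad t) by (apply (Kirr_Bad de t t'); auto).
  split.
  - replace (PI * IZR n * t) with (PI * (0 / 4 + IZR n * t)) by field. apply (quarter_sin_ne t 0); auto.
  - rewrite cos_sin. replace (PI / 2 + PI * IZR n * t) with (PI * (2 / 4 + IZR n * t)) by field.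
    apply (quarter_sin_ne t 2); auto.
Qed.

Lemma Wtrig_cot_csc (de rho rho' : R) (s e f : nat) : Kgen de -> Kirr de rho rho' -> (1 <= s)%nat -> (e + f + 1 <= s)%nat ->
  Wtrig de rho rho' s (- Z.of_nat e) (Z.of_nat (e + f)).
Proof.
  intros Hd K Hs Hef. assert (Kh := Kirr_half _ _ _ Hd K).
  assert (H := Wp_LP de _ _ s 0 (S (e + f)) _ Hd Kh ltac:(lia) Hs ltac:(lia) (LP_trig e f)).
  assert (X : forall u u', Kirr de u u' -> forall n, n <> 0%Z ->
    ((cotp (0 / 4 + IZR n * (u / 2)) + cotp (0 / 4 + IZR n * (u / 2) + / 2)) / 2) ^ e *
    ((cotp (0 / 4 + IZR n * (u / 2)) - cotp (0 / 4 + IZR n * (u / 2) + / 2)) / 2) ^ f =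
    trig (- Z.of_nat e) (Z.of_nat (e + f)) (PI * IZR n * u)).
  { intros u u' Ku n Hn.
    destruct (Kirr_sincos_ne de _ _ n Hd (Kirr_half _ _ _ Hd Ku) Hn) as [S1 C1].
    destruct (Kirr_sincos_ne de _ _ n Hd Ku Hn) as [S2 C2].
    set (w := 0 / 4 + IZR n * (u / 2)).
    assert (Ew : PI * w = PI * IZR n * (u / 2)) by (unfold w; field).
    destruct (cotp_half_facts w) as (_ & E1 & E2).
    - rewrite Ew; exact S1.
    - replace (PI * (w + / 2)) with (PI / 2 + PI * w) by field. rewrite <- cos_sin, Ew. exact C1.
    - rewrite E1, E2, trig_cot_csc by exact S2. 
      replace (2 * (PI * w)) with (PI * IZR n * u) by (rewrite Ew; field). reflexivity. }
  revert H. apply Wp_ext; [exact Hs| |]; intros n Hn.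
  - apply (X rho rho' K n Hn).
  - apply (X rho' rho (Kirr_sym _ _ _ K) n Hn).
Qed.

(** The shift 1/4 moves the doubled angle by pi/2, which turns the cotangent into minus the tangent
    and the cosecant into the secant, whence the sign (-1)^e. *)
Lemma Wtrig_tan_sec (de rho rho' : R) (s e f : nat) : Kgen de -> Kirr de rho rho' -> (1 <= s)%nat -> (e + f + 1 <= s)%nat ->
  Wtrig de rho rho' s (Z.of_nat (e + f)) (- Z.of_nat e).
Proof.
  intros Hd K Hs Hef. assert (Kh := Kirr_half _ _ _ Hd K).
  assert (H := Wp_scal de ((-1) ^ e) s _ _ Hd (isQ_pow _ e (isQ_IZR (-1))) (Wp_LP de _ _ s 1 (S (e + f)) _ Hd Kh ltac:(lia) Hs ltac:(lia) (LP_trig e f))).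
  assert (X : forall u u', Kirr de u u' -> forall n, n <> 0%Z ->
    (-1) ^ e * (((cotp (1 / 4 + IZR n * (u / 2)) + cotp (1 / 4 + IZR n * (u / 2) + / 2)) / 2) ^ e *
    ((cotp (1 / 4 + IZR n * (u / 2)) - cotp (1 / 4 + IZR n * (u / 2) + / 2)) / 2) ^ f) =
    trig (Z.of_nat (e + f)) (- Z.of_nat e) (PI * IZR n * u)).
  { intros u u' Ku n Hn.
    destruct (Kirr_sincos_ne de _ _ n Hd Ku Hn) as [S2 C2].
    assert (Bu : Bad (u / 2)) by (apply (Kirr_Bad de _ (u' / 2)); auto; apply Kirr_half; auto).
    set (w := 1 / 4 + IZR n * (u / 2)).
    destruct (cotp_half_facts w) as (_ & E1 & E2).
    - apply (quarter_sin_ne (u / 2) 1); auto.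
    - replace (w + / 2) with (3 / 4 + IZR n * (u / 2)) by (unfold w; field).
      apply (quarter_sin_ne (u / 2) 3); auto.
    - rewrite E1, E2, trig_tan_sec by exact C2.
      replace (2 * (PI * w)) with (PI / 2 + PI * IZR n * u) by (unfold w; field).
      rewrite <- cos_sin. rewrite <- Rmult_assoc, <- Rpow_mult_distr. f_equal. f_equal.
      rewrite sin_cos. field. exact C2. }
  revert H. apply Wp_ext; [exact Hs| |]; intros n Hn.
  - apply (X rho rho' K n Hn).
  - apply (X rho' rho (Kirr_sym _ _ _ K) n Hn).
Qed.

(** While both exponents are positive, the Pythagorean identity lowers their sum by 2 and keeps it
    nonnegative; what remains are products of cotangents and cosecants or of tangents and
    secants. *)
Lemma Wtrig_nonneg (de rho rho' : R) (s : nat) : Kgen de -> Kirr de rho rho' -> (1 <= s)%nat ->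
  forall m a b, (a + b <= Z.of_nat m)%Z -> (0 <= a + b)%Z -> (a + 1 <= Z.of_nat s)%Z -> (b + 1 <= Z.of_nat s)%Z ->
    Wtrig de rho rho' s a b.
Proof.
  intros Hd K Hs. induction m as [m IH] using (well_founded_induction lt_wf). intros a b Hm H0 Ha Hb.
  destruct (Z_le_gt_dec a 0) as [A|A].
  { assert (E := Wtrig_cot_csc de rho rho' s (Z.to_nat (- a)) (Z.to_nat (a + b)) Hd K Hs ltac:(lia)).
    replace (- Z.of_nat (Z.to_nat (- a)))%Z with a in E by lia.
    replace (Z.of_nat (Z.to_nat (- a) + Z.to_nat (a + b))) with b in E by lia. exact E. }
  destruct (Z_le_gt_dec b 0) as [B|B].
  { assert (E := Wtrig_tan_sec de rho rho' s (Z.to_nat (- b)) (Z.to_nat (a + b)) Hd K Hs ltac:(lia)).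
    replace (- Z.of_nat (Z.to_nat (- b)))%Z with b in E by lia.
    replace (Z.of_nat (Z.to_nat (- b) + Z.to_nat (a + b))) with a in E by lia. exact E. }
  assert (W1 := IH (Z.to_nat (a + b - 2)) ltac:(lia) (a - 2)%Z b ltac:(lia) ltac:(lia) ltac:(lia) ltac:(lia)).
  assert (W2 := IH (Z.to_nat (a + b - 2)) ltac:(lia) a (b - 2)%Z ltac:(lia) ltac:(lia) ltac:(lia) ltac:(lia)).
  assert (W := Wp_plus _ _ _ _ _ _ W1 W2). revert W.
  assert (X : forall x, sin x <> 0 -> cos x <> 0 -> trig (a - 2) b x + trig a (b - 2) x = trig a b x).
  { intros x S C. generalize (trig_pythagoras (a - 2) (b - 2) x S C).
    replace (a - 2 + 2)%Z with a by lia. replace (b - 2 + 2)%Z with b by lia. auto. }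
  apply Wp_ext; [exact Hs| |]; intros n Hn; apply X; (apply (Kirr_sincos_ne de rho rho') || apply (Kirr_sincos_ne de rho' rho)); auto; apply Kirr_sym; auto.
Qed.

(** * Bernoulli polynomials *)

(** The parity for which the Fourier series is a Bernoulli polynomial; the other parity cancels in
    symmetric sums. *)
Definition trg (s : nat) (x : R) : R := if Nat.even s then cos x else sin x.

Definition FS (s N : nat) (u : R) : R :=
  ns N (fun k => trg s (2 * PI * INR (S k) * u) / INR (S k) ^ s).

Lemma ns_is_derive (N : nat) (f : nat -> R -> R) (g : nat -> R) (x : R) :
  (forall m, is_derive (f m) x (g m)) ->
  is_derive (fun t => ns N (fun m => f m t)) x (ns N g).
Proof.
  intros H. induction N; cbn [ns]; [apply @is_derive_const|].
  apply @is_derive_plus; [exact IHN|apply H].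
Qed.

Definition sgn (s : nat) : R := if Nat.even s then -1 else 1.

Lemma FS_derive (s N : nat) (u : R) : is_derive (FS (S s) N) u (sgn (S s) * (2 * PI) * FS s N u).
Proof.
  unfold FS. rewrite <- ns_scal.
  apply (ns_is_derive N (fun k u => trg (S s) (2 * PI * INR (S k) * u) / INR (S k) ^ S s)). intros k.
  assert (P : INR (S k) <> 0) by (apply not_0_INR; lia). assert (Ps := pow_nonzero _ s P).
  unfold trg, sgn. rewrite Nat.even_succ, <- Nat.negb_even. change (INR (S k) ^ S s) with (INR (S k) * INR (S k) ^ s).
  revert P Ps. generalize (INR (S k)) (INR (S k) ^ s). intros m ms P Ps.
  destruct (Nat.even s); cbn [negb]; auto_derive; auto; field; auto.
Qed.

Lemma abs_trg_le (s : nat) (x : R) : Rabs (trg s x) <= 1.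
Proof.
  unfold trg. destruct (Nat.even s); apply Rabs_le; [generalize (COS_bound x)|generalize (SIN_bound x)]; lra.
Qed.

(** Each term is at most 1 / (m (m + 1)) in absolute value, which telescopes uniformly in [u]. *)
Lemma FS_cauchy (s N M : nat) (u : R) : (2 <= s)%nat -> (1 <= N)%nat -> (N <= M)%nat ->
  Rabs (FS s M u - FS s N u) <= / INR N - / INR M.
Proof.
  intros Hs HN HM. induction HM as [|M HM IH].
  - rewrite !Rminus_diag, Rabs_R0; lra.
  - unfold FS in *. cbn [ns].
    set (a := trg s (2 * PI * INR (S M) * u) / INR (S M) ^ s).
    assert (M1 : 1 <= INR M) by (apply (le_INR 1); lia).
    assert (B : Rabs a <= / INR M - / INR (S M)).
    { unfold a, Rdiv. rewrite Rabs_mult, Rabs_inv, <- RPow_abs, (Rabs_pos_eq (INR (S M))) by apply pos_INR.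
      rewrite S_INR. set (m := INR M) in *.
      apply Rle_trans with (1 * / (m + 1) ^ s).
      - apply Rmult_le_compat_r; [|apply abs_trg_le]. apply Rlt_le, Rinv_0_lt_compat, pow_lt; lra.
      - rewrite Rmult_1_l. replace (/ m - / (m + 1)) with (/ (m * (m + 1))) by (field; lra).
        apply Rinv_le_contravar; [nra|]. apply Rle_trans with ((m + 1) ^ 2); [nra|]. apply Rle_pow; [lra|exact Hs]. }
    match goal with |- Rabs (?x + a - ?y) <= _ => replace (x + a - y) with ((x - y) + a) by ring end.
    eapply Rle_trans; [apply Rabs_triang|]. lra.
Qed.

Lemma inv_INR_small (eps : R) : 0 < eps -> exists K, / INR (S K) < eps.
Proof.
  intros He. destruct (nfloor_ex (/ eps)) as [K [_ HK]]; [apply Rlt_le, Rinv_0_lt_compat, He|]. exists K.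
  rewrite <- (Rinv_inv eps). apply Rinv_lt_contravar; [|rewrite S_INR; exact HK].
  apply Rmult_lt_0_compat; [apply Rinv_0_lt_compat, He|apply lt_0_INR; lia].
Qed.

Definition FSlim (s : nat) (u : R) : R := real (Lim_seq (fun N => FS s N u)).

Lemma FS_lim (s : nat) (u : R) : (2 <= s)%nat -> is_lim_seq (fun N => FS s N u) (FSlim s u).
Proof.
  intros Hs. apply Lim_seq_correct', ex_lim_seq_cauchy_corr. intros eps.
  destruct (inv_INR_small eps ltac:(apply cond_pos)) as [K inv].
  assert (main : forall n m, (S K <= n)%nat -> (n <= m)%nat -> Rabs (FS s m u - FS s n u) < eps).
  { intros n m Hn Hm. eapply Rle_lt_trans; [apply FS_cauchy; [exact Hs|lia|exact Hm]|].
    assert (0 < / INR m) by (apply Rinv_0_lt_compat, lt_0_INR; lia).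
    assert (/ INR n <= / INR (S K)) by (apply Rinv_le_contravar; [apply lt_0_INR; lia|apply le_INR; lia]). lra. }
  exists (S K). intros n m Hn Hm. destruct (Nat.le_ge_cases n m) as [L|L].
  - rewrite Rabs_minus_sym. apply main; auto.
  - apply main; auto.
Qed.

Lemma FS_CVU (s : nat) (u : R) (r : posreal) : (2 <= s)%nat -> CVU (FS s) (FSlim s) u r.
Proof.
  intros Hs eps He.
  destruct (inv_INR_small eps ltac:(exact He)) as [K inv].
  exists (S K). intros n y Hn _.
  apply Rle_lt_trans with (/ INR n).
  - assert (L := is_lim_seq_abs _ _ (is_lim_seq_minus' _ _ _ _ (FS_lim s y Hs) (is_lim_seq_const (FS s n y)))).
    refine (is_lim_seq_le_loc _ _ _ _ _ L (is_lim_seq_const (/ INR n))).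
    exists n. intros M HM. eapply Rle_trans; [apply FS_cauchy; [exact Hs|lia|exact HM]|].
    assert (0 < / INR M) by (apply Rinv_0_lt_compat, lt_0_INR; lia). lra.
  - assert (/ INR n <= / INR (S K)) by (apply Rinv_le_contravar; [apply lt_0_INR; lia|apply le_INR; lia]). lra.
Qed.

Lemma QP_prim (d : nat) : forall p, QP d p -> exists P, QP (S d) P /\ forall c, is_derive P c (p c).
Proof.
  induction d; intros p Hp.
  - exists (fun _ => 0). split; [apply QP_0|]. intros c. rewrite Hp. apply @is_derive_const.
  - destruct Hp as (q & g & Hq & Hg & E). destruct (IHd g Hg) as (G & HG & DG).
    assert (N : INR (S d) <> 0) by (apply not_0_INR; lia).
    exists (fun c => q / INR (S d) * c ^ S d + G c). split.
    + exists (q / INR (S d)), G. repeat split; auto. apply isQ_div; auto with isq.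
    + intros c. rewrite E. apply @is_derive_plus; [|apply DG].
      evar_last; [apply is_derive_scal, is_derive_pow, is_derive_id|].
      change (q / INR (S d) * (INR (S d) * 1 * c ^ d) = q * c ^ d).
      revert N. generalize (INR (S d)) (c ^ d). intros. field. auto.
Qed.

(** The Dirichlet kernel, with its denominator cleared. *)
Lemma dirichlet (N : nat) (a : R) :
  2 * ns N (fun k => cos (2 * INR (S k) * a)) * sin a = sin ((2 * INR N + 1) * a) - sin a.
Proof.
  induction N; cbn [ns].
  - simpl INR. rewrite Rmult_0_r, Rplus_0_l, Rmult_1_l. ring.
  - rewrite Rmult_plus_distr_l, Rmult_plus_distr_r, IHN. rewrite S_INR.
    replace ((2 * (INR N + 1) + 1) * a) with (2 * (INR N + 1) * a + a) by ring.
    replace ((2 * INR N + 1) * a) with (2 * (INR N + 1) * a - a) by ring.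
    rewrite sin_plus, sin_minus. ring.
Qed.

Lemma sin_PI_INR (n : nat) : sin (PI * INR n) = 0.
Proof. apply sin_eq_0_1. exists (Z.of_nat n). rewrite <- INR_IZR_INZ. ring. Qed.

Lemma cos_half_odd (n : nat) : cos ((2 * INR n + 1) * (PI / 2)) = 0.
Proof. apply cos_eq_0_1. exists (Z.of_nat n). rewrite <- INR_IZR_INZ. field. Qed.

(** By the Dirichlet kernel the partial sum plus pi t has derivative pi sin (M pi t) / sin (pi t).
    Integration by parts splits off [H], and the derivative of what remains is of order 1 / M; at
    1/2 everything vanishes. The margin [de] keeps the sine away from 0. *)
Lemma FS_1_bound (de y : R) (N : nat) : 0 < de -> de <= y <= 1 - de ->
  Rabs (FS 1 N y - PI * (/ 2 - y)) <= (/ de + PI * / de ^ 2) / (2 * INR N + 1).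
Proof.
  intros Hde Hy. set (M := 2 * INR N + 1). assert (N0 := pos_INR N). assert (M0 : 0 < M) by (unfold M; lra).
  assert (HPI := PI2_1).
  assert (Slow : forall t, de <= t <= 1 - de -> de <= sin (PI * t)).
  { intros t Ht. destruct (Rle_lt_dec t (/ 2)) as [l|l].
    - assert (S := sin_ge_half (PI * t) ltac:(nra)). nra.
    - assert (S := sin_ge_half (PI * (1 - t)) ltac:(nra)).
      replace (PI * (1 - t)) with (PI - PI * t) in S at 2 by ring. rewrite sin_PI_x in S. nra. }
  set (H := fun t => - cos (M * (PI * t)) / (M * sin (PI * t))).
  set (E := fun t => FS 1 N t - PI * (/ 2 - t) - H t).
  set (E' := fun t => - (PI * cos (M * (PI * t)) * cos (PI * t) / (M * sin (PI * t) ^ 2))).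
  assert (dE : forall t, de <= t <= 1 - de -> is_derive E t (E' t)).
  { intros t Ht. assert (St := Slow t Ht).
    assert (dH : is_derive H t ((M * PI * sin (M * (PI * t)) * sin (PI * t) + PI * cos (M * (PI * t)) * cos (PI * t)) / (M * sin (PI * t) ^ 2))).
    { unfold H. auto_derive; [apply Rmult_integral_contrapositive_currified; lra|]. field. split; lra. }
    unfold E. evar_last.
    - apply @is_derive_minus; [apply @is_derive_minus|exact dH].
      + apply FS_derive.
      + instantiate (1 := - PI). auto_derive; [auto|ring].
    - unfold minus, plus, opp; simpl. unfold sgn; simpl Nat.even; cbv iota.
      assert (Di := dirichlet N (PI * t)). fold M in Di.
      assert (EF : FS 0 N t = ns N (fun k => cos (2 * INR (S k) * (PI * t)))).
      { unfold FS. apply ns_ext. intros k _. unfold trg; simpl Nat.even; cbv iota. rewrite pow_O.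
        unfold Rdiv. rewrite Rinv_1, Rmult_1_r. f_equal. ring. }
      rewrite EF. unfold E'.
      set (s := ns N _) in *.
      apply Rmult_eq_reg_r with (M * sin (PI * t) ^ 2).
      2:{ apply Rmult_integral_contrapositive_currified; [lra|]. apply pow_nonzero; lra. }
      transitivity (PI * (2 * s * sin (PI * t)) * M * sin (PI * t) + PI * M * sin (PI * t) ^ 2 -
        (M * PI * sin (M * (PI * t)) * sin (PI * t) + PI * cos (M * (PI * t)) * cos (PI * t))).
      + field. split; lra.
      + rewrite Di. field. split; lra. }
  assert (bE : forall t, de <= t <= 1 - de -> Rabs (E' t) <= PI * / de ^ 2 / M).
  { intros t Ht. assert (St := Slow t Ht). unfold E'. rewrite Rabs_Ropp.
    unfold Rdiv. rewrite !Rabs_mult, Rabs_inv, Rabs_mult, (Rabs_pos_eq PI), (Rabs_pos_eq M), (Rabs_pos_eq (sin (PI * t) ^ 2)) by (try apply pow2_ge_0; lra).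
    rewrite Rinv_mult.
    assert (C1 : Rabs (cos (M * (PI * t))) <= 1) by apply abs_cos_le_1.
    assert (C2 : Rabs (cos (PI * t)) <= 1) by apply abs_cos_le_1.
    assert (I : / sin (PI * t) ^ 2 <= / de ^ 2).
    { apply Rinv_le_contravar; [apply pow_lt; lra|]. apply pow_incr; lra. }
    assert (I0 : 0 < / sin (PI * t) ^ 2) by (apply Rinv_0_lt_compat, pow_lt; lra).
    assert (M1 := Rinv_0_lt_compat M M0).
    assert (R1 := Rabs_pos (cos (M * (PI * t)))). assert (R2 := Rabs_pos (cos (PI * t))).
    replace (PI * / de ^ 2 * / M) with (PI * 1 * 1 * (/ M * / de ^ 2)) by ring.
    apply Rmult_le_compat.
    - apply Rmult_le_pos; [apply Rmult_le_pos; lra|lra].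
    - apply Rmult_le_pos; lra.
    - apply Rmult_le_compat; [apply Rmult_le_pos; lra|lra| |lra]. apply Rmult_le_compat_l; lra.
    - apply Rmult_le_compat_l; lra. }
  assert (E0 : E (/ 2) = 0).
  { unfold E, H. replace (M * (PI * / 2)) with ((2 * INR N + 1) * (PI / 2)) by (unfold M; field).
    rewrite cos_half_odd. unfold FS. rewrite (ns_ext N _ (fun _ => 0)).
    - rewrite ns_const. unfold Rdiv. ring.
    - intros k _. unfold trg; simpl Nat.even; cbv iota.
      replace (2 * PI * INR (S k) * / 2) with (PI * INR (S k)) by field. rewrite sin_PI_INR. unfold Rdiv; ring. }
  assert (hy : Rabs (H y) <= / de / M).
  { assert (Sy := Slow y Hy). unfold H, Rdiv. rewrite Rabs_mult, Rabs_Ropp, Rabs_inv, Rabs_mult, (Rabs_pos_eq M), (Rabs_pos_eq (sin (PI * y))) by lra.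
    rewrite Rinv_mult.
    assert (C1 : Rabs (cos (M * (PI * y))) <= 1) by apply abs_cos_le_1.
    assert (I : / sin (PI * y) <= / de) by (apply Rinv_le_contravar; lra).
    assert (M1 := Rinv_0_lt_compat M M0). assert (I0 : 0 < / sin (PI * y)) by (apply Rinv_0_lt_compat; lra).
    assert (R1 := Rabs_pos (cos (M * (PI * y)))).
    replace (/ de * / M) with (1 * (/ M * / de)) by ring. apply Rmult_le_compat; [lra|apply Rmult_le_pos; lra|lra|].
    apply Rmult_le_compat_l; lra. }
  assert (d2 : de <= / 2) by lra.
  assert (Hin : forall t, Rmin (/ 2) y <= t <= Rmax (/ 2) y -> de <= t <= 1 - de).
  { intros t. unfold Rmin, Rmax. destruct (Rle_dec (/ 2) y); lra. }
  destruct (MVT_gen E (/ 2) y E') as [c [Hc Ec]].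
  - intros t Ht. apply dE, Hin; lra.
  - intros t Ht. apply derivable_continuous_pt, ex_derive_Reals_0. eexists. apply dE, Hin, Ht.
  - rewrite E0, Rminus_0_r in Ec.
    replace (FS 1 N y - PI * (/ 2 - y)) with (E y + H y) by (unfold E; ring).
    rewrite Ec. eapply Rle_trans; [apply Rabs_triang|]. rewrite Rabs_mult.
    assert (B := bE c (Hin c Hc)). assert (Ry : Rabs (y - / 2) <= 1) by (apply Rabs_le; lra).
    assert (R0 := Rabs_pos (y - / 2)). assert (R1 := Rabs_pos (E' c)).
    replace ((/ de + PI * / de ^ 2) / M) with (PI * / de ^ 2 / M + / de / M) by (field; split; lra).
    apply Rplus_le_compat; [|exact hy]. nra.
Qed.

(** Convergence is locally uniform rather than pointwise, as the passage to the next exponent by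
    differentiation requires; the polynomial is a rational multiple of a Bernoulli polynomial. *)
Definition fourier_poly (s : nat) : Prop :=
  exists d p, QP d p /\ forall u, 0 < u < 1 -> exists r : posreal,
    (forall y, Boule u r y -> 0 < y < 1) /\ CVU (FS s) (fun y => PI ^ s * p y) u r.

Lemma Boule_center (u : R) (r : posreal) : Boule u r u.
Proof. unfold Boule. rewrite Rminus_diag, Rabs_R0. apply cond_pos. Qed.

Lemma fourier_poly_1 : fourier_poly 1.
Proof.
  exists 2%nat, (fun u => -1 * u ^ 1 + / 2 * u ^ 0). split.
  - exists (-1), (fun u => / 2 * u ^ 0). split; [apply isQ_IZR|]. split; [|reflexivity].
    exists (/ 2), (fun _ => 0). repeat split; [apply isQ_inv, isQ_IZR|]. intros; ring.
  - intros u Hu. assert (D0 : 0 < Rmin u (1 - u) / 2) by (apply Rdiv_lt_0_compat; [apply Rmin_pos; lra|lra]).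
    exists (mkposreal _ D0). set (de := Rmin u (1 - u) / 2) in *.
    assert (m1 := Rmin_l u (1 - u)). assert (m2 := Rmin_r u (1 - u)).
    assert (HB : forall y, Boule u (mkposreal _ D0) y -> de <= y <= 1 - de).
    { intros y Hy. unfold Boule in Hy. simpl pos in Hy. apply Rabs_def2 in Hy. unfold de in *. lra. }
    split; [intros y Hy; apply HB in Hy; lra|].
    intros eps He. set (C := / de + PI * / de ^ 2).
    assert (C0 : 0 < C).
    { unfold C. assert (0 < / de) by (apply Rinv_0_lt_compat; lra).
      assert (0 < PI * / de ^ 2) by (apply Rmult_lt_0_compat; [apply PI_RGT_0|apply Rinv_0_lt_compat, pow_lt; lra]). lra. }
    destruct (nfloor_ex (C / eps)) as [K [_ HK]]; [apply Rlt_le, Rdiv_lt_0_compat; lra|].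
    exists (S K). intros n y Hn Hy. rewrite Rabs_minus_sym.
    replace (PI ^ 1 * (-1 * y ^ 1 + / 2 * y ^ 0)) with (PI * (/ 2 - y)) by ring.
    eapply Rle_lt_trans; [apply (FS_1_bound de y n D0 (HB y Hy))|]. fold C.
    assert (Kn : INR K + 1 <= INR n) by (rewrite <- S_INR; apply le_INR; lia). assert (K0 := pos_INR K).
    apply Rmult_lt_reg_r with (2 * INR n + 1); [lra|].
    replace (C / (2 * INR n + 1) * (2 * INR n + 1)) with C by (field; lra).
    apply Rmult_lt_compat_r with (r := eps) in HK; [|lra].
    replace (C / eps * eps) with C in HK by (field; lra). nra.
Qed.

Lemma ns_pairs (N : nat) (f : nat -> R) : ns (2 * N) f = ns N (fun i => f (2 * i)%nat + f (2 * i + 1)%nat).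
Proof.
  induction N; [reflexivity|]. replace (2 * S N)%nat with (S (S (2 * N))) by lia. cbn [ns].
  rewrite IHN. replace (2 * N + 1)%nat with (S (2 * N)) by lia. ring.
Qed.

Lemma FSlim_half_odd (s : nat) : Nat.even s = false -> FSlim s (/ 2) = 0.
Proof.
  intros Hs. unfold FSlim. rewrite (Lim_seq_ext _ (fun _ => 0)); [now rewrite Lim_seq_const|].
  intros N. unfold FS. rewrite (ns_ext N _ (fun _ => 0)); [rewrite ns_const; ring|].
  intros k _. unfold trg. rewrite Hs.
  replace (2 * PI * INR (S k) * / 2) with (PI * INR (S k)) by field. rewrite sin_PI_INR. unfold Rdiv; ring.
Qed.

(** cos (k pi / 2) vanishes for odd k, and an even k = 2 l contributes cos (l pi) / (2 l)^s. *)
Lemma FSlim_quarter_even (s : nat) : (2 <= s)%nat -> Nat.even s = true -> FSlim s (/ 4) = / 2 ^ s * FSlim s (/ 2).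
Proof.
  intros Hs He.
  assert (E : forall N, FS s (2 * N) (/ 4) = / 2 ^ s * FS s N (/ 2)).
  { intros N. unfold FS. rewrite ns_pairs, <- ns_scal. apply ns_ext. intros k _. unfold trg. rewrite He.
    replace (cos (2 * PI * INR (S (2 * k)) * / 4)) with 0.
    2:{ rewrite <- (cos_half_odd k). f_equal. rewrite S_INR, mult_INR. simpl (INR 2). field. }
    replace (INR (S (2 * k + 1))) with (2 * INR (S k)).
    2:{ rewrite !S_INR, plus_INR, mult_INR. simpl. ring. }
    rewrite Rpow_mult_distr. unfold Rdiv. rewrite Rinv_mult, Rmult_0_l, Rplus_0_l.
    replace (2 * PI * (2 * INR (S k)) * / 4) with (2 * PI * INR (S k) * / 2) by field. ring. }
  assert (sub : forall n, (2 * n < 2 * S n)%nat) by (intros; lia).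
  assert (L1 := is_lim_seq_subseq _ _ _ (eventually_subseq (fun N => (2 * N)%nat) sub) (FS_lim s (/ 4) Hs)).
  assert (L2 := is_lim_seq_mult' _ _ _ _ (is_lim_seq_const (/ 2 ^ s)) (FS_lim s (/ 2) Hs)).
  apply (is_lim_seq_ext _ _ _ E) in L1. apply is_lim_seq_unique in L1. apply is_lim_seq_unique in L2.
  rewrite L1 in L2. now injection L2.
Qed.

(** The derivative fixes the limit up to a constant. If the new exponent is odd, the value 0 at 1/2
    determines it; if it is even, the relation between the values at 1/4 and 1/2 is a linear
    equation with coefficient 1 - 2^(-s-1). *)
Lemma fourier_poly_succ (s : nat) : (1 <= s)%nat -> fourier_poly s -> fourier_poly (S s).
Proof.
  intros Hs (d & p & Hp & H). destruct (QP_prim d p Hp) as (P & HP & DP).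
  set (sg := sgn (S s)). assert (Qsg : isQ sg) by (unfold sg, sgn; destruct (Nat.even (S s)); apply isQ_IZR).
  assert (DG : forall u, 0 < u < 1 -> is_derive (FSlim (S s)) u (sg * (2 * PI) * (PI ^ s * p u))).
  { intros u Hu. destruct (H u Hu) as (r & HB & CV). apply is_derive_Reals.
    apply (CVU_derivable (FS (S s)) (fun N y => sg * (2 * PI) * FS s N y) _ (fun y => sg * (2 * PI) * (PI ^ s * p y)) u r);
      [| | |apply Boule_center].
    - intros eps He. assert (HPI := PI_RGT_0).
      assert (e2 : 0 < eps / (2 * PI)) by (apply Rdiv_lt_0_compat; lra).
      destruct (CV _ e2) as [K HK]. exists K. intros n y Hn Hy. specialize (HK n y Hn Hy).
      rewrite <- Rmult_minus_distr_l, Rabs_mult.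
      assert (As : Rabs (sg * (2 * PI)) = 2 * PI).
      { rewrite Rabs_mult, (Rabs_pos_eq (2 * PI)) by lra. unfold sg, sgn.
        destruct (Nat.even (S s)); [rewrite Rabs_left|rewrite Rabs_pos_eq]; lra. }
      rewrite As. apply Rmult_lt_compat_l with (r := 2 * PI) in HK; [|lra].
      replace (2 * PI * (eps / (2 * PI))) with eps in HK by (field; lra). exact HK.
    - intros y Hy. apply is_lim_seq_Reals, FS_lim. lia.
    - intros n y Hy. apply is_derive_Reals, FS_derive. }
  set (T := fun u => FSlim (S s) u - PI ^ S s * (sg * 2 * P u)).
  assert (DT : forall u, 0 < u < 1 -> is_derive T u 0).
  { intros u Hu. unfold T. evar_last.
    - apply @is_derive_minus; [apply DG, Hu|]. apply is_derive_scal, is_derive_scal, DP.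
    - unfold minus, plus, opp; simpl. ring. }
  assert (Tc : forall u, 0 < u < 1 -> T u = T (/ 2)).
  { intros u Hu. destruct (MVT_gen T (/ 2) u (fun _ => 0)) as [c [_ E]].
    - intros t Ht. apply DT. unfold Rmin, Rmax in Ht. destruct (Rle_dec (/ 2) u); lra.
    - intros t Ht. apply derivable_continuous_pt, ex_derive_Reals_0. eexists. apply DT.
      unfold Rmin, Rmax in Ht. destruct (Rle_dec (/ 2) u); lra.
    - lra. }
  assert (Cq : exists q, isQ q /\ T (/ 2) = PI ^ S s * q).
  { assert (QP2 : isQ (P (/ 2))) by (apply (QP_isQ (S d)); [exact HP|apply isQ_inv, isQ_IZR]).
    assert (QP4 : isQ (P (/ 4))) by (apply (QP_isQ (S d)); [exact HP|apply isQ_inv, isQ_IZR]).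
    destruct (Nat.even (S s)) eqn:Ev.
    - exists ((sg * 2 * (/ 2 ^ S s * P (/ 2) - P (/ 4))) / (1 - / 2 ^ S s)).
      assert (Qk : isQ (/ 2 ^ S s)) by (apply isQ_inv, isQ_pow, isQ_IZR).
      split.
      + apply isQ_div; [apply isQ_mult; [apply isQ_mult; [exact Qsg|apply isQ_IZR]|]|].
        * apply isQ_minus; [apply isQ_mult|]; assumption.
        * apply isQ_minus; [apply isQ_IZR|exact Qk].
      + assert (E4 := Tc (/ 4) ltac:(lra)).
        assert (Q4 := FSlim_quarter_even (S s) ltac:(lia) Ev).
        assert (G4 : FSlim (S s) (/ 4) = T (/ 2) + PI ^ S s * (sg * 2 * P (/ 4))) by (rewrite <- E4; unfold T; ring).
        assert (G2 : FSlim (S s) (/ 2) = T (/ 2) + PI ^ S s * (sg * 2 * P (/ 2))) by (unfold T; ring).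
        rewrite G4, G2 in Q4.
        assert (h1 : / 2 ^ S s < 1).
        { rewrite <- Rinv_1. apply Rinv_lt_contravar; [rewrite Rmult_1_l; apply pow_lt; lra|]. apply Rlt_pow_R1; [lra|lia]. }
        revert Q4 h1. generalize (/ 2 ^ S s) (PI ^ S s) (T (/ 2)). intros k pk t Q4 h1.
        field_simplify_eq; [|lra]. lra.
    - exists (- (sg * 2 * P (/ 2))). split; [apply isQ_opp, isQ_mult; [apply isQ_mult; [exact Qsg|apply isQ_IZR]|exact QP2]|].
      unfold T. rewrite FSlim_half_odd by exact Ev. ring. }
  destruct Cq as (q & Hq & Eq).
  exists (S d), (fun u => sg * 2 * P u + q * u ^ 0). split.
  - apply QP_plus; [apply QP_scal; [apply isQ_mult; [exact Qsg|apply isQ_IZR]|exact HP]|].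
    apply QP_scal; [exact Hq|]. apply QP_le with 1%nat; [lia|apply (QP_pow 0)].
  - intros u Hu. destruct (H u Hu) as (r & HB & _). exists r. split; [exact HB|].
    apply CVU_ext_lim with (FSlim (S s)); [apply FS_CVU; lia|].
    intros y Hy. assert (E := Tc y (HB y Hy)). rewrite Eq in E. unfold T in E. rewrite pow_O. lra.
Qed.

Lemma fourier_poly_all (s : nat) : (1 <= s)%nat -> fourier_poly s.
Proof. intros H; induction H; [apply fourier_poly_1|apply fourier_poly_succ; auto]. Qed.

(** * Arbitrary exponents *)

(* Unlike in [Wp], the second component is not tied to the series at the conjugate: for trigonometric polynomials the
   fractional part in the Bernoulli polynomial destroys the equivariance. *)
Definition W1 (de : R) (s : nat) (f : Z -> R) : Prop :=
  exists v v', InK de v v' /\ zlim (fun n => / IZR n ^ s * f n) (PI ^ s * v).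

Lemma Wp_W1 (de : R) (s : nat) (f f' : Z -> R) : Wp de s f f' -> W1 de s f.
Proof. intros (v & v' & K & L & _). exists v, v'. auto. Qed.

Lemma W1_ext (de : R) (s : nat) (f g : Z -> R) : (1 <= s)%nat ->
  (forall n, n <> 0%Z -> f n = g n) -> W1 de s f -> W1 de s g.
Proof.
  intros Hs E (v & v' & K & L). exists v, v'. split; [exact K|]. revert L.
  apply is_lim_seq_zs_subst. intros n. destruct (Z.eq_dec n 0) as [->|Hn]; [|now rewrite E].
  rewrite Rinv_pow_0 by exact Hs. ring.
Qed.

Lemma W1_lin (de q : R) (s : nat) (f g : Z -> R) : Kgen de -> isQ q ->
  W1 de s f -> W1 de s g -> W1 de s (fun n => f n + q * g n).
Proof.
  intros Hd Hq (v & v' & K & L) (w & w' & K2 & M). exists (v + q * w), (v' + q * w').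
  split; [apply InK_plus; [exact K|apply InK_mult; [exact Hd|apply InK_Q, Hq|exact K2]]|].
  replace (PI ^ s * (v + q * w)) with (PI ^ s * v + q * (PI ^ s * w)) by ring.
  apply is_lim_seq_ext with (fun N => zs N (fun n => / IZR n ^ s * f n) + q * zs N (fun n => / IZR n ^ s * g n)).
  - intros N. rewrite <- zs_scal, <- zs_plus. apply zs_ext; intros; ring.
  - apply is_lim_seq_plus'; [exact L|]. apply is_lim_seq_mult'; [apply is_lim_seq_const|exact M].
Qed.

Lemma W1_1 (de : R) (s : nat) : (1 <= s)%nat -> W1 de s (fun _ => 1).
Proof. intros Hs. apply (Wp_W1 de s _ (fun _ => 1)), Wp_1, Hs. Qed.

Lemma W1_0 (de : R) (s : nat) : (1 <= s)%nat -> W1 de s (fun _ => 0).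
Proof.
  intros Hs. exists 0, 0. split; [apply InK_Q, isQ_IZR|]. rewrite Rmult_0_r.
  apply is_lim_seq_ext with (fun _ => 0); [|apply is_lim_seq_const]. intros N.
  rewrite (zs_ext N _ (fun _ => 0)) by (intros; ring). rewrite zs_const; ring.
Qed.

Lemma zs_even_fun (N : nat) (g : Z -> R) : g 0%Z = 0 -> (forall n, g (- n)%Z = g n) ->
  zs N g = 2 * ns N (fun k => g (Z.of_nat (S k))).
Proof.
  intros H0 H. rewrite zs_split, H0, <- ns_scal, Rplus_0_l. apply ns_ext. intros k _. rewrite H. ring.
Qed.

Lemma zs_odd_fun (N : nat) (g : Z -> R) : (forall n, g (- n)%Z = - g n) -> zs N g = 0.
Proof.
  intros H. assert (E := zs_opp N g). rewrite (zs_ext N _ (fun n => -1 * g n)) in E by (intros; rewrite H; ring).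
  rewrite zs_scal in E. lra.
Qed.

Lemma inv_pow_neg (x : R) (s : nat) : / (- x) ^ s = (if Nat.even s then 1 else -1) * / x ^ s.
Proof.
  replace (- x) with (-1 * x) by ring. rewrite Rpow_mult_distr, Rinv_mult. f_equal.
  destruct (Nat.even s) eqn:E.
  - apply Nat.even_spec in E. destruct E as [m ->]. rewrite pow_mult. replace ((-1) ^ 2) with 1 by ring. rewrite pow1. field.
  - assert (O : Nat.odd s = true) by (rewrite <- Nat.negb_even, E; reflexivity).
    apply Nat.odd_spec in O. destruct O as [m ->]. rewrite pow_add, pow_mult.
    replace ((-1) ^ 2) with 1 by ring. rewrite pow1, pow_1. field.
Qed.

Lemma cos_shift_Z (x : R) (k : Z) : cos (x + IZR k * (2 * PI)) = cos x.
Proof.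
  revert k. apply Z.peano_ind.
  - f_equal; ring.
  - intros k H. rewrite succ_IZR. replace (x + (IZR k + 1) * (2 * PI)) with (x + IZR k * (2 * PI) + 2 * INR 1 * PI) by (simpl; ring).
    now rewrite cos_period.
  - intros k H. rewrite <- H, <- (cos_period (x + IZR (Z.pred k) * (2 * PI)) 1). f_equal.
    unfold Z.pred; rewrite plus_IZR; simpl; ring.
Qed.

Lemma trg_shift_Z (s : nat) (x : R) (k : Z) : trg s (x + IZR k * (2 * PI)) = trg s x.
Proof.
  unfold trg. destruct (Nat.even s); [apply cos_shift_Z|]. rewrite !sin_cos.
  rewrite <- (cos_shift_Z (PI / 2 + x) k). do 2 f_equal. ring.
Qed.

Lemma QP_InK (de : R) (d : nat) : Kgen de -> forall f x x', QP d f -> InK de x x' -> InK de (f x) (f x').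
Proof.
  intros Hd. induction d; intros f x x' Hf K.
  - rewrite !Hf. apply InK_Q, isQ_IZR.
  - destruct Hf as (q & g & Hq & Hg & E). rewrite !E. apply InK_plus; [|apply IHd; auto].
    apply InK_mult; [exact Hd|apply InK_Q, Hq|apply InK_pow; auto].
Qed.

(** Modulo 1 the number k rho / 2 is a point y in (0, 1), and y = k rho / 2 - z stays in the field;
    the sum is the polynomial at y, doubled by symmetry. *)
Lemma W1_trg (de rho rho' : R) (s : nat) (k : Z) : Kgen de -> Kirr de rho rho' -> (1 <= s)%nat -> k <> 0%Z ->
  W1 de s (fun n => trg s (IZR k * (PI * IZR n * rho))).
Proof.
  intros Hd K Hs Hk. destruct (fourier_poly_all s Hs) as (d & p & Hp & H).
  assert (k0 : IZR k <> 0) by (apply IZR_neq; exact Hk).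
  assert (Ku : Kirr de (IZR k / 2 * rho) (IZR k / 2 * rho')).
  { split; [apply InK_mult; [exact Hd|apply InK_Q, isQ_div; apply isQ_IZR|apply K]|].
    intros E. apply Rmult_eq_reg_l in E; [apply K, E|]. apply Rmult_integral_contrapositive_currified; [exact k0|lra]. }
  destruct (Kirr_sincos_ne de _ _ 1 Hd Ku ltac:(lia)) as [S1 _].
  destruct (frac_decomp (IZR k / 2 * rho)) as (y & z & Hy & Ey).
  { rewrite Rmult_1_r in S1. exact S1. }
  destruct (H y Hy) as (r & _ & CV). assert (L := CVU_cv _ _ _ _ CV y (Boule_center y r)).
  apply is_lim_seq_Reals in L.
  exists (2 * p y), (2 * p (IZR k / 2 * rho' - IZR z)). split.
  - apply InK_mult; [exact Hd|apply InK_Q, isQ_IZR|]. apply (QP_InK de d Hd p); [exact Hp|].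
    replace y with (IZR k / 2 * rho - IZR z) by lra. apply InK_minus; [apply Ku|apply InK_Q, isQ_IZR].
  - replace (PI ^ s * (2 * p y)) with (2 * (PI ^ s * p y)) by ring.
    apply is_lim_seq_ext with (fun N => 2 * FS s N y); [|apply lim_scal, L].
    intros N. rewrite zs_even_fun.
    + f_equal. unfold FS. apply ns_ext. intros i _. rewrite <- INR_IZR_INZ. unfold Rdiv. rewrite Rmult_comm. f_equal.
      rewrite <- (trg_shift_Z s (2 * PI * INR (S i) * y) (z * Z.of_nat (S i))). f_equal.
      rewrite mult_IZR, <- INR_IZR_INZ. replace rho with (2 / IZR k * (y + IZR z)) by (rewrite <- Ey; field; exact k0).
      field. exact k0.
    + rewrite Rinv_pow_0 by exact Hs. ring.
    + intros n. rewrite opp_IZR, inv_pow_neg. unfold trg.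
      replace (IZR k * (PI * - IZR n * rho)) with (- (IZR k * (PI * IZR n * rho))) by ring.
      destruct (Nat.even s); [rewrite cos_neg|rewrite sin_neg]; ring.
Qed.

(** The terms are odd in [n], so the symmetric sums vanish. *)
Lemma W1_trg_mismatch (de rho : R) (s : nat) (k : Z) :
  W1 de s (fun n => if Nat.even s then sin (IZR k * (PI * IZR n * rho)) else cos (IZR k * (PI * IZR n * rho))).
Proof.
  exists 0, 0. split; [apply InK_Q, isQ_IZR|]. rewrite Rmult_0_r.
  apply is_lim_seq_ext with (fun _ => 0); [|apply is_lim_seq_const]. intros N. symmetry. apply zs_odd_fun.
  intros n. rewrite opp_IZR, inv_pow_neg.
  replace (IZR k * (PI * - IZR n * rho)) with (- (IZR k * (PI * IZR n * rho))) by ring.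
  destruct (Nat.even s); [rewrite sin_neg|rewrite cos_neg]; ring.
Qed.

Lemma W1_cos_sin (de rho rho' : R) (s : nat) (k : Z) : Kgen de -> Kirr de rho rho' -> (1 <= s)%nat ->
  W1 de s (fun n => cos (IZR k * (PI * IZR n * rho))) /\ W1 de s (fun n => sin (IZR k * (PI * IZR n * rho))).
Proof.
  intros Hd K Hs. destruct (Z.eq_dec k 0) as [->|Hk].
  - split.
    + apply W1_ext with (fun _ => 1); [exact Hs| |apply W1_1, Hs]. intros. rewrite Rmult_0_l, cos_0. reflexivity.
    + apply W1_ext with (fun _ => 0); [exact Hs| |apply W1_0, Hs]. intros. rewrite Rmult_0_l, sin_0. reflexivity.
  - assert (A := W1_trg de rho rho' s k Hd K Hs Hk). assert (B := W1_trg_mismatch de rho s k).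
    unfold trg in A. destruct (Nat.even s); split; assumption.
Qed.

(** Trigonometric polynomials as a rational span of the functions that the Bernoulli polynomials
    evaluate, closed under pointwise equality. *)
Inductive TP : (R -> R) -> Prop :=
| TP_cos (k : Z) : TP (fun x => cos (IZR k * x))
| TP_sin (k : Z) : TP (fun x => sin (IZR k * x))
| TP_lin (q : R) (f g : R -> R) : isQ q -> TP f -> TP g -> TP (fun x => f x + q * g x)
| TP_ext (f g : R -> R) : (forall x, f x = g x) -> TP f -> TP g.

Lemma TP_0 : TP (fun _ => 0).
Proof. apply TP_ext with (fun x => sin (IZR 0 * x)); [|apply TP_sin]. intros; rewrite Rmult_0_l, sin_0; reflexivity. Qed.

Lemma TP_half_sum (q : R) (f g h : R -> R) : isQ q -> (forall x, f x = / 2 * g x + q * h x) -> TP g -> TP h -> TP f.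
Proof.
  intros Hq E Hg Hh. apply TP_ext with (fun x => (0 + / 2 * g x) + q * h x); [intros; rewrite E; ring|].
  apply TP_lin; [exact Hq| |exact Hh].
  apply (TP_lin (/ 2) (fun _ => 0) g); [apply isQ_inv, isQ_IZR|apply TP_0|exact Hg].
Qed.

(** The product-to-sum formulas keep the span closed. *)
Lemma TP_mul (f : R -> R) : TP f -> TP (fun x => cos x * f x) /\ TP (fun x => sin x * f x).
Proof.
  assert (h : isQ (/ 2)) by (apply isQ_inv, isQ_IZR). assert (mh := isQ_opp _ h).
  assert (e1 : forall k x, IZR (k + 1) * x = IZR k * x + x) by (intros; rewrite plus_IZR; ring).
  assert (e2 : forall k x, IZR (k - 1) * x = IZR k * x - x) by (intros; rewrite minus_IZR; ring).
  induction 1 as [k|k|q f g Hq Hf [F1 F2] Hg [G1 G2]|f g E Hf [F1 F2]].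
  - split.
    + apply (TP_half_sum (/ 2) _ _ _ h) with (2 := TP_cos (k + 1)) (3 := TP_cos (k - 1)).
      intros x. rewrite e1, e2, cos_plus, cos_minus. field.
    + apply (TP_half_sum (- / 2) _ _ _ mh) with (2 := TP_sin (k + 1)) (3 := TP_sin (k - 1)).
      intros x. rewrite e1, e2, sin_plus, sin_minus. field.
  - split.
    + apply (TP_half_sum (/ 2) _ _ _ h) with (2 := TP_sin (k + 1)) (3 := TP_sin (k - 1)).
      intros x. rewrite e1, e2, sin_plus, sin_minus. field.
    + apply (TP_half_sum (- / 2) _ _ _ mh) with (2 := TP_cos (k - 1)) (3 := TP_cos (k + 1)).
      intros x. rewrite e1, e2, cos_plus, cos_minus. field.
  - split.
    + apply TP_ext with (fun x => cos x * f x + q * (cos x * g x)); [intros; ring|]. apply TP_lin; auto.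
    + apply TP_ext with (fun x => sin x * f x + q * (sin x * g x)); [intros; ring|]. apply TP_lin; auto.
  - split.
    + apply TP_ext with (fun x => cos x * f x); [intros; now rewrite E|]. exact F1.
    + apply TP_ext with (fun x => sin x * f x); [intros; now rewrite E|]. exact F2.
Qed.

Lemma TP_monomial (p q : nat) : TP (fun x => cos x ^ p * sin x ^ q).
Proof.
  induction p as [|p IH].
  - induction q as [|q IH].
    + apply TP_ext with (fun x => cos (IZR 0 * x)); [|apply TP_cos]. intros. rewrite Rmult_0_l, cos_0. ring.
    + apply TP_ext with (fun x => sin x * (cos x ^ 0 * sin x ^ q)); [intros; simpl; ring|]. apply TP_mul, IH.
  - apply TP_ext with (fun x => cos x * (cos x ^ p * sin x ^ q)); [intros; simpl; ring|]. apply TP_mul, IH.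
Qed.

Lemma W1_TP (de rho rho' : R) (s : nat) (f : R -> R) : Kgen de -> Kirr de rho rho' -> (1 <= s)%nat ->
  TP f -> W1 de s (fun n => f (PI * IZR n * rho)).
Proof.
  intros Hd K Hs. induction 1 as [k|k|q f g Hq Hf IHf Hg IHg|f g E Hf IHf].
  - apply (W1_cos_sin de rho rho' s k Hd K Hs).
  - apply (W1_cos_sin de rho rho' s k Hd K Hs).
  - apply W1_lin; auto.
  - revert IHf. apply W1_ext; [exact Hs|]. intros; apply E.
Qed.

(** For a + b < 0 the Pythagorean identity is read the other way. If a > 0 >= b, then b <= -2, so b
    + 2 is closer to 0 while |a - 2| <= a; the case b > 0 is symmetric. Thus |a| + |b| decreases
    until both exponents are nonpositive or their sum is nonnegative. *)
Lemma W1_trig (de rho rho' : R) (s : nat) : Kgen de -> Kirr de rho rho' -> (1 <= s)%nat ->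
  forall m a b, (Z.abs_nat a + Z.abs_nat b <= m)%nat -> (a + 1 <= Z.of_nat s)%Z -> (b + 1 <= Z.of_nat s)%Z ->
    W1 de s (fun n => trig a b (PI * IZR n * rho)).
Proof.
  intros Hd K Hs. induction m as [m IH] using (well_founded_induction lt_wf). intros a b Hm Ha Hb.
  destruct (Z_le_gt_dec 0 (a + b)) as [P|P].
  { apply (Wp_W1 de s _ (fun n => trig a b (PI * IZR n * rho'))).
    apply (Wtrig_nonneg de rho rho' s Hd K Hs (Z.to_nat (a + b))); lia. }
  assert (ne : forall n, n <> 0%Z -> sin (PI * IZR n * rho) <> 0 /\ cos (PI * IZR n * rho) <> 0).
  { intros n Hn. apply (Kirr_sincos_ne de rho rho'); auto. }
  destruct (Z_le_gt_dec b 0) as [B|B]; [destruct (Z_le_gt_dec a 0) as [A|A]|].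
  - assert (T := W1_TP de rho rho' s _ Hd K Hs (TP_monomial (Z.to_nat (- a)) (Z.to_nat (- b)))).
    revert T. apply W1_ext; [exact Hs|]. intros n _. unfold trig.
    rewrite <- !powerRZ_inv_opp. do 2 f_equal; lia.
  - assert (X1 := IH (Z.abs_nat a + Z.abs_nat (b + 2))%nat ltac:(lia) a (b + 2)%Z ltac:(lia) ltac:(lia) ltac:(lia)).
    assert (X2 := IH (Z.abs_nat (a - 2) + Z.abs_nat (b + 2))%nat ltac:(lia) (a - 2)%Z (b + 2)%Z ltac:(lia) ltac:(lia) ltac:(lia)).
    assert (X := W1_lin de (-1) s _ _ Hd (isQ_IZR (-1)) X1 X2). revert X.
    apply W1_ext; [exact Hs|]. intros n Hn. destruct (ne n Hn) as [S C].
    assert (T := trig_pythagoras (a - 2) b _ S C). replace (a - 2 + 2)%Z with a in T by lia. lra.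
  - assert (X1 := IH (Z.abs_nat (a + 2) + Z.abs_nat b)%nat ltac:(lia) (a + 2)%Z b ltac:(lia) ltac:(lia) ltac:(lia)).
    assert (X2 := IH (Z.abs_nat (a + 2) + Z.abs_nat (b - 2))%nat ltac:(lia) (a + 2)%Z (b - 2)%Z ltac:(lia) ltac:(lia) ltac:(lia)).
    assert (X := W1_lin de (-1) s _ _ Hd (isQ_IZR (-1)) X1 X2). revert X.
    apply W1_ext; [exact Hs|]. intros n Hn. destruct (ne n Hn) as [S C].
    assert (T := trig_pythagoras a (b - 2) _ S C). replace (b - 2 + 2)%Z with b in T by lia. lra.
Qed.

(** * From symmetric sums to the series *)

Lemma powerRZ_opp_base (x : R) (b : Z) : powerRZ (- x) b = (if Z.even b then 1 else -1) * powerRZ x b.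
Proof.
  replace (- x) with (-1 * x) by ring. rewrite powerRZ_mult. f_equal.
  assert (m1 : -1 <> 0) by lra.
  destruct (Z.even b) eqn:E.
  - apply Z.even_spec in E. destruct E as [m ->]. replace (2 * m)%Z with (m + m)%Z by lia.
    rewrite powerRZ_add, <- powerRZ_mult by exact m1. replace (-1 * -1) with 1 by ring. apply powerRZ_R1.
  - assert (O : Z.odd b = true) by (rewrite <- Z.negb_even, E; reflexivity).
    apply Z.odd_spec in O. destruct O as [m ->]. replace (2 * m + 1)%Z with (m + m + 1)%Z by lia.
    rewrite !powerRZ_add, <- powerRZ_mult by exact m1. replace (-1 * -1) with 1 by ring. rewrite powerRZ_R1. simpl; ring.
Qed.

Lemma trig_neg (a b : Z) (x : R) : trig a b (- x) = (if Z.even b then 1 else -1) * trig a b x.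
Proof. unfold trig. rewrite cos_neg, sin_neg, Rinv_opp, powerRZ_opp_base. ring. Qed.

Lemma sum_n_double (u : nat -> R) (N : nat) : sum_n (fun k => 2 * u k) N = 2 * sum_n u N.
Proof.
  induction N; [now rewrite !sum_O|]. rewrite !sum_Sn, IHN. unfold plus; simpl. ring.
Qed.

(** Equal parity of [s] and [b] makes the terms even in [n], so the series is half the symmetric
    sum, whose term at n = 0 vanishes. *)
Lemma is_series_psi (a b : Z) (s : nat) (rho l : R) : (1 <= s)%nat -> Z.even (Z.of_nat s) = Z.even b ->
  zlim (fun n => / IZR n ^ s * trig a b (PI * IZR n * rho)) l ->
  is_series (psi_term a b (Z.of_nat s) rho) (l / 2).
Proof.
  intros Hs Hpar L. rewrite (is_lim_seq_incr_1) in L.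
  assert (L2 : is_lim_seq (sum_n (psi_term a b (Z.of_nat s) rho)) (l / 2)); [|exact L2].
  replace (l / 2) with (/ 2 * l) by field.
  apply is_lim_seq_ext with (2 := is_lim_seq_mult' _ _ _ _ (is_lim_seq_const (/ 2)) L).
  intros N. rewrite zs_sum. rewrite Rinv_pow_0, Rmult_0_l, Rplus_0_l by exact Hs.
  rewrite (sum_n_ext _ (fun k => 2 * psi_term a b (Z.of_nat s) rho k)).
  - rewrite sum_n_double. field.
  - intros k. unfold psi_term. rewrite opp_IZR, inv_pow_neg, <- INR_IZR_INZ, <- pow_powerRZ.
    replace (PI * - INR (S k) * rho) with (- (PI * INR (S k) * rho)) by ring. rewrite trig_neg.
    replace (Nat.even s) with (Z.even b).
    + destruct (Z.even b); unfold Rdiv; match goal with |- ?x = ?y => change (@eq R x y) end; ring.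
    + rewrite <- Hpar. clear. destruct (Nat.even s) eqn:E.
      * apply Nat.even_spec in E. destruct E as [m ->]. apply Z.even_spec. exists (Z.of_nat m). lia.
      * assert (O : Nat.odd s = true) by (rewrite <- Nat.negb_even, E; reflexivity).
        apply Nat.odd_spec in O. destruct O as [m ->]. rewrite <- Z.negb_odd.
        replace (Z.odd (Z.of_nat (2 * m + 1))) with true; [reflexivity|]. symmetry. apply Z.odd_spec. exists (Z.of_nat m). lia.
Qed.


Lemma isQ_Q2R (q : Q) : isQ (Q2R q).
Proof. exists q; reflexivity. Qed.

Lemma in_Q_adj_lin (rho x y : R) : isQ x -> isQ y -> in_Q_adj rho (x + y * rho).
Proof.
  intros [p ->] [q ->]. exists (p :: q :: nil), (1%Q :: nil). cbn [Qpoly_eval].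
  assert (E : Q2R 1 = 1) by (unfold Q2R; simpl; field). rewrite E. split; [lra|]. field.
Qed.

(** [de] is the derivative of the quadratic polynomial at [rho], which is a square root of the
    discriminant; the field elements are then rational combinations of 1 and [rho]. *)
Lemma quad_irrational_Kirr (rho : R) : quad_irrational rho ->
  exists de rho', Kgen de /\ Kirr de rho rho' /\
    forall v v', InK de v v' -> exists x y, isQ x /\ isQ y /\ v = x + y * rho.
Proof.
  intros [(p & q & r & Hp & E) Hirr].
  assert (nQ : ~ isQ rho) by (intros [x ->]; apply Hirr; exists x; reflexivity).
  assert (p0 : Q2R p <> 0).
  { intros Z0. apply Hp, Qreals.eqR_Qeq. rewrite Z0. unfold Q2R; simpl. ring. }
  assert (Qp := isQ_Q2R p). assert (Qq := isQ_Q2R q). assert (Qr := isQ_Q2R r).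
  set (P := Q2R p) in *. set (B := Q2R q) in *. set (C := Q2R r) in *.
  set (de := 2 * P * rho + B).
  assert (Er : rho = (de - B) / (2 * P)) by (unfold de; field; exact p0).
  assert (Hd : Kgen de).
  { split.
    - replace (de ^ 2) with (B ^ 2 - 4 * P * C); [auto 8 with isq|]. unfold de.
      replace C with (- (P * rho ^ 2 + B * rho)) by lra. ring.
    - intros Hde. apply nQ. rewrite Er. auto 8 with isq. }
  exists de, ((- de - B) / (2 * P)). split; [exact Hd|]. split.
  - split.
    + exists (- B / (2 * P)), (/ (2 * P)). split; [auto 8 with isq|]. split; [auto 8 with isq|].
      split; [rewrite Er at 1|]; field; exact p0.
    + intros F. apply (proj2 Hd). replace de with 0; [apply isQ_IZR|].
      rewrite Er in F. apply (Rmult_eq_compat_r (2 * P)) in F.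
      replace ((de - B) / (2 * P) * (2 * P)) with (de - B) in F by (field; exact p0).
      replace ((- de - B) / (2 * P) * (2 * P)) with (- de - B) in F by (field; exact p0). lra.
  - intros v v' (x & y & Hx & Hy & -> & _). exists (x + y * B), (y * (2 * P)).
    split; [auto 8 with isq|]. split; [auto 8 with isq|]. unfold de. ring.
Qed.

Lemma pow_even_square (x : R) (m : nat) : isQ (x ^ 2) -> isQ (x ^ (2 * m)).
Proof. intros H. rewrite pow_mult. auto with isq. Qed.

(** With [rho] itself as generator the conjugate is -rho, where the sum is multiplied by (-1)^b. So
    v is rational for even b and a rational multiple of [rho] for odd b, and [rho^s] is of the same
    type since s and b have equal parity. *)
Lemma series_value_conjugate (rho : R) (a b : Z) (s : nat) : Kgen rho ->
  (a + 1 <= Z.of_nat s)%Z -> (b + 1 <= Z.of_nat s)%Z -> (1 <= s)%nat -> (0 <= a + b)%Z ->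
  Z.even (Z.of_nat s) = Z.even b ->
  exists c : Q, is_series (psi_term a b (Z.of_nat s) rho) ((PI * rho) ^ s * Q2R c).
Proof.
  intros Hd Ha Hb Hs Hab Hpar.
  assert (r0 : rho <> 0) by (intros e; apply (proj2 Hd); rewrite e; apply isQ_IZR).
  assert (K : Kirr rho rho (- rho)).
  { split; [|lra]. exists 0, 1. repeat split; try apply isQ_IZR; ring. }
  destruct (Wtrig_nonneg rho rho (- rho) s Hd K Hs (Z.to_nat (a + b)) a b) as (v & v' & (x & y & Hx & Hy & Ev & Ev') & L & L'); try lia.
  assert (E : v' = (if Z.even b then 1 else -1) * v).
  { assert (L2 : zlim (fun n => / IZR n ^ s * trig a b (PI * IZR n * - rho)) ((if Z.even b then 1 else -1) * (PI ^ s * v))).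
    { apply is_lim_seq_ext with (fun N => (if Z.even b then 1 else -1) * zs N (fun n => / IZR n ^ s * trig a b (PI * IZR n * rho))).
      - intros N. rewrite <- zs_scal. apply zs_ext; intros n.
        replace (PI * IZR n * - rho) with (- (PI * IZR n * rho)) by ring. rewrite trig_neg. ring.
      - apply lim_scal, L. }
    apply is_lim_seq_unique in L'. apply is_lim_seq_unique in L2. rewrite L' in L2. injection L2 as L2.
    assert (P : PI ^ s <> 0) by (apply pow_nonzero, PI_neq0).
    apply Rmult_eq_reg_l with (PI ^ s); [|exact P]. lra. }
  assert (Sv := is_series_psi a b s rho _ Hs Hpar L).
  assert (Hc : exists c, isQ c /\ v / 2 = rho ^ s * c).
  { destruct (Z.even b) eqn:Eb.
    - apply Z.even_spec in Hpar. destruct Hpar as [m Hm].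
      assert (Es : s = (2 * Z.to_nat m)%nat) by lia. rewrite Es.
      assert (Q2 := pow_even_square rho (Z.to_nat m) (proj1 Hd)).
      assert (N0 : rho ^ (2 * Z.to_nat m) <> 0) by (apply pow_nonzero, r0).
      exists (x / 2 / rho ^ (2 * Z.to_nat m)). split; [auto 8 with isq|].
      assert (Ex : v = x) by lra. rewrite Ex. revert N0. generalize (rho ^ (2 * Z.to_nat m)). intros; field; auto.
    - assert (O : Z.odd (Z.of_nat s) = true) by (rewrite <- Z.negb_even, Hpar; reflexivity).
      apply Z.odd_spec in O. destruct O as [m Hm].
      assert (Es : s = (2 * Z.to_nat m + 1)%nat) by lia. rewrite Es, pow_add, pow_1.
      assert (Q2 := pow_even_square rho (Z.to_nat m) (proj1 Hd)).
      assert (N0 : rho ^ (2 * Z.to_nat m) <> 0) by (apply pow_nonzero, r0).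
      exists (y / 2 / rho ^ (2 * Z.to_nat m)). split; [auto 8 with isq|].
      assert (Ex : v = y * rho) by lra. rewrite Ex. revert N0. generalize (rho ^ (2 * Z.to_nat m)). intros; field; auto. }
  destruct Hc as (c & [c' ->] & Ec). exists c'.
  replace ((PI * rho) ^ s * Q2R c') with (PI ^ s * v / 2); [exact Sv|].
  rewrite Rpow_mult_distr, Rmult_assoc, <- Ec. field.
Qed.

Theorem theorem1 (rho : R) (a b s : Z) :
  quad_irrational rho ->
  (Z.max (Z.max a b) 1 + 1 <= s)%Z ->
  Z.even s = Z.even b ->
  (exists v : R, in_Q_adj rho v /\
     is_series (psi_term a b s rho) (powerRZ PI s * v)) /\
  ((exists c : Q, rho ^ 2 = Q2R c) -> (0 <= a + b)%Z ->
   exists c : Q, is_series (psi_term a b s rho) (powerRZ (PI * rho) s * Q2R c)).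

Proof.
  intros Hq Hs Hpar.
  assert (Es : exists n, s = Z.of_nat n) by (exists (Z.to_nat s); lia). destruct Es as [n ->].
  rewrite <- !pow_powerRZ. split.
  - destruct (quad_irrational_Kirr rho Hq) as (de & rho' & Hd & K & F).
    destruct (W1_trig de rho rho' n Hd K ltac:(lia) _ a b (le_n _) ltac:(lia) ltac:(lia)) as (v & v' & Kv & L).
    destruct (F v v' Kv) as (x & y & Hx & Hy & Ev).
    exists (x / 2 + y / 2 * rho). split.
    + apply in_Q_adj_lin; auto with isq.
    + replace (PI ^ n * (x / 2 + y / 2 * rho)) with (PI ^ n * v / 2) by (rewrite Ev; field).
      apply is_series_psi; auto. lia.
  - intros [c Hc] Hab. apply series_value_conjugate; try lia; [|exact Hpar].
    split; [rewrite Hc; apply isQ_Q2R|]. intros [x Ex]. apply (proj2 Hq). exists x. auto.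
Qed.
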